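(* (Lift Theorem.) Let $\mathbb{P}$ and $\hat{\mathbb{P}}$ be partial fields, let $\phi:\hat{\mathbb{P}}\to\mathbb{P}$ be a homomorphism, and let ${}^\uparrow:\mathcal{F}(\mathbb{P})\to\hat{\mathbb{P}}$ be a lifting function for $\phi$. Let $A$ be an $X\times Y$ $\mathbb{P}$-matrix with $X\cap Y=\emptyset$. Then exactly one of the following is true: (i) $A$ has a global ${}^\uparrow$-lift; (ii) $A$ has a minor $B$ such that $B$ has no local ${}^\uparrow$-lift, and $B$ or $B^T$ equals $\begin{bmatrix}0&1&1&1\\1&0&1&1\\1&1&0&1\end{bmatrix}$ or $\begin{bmatrix}1&1&1\\1&p&q\end{bmatrix}$ for some distinct $p,q\in\mathcal{F}(\mathbb{P})\setminus\{0,1\}$.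
   Context: A partial field is a tuple $\mathbb{P}=(P,+,\cdot,0,1)$ where $P$ is a set with distinguished elements $0,1$, $\cdot$ is a binary operation and $+$ a partial binary operation on $P$, such that: (P1) $(P\setminus\{0\},\cdot,1)$ is an abelian group, denoted $\mathbb{P}^*$; (P2) $p+0=p$ for all $p$; (P3) for each $p$ there is a unique $q$ with $p+q=0$, written $-p$; (P4) if $p+q$ is defined then $q+p$ is defined and equals it; (P5) $p(q+r)$ is defined iff $pq+pr$ is defined, and then they are equal; (P6) (associative law) for every finite multiset $S$ of elements of $P$ having an association $T$, every pre-association of $S$ is compatible with $T$. Here a pre-association of a multiset $S$ is a rooted binary tree whose leaves are labelled bijectively by the elements of $S$, in which every non-leaf, non-root node whose children are labelled $u,w$ has $u+w$ defined and is labelled $u+w$; if in addition the sum of the labels of the root's children is defined, labelling the root by it gives an association; a pre-association is compatible with an association with root label $r$ if the sum of the labels of its root's children is defined and equals $r$. A sum $p_1+\dots+p_n$ is defined if for some finite multiset $Z=\{z_1,-z_1,\dots,z_k,-z_k\}$ the multiset $\{p_1,\dots,p_n\}\cup Z$ has an association; its value is the root label. We write $p+q\doteq r$ for ''$p+q$ is defined and equals $r$''. Determinants of square matrices over $\mathbb{P}$ are given by the Leibniz formula and are defined when that sum is defined; a $\mathbb{P}$-matrix is a matrix with entries in $\mathbb{P}$ all of whose square submatrices have defined determinants. A homomorphism $\phi:\mathbb{P}_1\to\mathbb{P}_2$ is a map with $\phi(pq)=\phi(p)\phi(q)$ for all $p,q$ and, whenever $p+q$ is defined, $\phi(p)+\phi(q)\doteq\phi(p+q)$.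 An element $p\in\mathbb{P}$ is fundamental if $1-p\in\mathbb{P}$ (i.e. $1+(-p)$ is defined); $\mathcal{F}(\mathbb{P})$ is the set of fundamental elements. A lifting function for $\phi:\hat{\mathbb{P}}\to\mathbb{P}$ is a map ${}^\uparrow:\mathcal{F}(\mathbb{P})\to\hat{\mathbb{P}}$ such that for all $p,q\in\mathcal{F}(\mathbb{P})$: $\phi(p^\uparrow)=p$; if $p+q\doteq1$ then $p^\uparrow+q^\uparrow\doteq1$; if $pq=1$ then $p^\uparrow q^\uparrow=1$. For an $X\times Y$ matrix $A$ ($X\cap Y=\emptyset$) and $x\in X,y\in Y$ with $A_{xy}\ne0$, the pivot $A^{xy}$ is the $(X\setminus x\cup y)\times(Y\setminus y\cup x)$ matrix with $(A^{xy})_{yx}=A_{xy}^{-1}$, $(A^{xy})_{yv}=A_{xy}^{-1}A_{xv}$ for $v\ne x$, $(A^{xy})_{ux}=-A_{xy}^{-1}A_{uy}$ for $u\ne y$, and $(A^{xy})_{uv}=A_{uv}-A_{xy}^{-1}A_{uy}A_{xv}$ otherwise. A minor of $A$ is any matrix obtained from $A$ by a sequence of: multiplying a row or column by an element of $\mathbb{P}^*$; deleting rows or columns; permuting rows or columns (with their labels); pivoting over a nonzero entry. Two matrices are strongly equivalent ($A\approx A'$) if each is a minor of the other. $A\sim A'$ (scaling-equivalent) means $A'$ is obtained from $A$ by multiplying rows and columns by elements of $\mathbb{P}^*$. $G(A)$ is the bipartite graph on $X\cup Y$ with edge $xy$ iff $A_{xy}\ne0$. A cycle $C$ of $G(A)$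 is induced if $G(A[V(C)])=C$. The signature of $A$ is $\sigma_A(vw)=A_{vw}$ if $v\in X,w\in Y$ and $\sigma_A(vw)=1/A_{wv}$ if $v\in Y,w\in X$; for a cycle $C=(v_0,\dots,v_{2n}=v_0)$, $\sigma_A(C)=(-1)^{|V(C)|/2}\prod_{i=0}^{2n-1}\sigma_A(v_iv_{i+1})$. For a $\mathbb{P}$-matrix $A$ and induced cycle $C$, $\sigma_A(C)\in\mathcal{F}(\mathbb{P})$. A local ${}^\uparrow$-lift of an $X\times Y$ $\mathbb{P}$-matrix $A$ is an $X\times Y$ $\hat{\mathbb{P}}$-matrix $\hat A$ with $\phi(\hat A)\sim A$ such that $\sigma_A(C)^\uparrow=\sigma_{\hat A}(C)$ for every induced cycle $C$ of $G(A)$. A matrix $\hat A$ is a global ${}^\uparrow$-lift of $\phi(\hat A)$ if $\hat A'$ is a local ${}^\uparrow$-lift of $\phi(\hat A')$ for every $\hat A'\approx\hat A$; ''$A$ has a global ${}^\uparrow$-lift'' means some $\hat A$ is a global ${}^\uparrow$-lift of $A=\phi(\hat A)$.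
   Formalization: In (i), ''A has a global lift'' is read up to scaling: some Â is a global lift of φ(Â) with φ(Â) ~ A, not φ(Â) = A (with equality, a 1×1 matrix [a] with a outside the image of φ is a counterexample). Also (P5) is taken for p ≠ 0, and 0·p = 0 is assumed. *)

(* Defs.v *)
From mathcomp Require Import all_boot all_order all_fingroup all_algebra.

Set Implicit Arguments.
Unset Strict Implicit.
Unset Printing Implicit Defensive.

(** Rooted binary trees with labelled leaves.  A multiset is represented by a
    sequence up to [perm_eq]; the label of an internal node is determined by
    the leaves, and is [None] when some sum below that node is undefined. *)
Inductive sum_tree (T : Type) : Type :=
| SumLeaf of T
| SumNode of sum_tree T & sum_tree T.

Section Associations.

Variables (T : eqType) (add : T -> T -> option T).

Fixpoint leaves (t : sum_tree T) : seq T :=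
  match t with
  | SumLeaf p => [:: p]
  | SumNode l r => leaves l ++ leaves r
  end.

Fixpoint root_label (t : sum_tree T) : option T :=
  match t with
  | SumLeaf p => Some p
  | SumNode l r => obind (fun u => obind (add u) (root_label r)) (root_label l)
  end.

Definition pre_association (S : seq T) (t : sum_tree T) : Prop :=
  perm_eq (leaves t) S /\
  match t with
  | SumLeaf _ => True
  | SumNode l r => root_label l <> None /\ root_label r <> None
  end.

Definition association (S : seq T) (t : sum_tree T) (r : T) : Prop :=
  perm_eq (leaves t) S /\ root_label t = Some r.

Definition compatible (t : sum_tree T) (r : T) : Prop :=
  root_label t = Some r.

End Associations.

(** The operations [pf_inv] and [pf_opp] are determined by the axioms, except
    for the irrelevant value [pf_inv 0].

    Two conventions about zero are needed to read the axioms as intended.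
    The group axioms say nothing about products [0 * p] (while [p * 0 = 0] is
    a consequence of the other axioms for [p] nonzero), so [pf_mul0p] is
    explicit.  Distributivity is stated for a nonzero multiplier: for [p = 0],
    "[p(q+r)] is defined iff [pq+pr] is defined" would make every sum [q+r]
    defined, since [0 + 0] is. *)
Record partial_field : Type := PartialField {
  pf_sort :> choiceType;
  pf_zero : pf_sort;
  pf_one : pf_sort;
  pf_mul : pf_sort -> pf_sort -> pf_sort;
  pf_add : pf_sort -> pf_sort -> option pf_sort;
  pf_inv : pf_sort -> pf_sort;
  pf_opp : pf_sort -> pf_sort;
  pf_one_neq0 : pf_one != pf_zero;
  pf_mul_neq0 : forall p q,
    p != pf_zero -> q != pf_zero -> pf_mul p q != pf_zero;
  pf_mulA : forall p q r, p != pf_zero -> q != pf_zero -> r != pf_zero ->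
    pf_mul p (pf_mul q r) = pf_mul (pf_mul p q) r;
  pf_mulC : forall p q, p != pf_zero -> q != pf_zero ->
    pf_mul p q = pf_mul q p;
  pf_mul1p : forall p, p != pf_zero -> pf_mul pf_one p = p;
  pf_inv_neq0 : forall p, p != pf_zero -> pf_inv p != pf_zero;
  pf_mulVp : forall p, p != pf_zero -> pf_mul (pf_inv p) p = pf_one;
  pf_mul0p : forall p, pf_mul pf_zero p = pf_zero;
  pf_addp0 : forall p, pf_add p pf_zero = Some p;
  pf_addpN : forall p, pf_add p (pf_opp p) = Some pf_zero;
  pf_opp_uniq : forall p q, pf_add p q = Some pf_zero -> q = pf_opp p;
  pf_addC : forall p q r, pf_add p q = Some r -> pf_add q p = Some r;
  pf_mulDr : forall p q r, p != pf_zero ->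
    pf_add (pf_mul p q) (pf_mul p r) = omap (pf_mul p) (pf_add q r);
  pf_assoc : forall (S : seq pf_sort) (t : sum_tree pf_sort) (r : pf_sort),
    association pf_add S t r ->
    forall t' : sum_tree pf_sort, pre_association pf_add S t' ->
    compatible pf_add t' r
}.

Arguments pf_zero {_}.
Arguments pf_one {_}.
Arguments pf_mul {_}.
Arguments pf_add {_}.
Arguments pf_inv {_}.
Arguments pf_opp {_}.

Declare Scope pf_scope.
Delimit Scope pf_scope with P.

Notation "0" := pf_zero : pf_scope.
Notation "1" := pf_one : pf_scope.
Notation "p * q" := (pf_mul p q) : pf_scope.
Notation "- p" := (pf_opp p) : pf_scope.
Notation "p ^-1" := (pf_inv p) : pf_scope.
Notation "p + q" := (pf_add p q) : pf_scope.

Local Open Scope pf_scope.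

(** [(-1)^k] is [pf_sign (odd k)], and the sign of a permutation [s] is
    [pf_sign s]. *)
Definition pf_sign (P : partial_field) (b : bool) : P := if b then pf_opp 1 else 1.

(** The sum of the multiset [s] is defined and equals [r]. *)
Definition pf_sum (P : partial_field) (s : seq P) (r : P) : Prop :=
  exists (z : seq P) (t : sum_tree P),
    association pf_add (s ++ z ++ map pf_opp z) t r.

Definition fundamental (P : partial_field) (p : P) : Prop :=
  exists r : P, 1 + (- p) = Some r.

Definition pf_hom (P1 P2 : partial_field) (phi : P1 -> P2) : Prop :=
  (forall p q, phi (p * q) = phi p * phi q) /\
  (forall p q r, p + q = Some r -> phi p + phi q = Some (phi r)).

(** A lifting function is a total function whose values outside the
    fundamental elements are irrelevant. *)
Definition lifting_function (Ph P : partial_field) (phi : Ph -> P)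
    (up : P -> Ph) : Prop :=
  forall p q : P, fundamental p -> fundamental q ->
  [/\ phi (up p) = p,
      p + q = Some 1 -> up p + up q = Some 1
    & p * q = 1 -> up p * up q = 1].

Definition pf_det (P : partial_field) (n : nat) (M : 'M[P]_n) (d : P) : Prop :=
  pf_sum [seq pf_sign P (odd_perm s) * \big[pf_mul/1]_(i < n) M i (s i)
         | s : 'S_n] d.

(** An [X x Y] matrix whose rows and columns are labelled by subsets of a
    common finite type.  Only the entries in [X x Y] are meaningful; [lmx_eq]
    is equality of labelled matrices.  As rows and columns carry labels rather
    than positions, permuting them along with their labels does nothing. *)
Record lmatrix (P : partial_field) (E : finType) : Type := LMatrix {
  lrows : {set E};
  lcols : {set E};
  lentry :> E -> E -> P
}.

Section Matrices.

Variables (P : partial_field) (E : finType).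
Implicit Types A B : lmatrix P E.

Definition lmx_agree A B : Prop :=
  forall x y, x \in lrows B -> y \in lcols B -> A x y = B x y.

Definition lmx_eq A B : Prop :=
  [/\ lrows A = lrows B, lcols A = lcols B & lmx_agree A B].

Definition ltr A : lmatrix P E :=
  LMatrix (lcols A) (lrows A) (fun x y => A y x).

Definition pmatrix A : Prop :=
  forall (n : nat) (f g : 'I_n -> E), injective f -> injective g ->
  (forall i, f i \in lrows A) -> (forall j, g j \in lcols A) ->
  exists d : P, pf_det (\matrix_(i, j) A (f i) (g j)) d.

(** [A] is the unlabelled matrix [M], for suitable orders of its rows and
    columns. *)
Definition displayed_as (m n : nat) A (M : 'M[P]_(m, n)) : Prop :=
  exists (f : 'I_m -> E) (g : 'I_n -> E),
  [/\ injective f, injective g,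
      lrows A = [set f i | i : 'I_m], lcols A = [set g j | j : 'I_n]
    & forall i j, A (f i) (g j) = M i j].

Definition scaling_equiv A B : Prop :=
  [/\ lrows B = lrows A, lcols B = lcols A
    & exists r c : E -> P,
      [/\ forall x, r x != 0, forall y, c y != 0
        & forall x y, x \in lrows A -> y \in lcols A ->
          B x y = r x * A x y * c y]].

(** [B] is the pivot of [A] over [x y]; in general the entries of the pivot
    need not be defined. *)
Definition is_pivot A (x y : E) B : Prop :=
  [/\ [/\ x \in lrows A, y \in lcols A & A x y != 0],
      lrows B = y |: (lrows A :\ x) /\ lcols B = x |: (lcols A :\ y),
      B y x = (A x y)^-1
        /\ (forall v, v \in lcols A :\ y -> B y v = (A x y)^-1 * A x v),
      forall u, u \in lrows A :\ x -> B u x = - ((A x y)^-1 * A u y)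
    & forall u v, u \in lrows A :\ x -> v \in lcols A :\ y ->
        A u v + (- ((A x y)^-1 * A u y * A x v)) = Some (B u v)].

Inductive minor_step A B : Prop :=
| MinorScaleRow (x : E) (a : P) of x \in lrows A & a != 0 &
    lmx_eq B (LMatrix (lrows A) (lcols A)
                (fun u v => if u == x then a * A u v else A u v))
| MinorScaleCol (y : E) (a : P) of y \in lcols A & a != 0 &
    lmx_eq B (LMatrix (lrows A) (lcols A)
                (fun u v => if v == y then a * A u v else A u v))
| MinorDelete of lrows B \subset lrows A & lcols B \subset lcols A &
    lmx_agree A B
| MinorPivot (x y : E) of is_pivot A x y B.

(** [minor A B] : [B] is a minor of [A]. *)
Inductive minor A : lmatrix P E -> Prop :=
| MinorRefl : minor A A
| MinorStep B C of minor A B & minor_step B C : minor A C.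

Definition strongly_equiv A B : Prop := minor A B /\ minor B A.

Definition gadj A : rel E := fun u v =>
  [&& u \in lrows A, v \in lcols A & A u v != 0]
  || [&& v \in lrows A, u \in lcols A & A v u != 0].

(** A cycle is given by its sequence of pairwise distinct vertices; it is
    induced if its edges are all the edges spanned by its vertices. *)
Definition induced_cycle A (c : seq E) : Prop :=
  [/\ 2 < size c, ucycle (gadj A) c
    & forall u v, u \in c -> v \in c ->
      gadj A u v = (v == next c u) || (u == next c v)].

Definition edge_signature A (v w : E) : P :=
  if v \in lrows A then A v w else (A w v)^-1.

Definition cycle_signature A (c : seq E) : P :=
  pf_sign P (odd (size c)./2)
  * \big[pf_mul/1]_(v <- c) edge_signature A v (next c v).

End Matrices.

Section Lifts.

Variables (P Ph : partial_field) (phi : Ph -> P) (up : P -> Ph) (E : finType).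

Definition map_lmx (Ah : lmatrix Ph E) : lmatrix P E :=
  LMatrix (lrows Ah) (lcols Ah) (fun x y => phi (Ah x y)).

Definition local_lift (A : lmatrix P E) (Ah : lmatrix Ph E) : Prop :=
  [/\ pmatrix Ah, scaling_equiv (map_lmx Ah) A
    & forall c : seq E, induced_cycle A c ->
      up (cycle_signature A c) = cycle_signature Ah c].

Definition global_lift (Ah : lmatrix Ph E) : Prop :=
  forall Ah' : lmatrix Ph E, strongly_equiv Ah' Ah ->
  local_lift (map_lmx Ah') Ah'.

Definition has_local_lift (A : lmatrix P E) : Prop :=
  exists Ah : lmatrix Ph E, local_lift A Ah.

(** As for local lifts, [phi Ah] is compared with [A] up to scaling.  Scaling
    factors need not lie in the image of [phi]: when they do not, a one by one
    matrix [a] can be the image of no matrix at all, although it contains no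
    obstruction to lifting. *)
Definition has_global_lift (A : lmatrix P E) : Prop :=
  exists Ah : lmatrix Ph E, scaling_equiv (map_lmx Ah) A /\ global_lift Ah.

End Lifts.

Definition seqs_mx (P : partial_field) (m n : nat) (s : seq (seq P)) :
    'M[P]_(m, n) :=
  \matrix_(i, j) nth 0 (nth [::] s i) j.

Definition obstruction1 (P : partial_field) : 'M[P]_(3, 4) :=
  seqs_mx 3 4 [:: [:: 0; 1; 1; 1];
                  [:: 1; 0; 1; 1];
                  [:: 1; 1; 0; 1]].

Definition obstruction2 (P : partial_field) (p q : P) : 'M[P]_(2, 3) :=
  seqs_mx 2 3 [:: [:: 1; 1; 1];
                  [:: 1; p; q]].

Definition is_obstruction (P : partial_field) (E : finType)
    (B : lmatrix P E) : Prop :=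
  displayed_as B (obstruction1 P) \/
  exists p q : P,
    [/\ fundamental p, fundamental q, p \notin [:: 0; 1],
        q \notin [:: 0; 1] & p != q] /\
    displayed_as B (obstruction2 p q).

(* Main.v *)
Require Import Defs.
From HB Require Import structures.
From mathcomp Require Import all_boot all_order all_fingroup all_algebra.
From mathcomp Require Import boolp ring zify.

Set Implicit Arguments.
Unset Strict Implicit.
Unset Printing Implicit Defensive.

Import GRing.Theory.

(** By (P6), a partial field embeds in the commutative ring of formal sums of
    its elements modulo those whose sum is [0], and [p + q = r] holds in the
    partial field iff it holds in the ring.  So all matrices may be taken over
    commutative rings, with entries in a distinguished subset; being a matrix
    over the partial field then means that no sequence of pivots leads out of
    that subset.

    Pivoting on an edge of an induced cycle shortens it by two and preserves
    its signature.  Hence a matrix is a global lift of its image iff, after any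
    sequence of pivots, every cross ratio of a 2 x 2 submatrix is the lift of
    its own image.  Such a matrix is determined by its image up to scaling.

    If [A] has no obstruction, a global lift is built by induction on the number
    of rows and columns.  Disconnected matrices split.  A connected one has,
    possibly after a pivot and up to transposition, two columns [x], [y] whose
    removal leaves it connected: two of three leaves of a spanning tree lie in
    the same class.  The lifts of [A - x] and [A - y] agree on [A - {x, y}], so
    they glue to a candidate, whose cross ratios could only be bad in rows
    [a], [b] and columns [x], [y].  Following a path from [a] to [b] in
    [A - {x, y}], such a cross ratio is reduced to the quotient of two good ones
    on a five-point line, where the second kind of obstruction is excluded, or
    to [-1] in a non-Fano configuration, where the first kind is. *)

(** * The ring of a partial field *)

(** In the ring a pivot is a total function, and a state is determined by its basis together with
    the row space of [I | M]. This makes arguments by deletion possible: a state of the whole matrix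
    whose basis avoids a column restricts to a state of the matrix without it, even if the pivots
    leading there moved that column in and out. The difficulty is a column x or y that has entered
    the basis. It is pivoted out again and cross ratios are compared before and after: a pivot
    inside the 2 x 2 submatrix turns c into 1 - c, a pivot elsewhere changes nothing when suitable
    zeros block it, and otherwise a third row or column expresses the ratio as a quotient of known
    ones. The axioms of a lifting function control 1 - c and inverses but say nothing about
    products, so quotients are where an obstruction can enter. The value -1 comes from the one
    configuration in which three choices of pivots all fail to give a third row that is nonzero in
    both columns; the three vanishing entries are equations that force it. *)

Section PartialFieldTheory.

Variable P : partial_field.
Implicit Types (p q r : P) (s t z : seq P).
Local Open Scope pf_scope.

(** The element z = p * 0 satisfies z + z = z, and (P6) reassociates z + z - z to cancel it.
    Distributivity holds only for a nonzero multiplier, so p = 0 is treated apart. *)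
Lemma pf_mulp0 p : p * 0 = 0 :> P.
Proof.
have [->|p0] := eqVneq p 0; first exact: pf_mul0p.
set z := p * 0.
have zz : z + z = Some z by rewrite /z pf_mulDr // pf_addp0.
pose T1 := SumNode (SumNode (SumLeaf z) (SumLeaf z)) (SumLeaf (- z)).
pose T2 := SumNode (SumLeaf z) (SumNode (SumLeaf z) (SumLeaf (- z))).
have h1 : association pf_add [:: z; z; - z] T1 0.
  by split=> //=; rewrite zz /= pf_addpN.
have h2 : pre_association pf_add [:: z; z; - z] T2.
  by split=> //=; split=> //; rewrite pf_addpN.
have := pf_assoc h1 h2; rewrite /compatible /= pf_addpN /= pf_addp0.
by case.
Qed.

Lemma pf_mulCt p q : p * q = q * p.
Proof.
have [->|p0] := eqVneq p 0; first by rewrite pf_mul0p pf_mulp0.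
have [->|q0] := eqVneq q 0; first by rewrite pf_mul0p pf_mulp0.
exact: pf_mulC.
Qed.

Lemma pf_mulAt p q r : p * (q * r) = p * q * r.
Proof.
have [->|p0] := eqVneq p 0; first by rewrite !pf_mul0p.
have [->|q0] := eqVneq q 0; first by rewrite !(pf_mul0p, pf_mulp0).
have [->|r0] := eqVneq r 0; first by rewrite !pf_mulp0.
exact: pf_mulA.
Qed.

Lemma pf_mul1t p : 1 * p = p.
Proof.
have [->|p0] := eqVneq p 0; first exact: pf_mulp0.
exact: pf_mul1p.
Qed.

Lemma pf_opp0 : - (0 : P) = 0.
Proof. by apply/esym/pf_opp_uniq; rewrite pf_addp0. Qed.

Lemma pf_mulpN p q : p * - q = - (p * q).
Proof.
have [->|p0] := eqVneq p 0; first by rewrite !pf_mul0p pf_opp0.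
by apply: pf_opp_uniq; rewrite pf_mulDr // pf_addpN /= pf_mulp0.
Qed.

Lemma pf_mulNp p q : (- p) * q = - (p * q).
Proof. by rewrite pf_mulCt pf_mulpN pf_mulCt. Qed.

Lemma pf_oppK p : - - p = p.
Proof. by apply/esym/pf_opp_uniq/pf_addC; rewrite pf_addpN. Qed.

Lemma pf_add0p p : 0 + p = Some p.
Proof. by apply: pf_addC; rewrite pf_addp0. Qed.

Definition zero_sum s : Prop := pf_sum s (0 : P).

Lemma pf_sum_perm s s' r : perm_eq s s' -> pf_sum s r -> pf_sum s' r.
Proof.
move=> ss' [z [t [h1 h2]]]; exists z, t; split=> //.
by apply: perm_trans h1 _; rewrite perm_cat2r.
Qed.

Lemma pf_sum_cancel s z r : pf_sum (s ++ z ++ map pf_opp z) r -> pf_sum s r.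
Proof.
move=> [z' [t [h1 h2]]]; exists (z ++ z'), t; split=> //.
apply: perm_trans h1 _; rewrite map_cat -!catA perm_cat2l perm_cat2l.
by rewrite perm_catCA.
Qed.

Lemma pf_sum_cat s s' r r' q : pf_sum s r -> pf_sum s' r' -> r + r' = Some q ->
  pf_sum (s ++ s') q.
Proof.
move=> [z [t [h1 h2]]] [z' [t' [h1' h2']]] rr'.
exists (z ++ z'), (SumNode t t'); split; last by rewrite /= h2 h2'.
apply: perm_trans (perm_cat h1 h1') _.
by apply/seq.permP=> a; rewrite map_cat !count_cat; lia.
Qed.

Lemma zero_sum_pair p : zero_sum [:: p; - p].
Proof.
exists [::], (SumNode (SumLeaf p) (SumLeaf (- p))).
by split=> //=; rewrite pf_addpN.
Qed.

Lemma zero_sum_cat s s' : zero_sum s -> zero_sum s' -> zero_sum (s ++ s').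
Proof. by move=> hs hs'; apply: pf_sum_cat hs hs' _; rewrite pf_addp0. Qed.

(** A tree has at least one leaf, so the empty sum gets its value from the cancelling pair 0, -0. *)
Lemma zero_sum_nil : zero_sum [::].
Proof. by apply: (@pf_sum_cancel _ [:: 0]); apply: zero_sum_pair. Qed.

Lemma zero_sum_opp s : zero_sum (s ++ map pf_opp s).
Proof.
elim: s => [|p s ih]; first exact: zero_sum_nil.
apply: pf_sum_perm (zero_sum_cat (zero_sum_pair p) ih).
by apply/seq.permP=> a; rewrite /= !count_cat /=; lia.
Qed.

Fixpoint map_tree (f : P -> P) (t : sum_tree P) : sum_tree P :=
  match t with
  | SumLeaf p => SumLeaf (f p)
  | SumNode l r => SumNode (map_tree f l) (map_tree f r)
  end.

Lemma leaves_map f (t : sum_tree P) : leaves (map_tree f t) = map f (leaves t).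
Proof. by elim: t => //= l -> r ->; rewrite map_cat. Qed.

Lemma root_label_map p (t : sum_tree P) : p != 0 ->
  root_label pf_add (map_tree (pf_mul p) t)
  = omap (pf_mul p) (root_label pf_add t).
Proof.
move=> p0; elim: t => //= l -> r ->.
case: (root_label pf_add l) => //= u; case: (root_label pf_add r) => //= v.
by rewrite pf_mulDr.
Qed.

Lemma zero_sum_mul p s : zero_sum s -> zero_sum (map (pf_mul p) s).
Proof.
have [->|p0] := eqVneq p 0.
  move=> _; elim: s => [|q s ih]; first exact: zero_sum_nil.
  rewrite /= pf_mul0p; apply: (@zero_sum_cat [:: 0] _ _ ih).
  by exists [::], (SumLeaf 0).
move=> [z [t [h1 h2]]]; exists (map (pf_mul p) z), (map_tree (pf_mul p) t).
split; last by rewrite root_label_map // h2 /= pf_mulp0.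
rewrite leaves_map; apply: perm_trans (perm_map _ h1) _.
rewrite !map_cat perm_cat2l perm_cat2l -!map_comp.
by rewrite (eq_map (fun q => pf_mulpN p q)).
Qed.

Lemma zero_sum_mapN s : zero_sum s -> zero_sum (map pf_opp s).
Proof.
move=> /(zero_sum_mul (pf_opp pf_one)); rewrite (eq_map (g := pf_opp)) // => p.
by rewrite pf_mulNp pf_mul1t.
Qed.

(* Once [r + (z_1 - z_1) + ...] has been added, (P6) turns a cancelling
   association of [p, q, -r, ...] into an association of [p] with [q]. *)
Lemma zero_sum_add p q r : zero_sum [:: p; q; - r] <-> p + q = Some r.
Proof.
split=> [[z [t [h1 h2]]]|pq]; last first.
  exists [::], (SumNode (SumNode (SumLeaf p) (SumLeaf q)) (SumLeaf (- r))).
  by split=> //=; rewrite pq /= pf_addpN.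
pose W := foldr (fun x T => SumNode T (SumNode (SumLeaf x) (SumLeaf (- x))))
  (SumNode (SumLeaf r) (SumLeaf (- r))) z.
have WE : root_label pf_add W = Some 0.
  rewrite /W; elim: (z) => [|x z' ih] /=; first by rewrite pf_addpN.
  by rewrite ih /= pf_addpN /= pf_addp0.
have WL : perm_eq (leaves W) ([:: r; - r] ++ z ++ map pf_opp z).
  rewrite /W; elim: (z) => [|x z' ih] //=.
  apply/seq.permP=> a; rewrite count_cat (seq.permP ih) /= !count_cat /=; lia.
have hT : association pf_add ([:: p; q; - r; r] ++ z ++ map pf_opp z)
    (SumNode t (SumLeaf r)) r.
  split; last by rewrite /= h2 /= pf_add0p.
  by apply/seq.permP=> a; rewrite /= count_cat (seq.permP h1) /= !count_cat /=; lia.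
(* The root is the one sum whose definedness (P6) provides, so p is placed opposite q + W there; W
   has value 0, hence the right child has label q. *)
have {hT} := pf_assoc hT; move=> /(_ (SumNode (SumLeaf p) (SumNode (SumLeaf q) W))).
rewrite /compatible /pre_association /= WE /= pf_addp0; apply; split=> //.
by apply/seq.permP=> a; rewrite /= (seq.permP WL) /= !count_cat /=; lia.
Qed.

Lemma zero_sum_mulr s t : zero_sum s -> zero_sum (allpairs pf_mul s t).
Proof.
move=> hs; elim: t => [|q t ih].
  rewrite (_ : allpairs _ _ _ = [::]); first exact: zero_sum_nil.
  by rewrite /allpairs; elim: s {hs} => //= x s ->.
apply: pf_sum_perm (zero_sum_cat (zero_sum_mul q hs) ih).
rewrite perm_sym; have /permPl := perm_allpairs_consr pf_mul s (fun=> q) (fun=> t).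
move=> /perm_trans; apply.
by rewrite (eq_map (pf_mulCt q)).
Qed.

End PartialFieldTheory.

(** * The quotient ring of formal sums and the embedding of the partial field *)

Section PartialFieldRing.

Variable P : partial_field.
Implicit Types (s t z : seq P).

(* A formal sum is the sequence of its terms. *)
Definition sum_equiv : rel (seq P) :=
  fun s t => `[< zero_sum (s ++ map pf_opp t) >].

Lemma sum_equiv_refl : reflexive sum_equiv.
Proof. by move=> s; apply/asboolP/zero_sum_opp. Qed.

Lemma sum_equiv_sym : symmetric sum_equiv.
Proof.
suff h s t : sum_equiv s t -> sum_equiv t s by move=> s t; apply/idP/idP; apply: h.
move=> /asboolP /zero_sum_mapN h; apply/asboolP.
apply: pf_sum_perm h; rewrite map_cat -map_comp (eq_map (@pf_oppK P)) map_id.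
by rewrite perm_catC.
Qed.

Lemma sum_equiv_trans : transitive sum_equiv.
Proof.
move=> t s u /asboolP h1 /asboolP h2; apply/asboolP.
apply: (@pf_sum_cancel _ _ t); apply: pf_sum_perm (zero_sum_cat h1 h2).
by apply/seq.permP=> a; rewrite !count_cat; lia.
Qed.

Canonical sum_equiv_equiv :=
  EquivRel sum_equiv sum_equiv_refl sum_equiv_sym sum_equiv_trans.

Definition pfring : Type := {eq_quot sum_equiv}%qT.
HB.instance Definition _ := Choice.on pfring.

Definition cl (s : seq P) : pfring := (\pi_{eq_quot sum_equiv} s)%qT.
Definition rep (x : pfring) : seq P := generic_quotient.repr (x : {eq_quot sum_equiv}%qT).

Lemma repK x : cl (rep x) = x.
Proof. exact: reprK. Qed.

Lemma clP s t : cl s = cl t <-> zero_sum (s ++ map pf_opp t).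
Proof.
split=> [/eqmodP /asboolP //|h]; apply/eqmodP; exact/asboolP.
Qed.

Lemma cl_perm s t : perm_eq s t -> cl s = cl t.
Proof.
move=> st; apply/clP; apply: pf_sum_perm (zero_sum_opp t).
by rewrite perm_cat2r perm_sym.
Qed.

Definition pfr_add (x y : pfring) := cl (rep x ++ rep y).
Definition pfr_opp (x : pfring) := cl (map pf_opp (rep x)).
Definition pfr_mul (x y : pfring) := cl (allpairs pf_mul (rep x) (rep y)).

Lemma cl_add s t : pfr_add (cl s) (cl t) = cl (s ++ t).
Proof.
have /clP h1 := repK (cl s); have /clP h2 := repK (cl t).
apply/clP; apply: pf_sum_perm (zero_sum_cat h1 h2).
by apply/seq.permP=> a; rewrite map_cat !count_cat; lia.
Qed.

Lemma cl_opp s : pfr_opp (cl s) = cl (map pf_opp s).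
Proof.
have /clP /zero_sum_mapN h := repK (cl s).
by apply/clP; rewrite -map_cat.
Qed.

Lemma pfmulsC s t : perm_eq (allpairs pf_mul s t) (allpairs pf_mul t s).
Proof.
elim: t s => [|q t ih] s; first by elim: s.
have /permPl := perm_allpairs_consr pf_mul s (fun=> q) (fun=> t).
move=> /perm_trans; apply.
rewrite /= (eq_map (fun p => pf_mulCt p q)) perm_cat2l; exact: ih.
Qed.

Lemma cl_mull s s' t :
  cl s = cl s' -> cl (allpairs pf_mul s t) = cl (allpairs pf_mul s' t).
Proof.
move=> /clP /(zero_sum_mulr t) h; apply/clP; apply: pf_sum_perm h.
rewrite /allpairs allpairs_cat allpairs_mapl map_allpairs perm_cat2l.
by rewrite (eq_allpairs (f2 := fun p q => pf_opp (pf_mul p q))) // => p q; rewrite pf_mulNp.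
Qed.

Lemma cl_mul s t : pfr_mul (cl s) (cl t) = cl (allpairs pf_mul s t).
Proof.
rewrite /pfr_mul (cl_mull _ (repK (cl s))) (cl_perm (pfmulsC _ _)).
by rewrite (cl_mull _ (repK (cl t))) (cl_perm (pfmulsC _ _)).
Qed.

Lemma pfr_addA : associative pfr_add.
Proof.
by move=> x y z; rewrite -(repK x) -(repK y) -(repK z) !cl_add catA.
Qed.

Lemma pfr_addC : commutative pfr_add.
Proof.
move=> x y; rewrite -(repK x) -(repK y) !cl_add; apply: cl_perm.
by rewrite perm_catC.
Qed.

Lemma pfr_add0 : left_id (cl [::]) pfr_add.
Proof. by move=> x; rewrite -(repK x) cl_add. Qed.

Lemma pfr_addN : left_inverse (cl [::]) pfr_opp pfr_add.
Proof.
move=> x; rewrite -(repK x) cl_opp cl_add; apply/clP; rewrite cats0.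
by apply: pf_sum_perm (zero_sum_opp (rep x)); rewrite perm_catC.
Qed.

HB.instance Definition _ :=
  GRing.isZmodule.Build pfring pfr_addA pfr_addC pfr_add0 pfr_addN.

Lemma pfr_mulA : associative pfr_mul.
Proof.
move=> x y z; rewrite -(repK x) -(repK y) -(repK z) !cl_mul; congr cl.
rewrite /allpairs; elim: (rep x) => //= p s ->; rewrite allpairs_cat; congr (_ ++ _).
rewrite allpairs_mapl map_allpairs.
by apply: eq_allpairs => q r; rewrite pf_mulAt.
Qed.

Lemma pfr_mulC : commutative pfr_mul.
Proof.
by move=> x y; rewrite -(repK x) -(repK y) !cl_mul; apply/cl_perm/pfmulsC.
Qed.

Lemma pfr_mul1 : left_id (cl [:: pf_one]) pfr_mul.
Proof.
move=> x; rewrite -(repK x) cl_mul /= cats0 (eq_map (@pf_mul1t P)).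
by rewrite map_id.
Qed.

Lemma pfr_mulDl : left_distributive pfr_mul pfr_add.
Proof.
move=> x y z; rewrite -(repK x) -(repK y) -(repK z).
by rewrite cl_add !cl_mul cl_add /allpairs allpairs_cat.
Qed.

(** If the classes agreed, the formal sum of p, 0, -0 would vanish, and [zero_sum_add] would give p
    + 0 = 0 inside the partial field. *)
Lemma cl_neq0 (p : P) : p != pf_zero -> cl [:: p] != cl [::].
Proof.
apply: contraNneq => h; apply/eqP.
have : cl ([:: p] ++ [:: pf_zero; pf_opp pf_zero]) = cl [::].
  by rewrite -cl_add h cl_add; apply/clP; rewrite cats0; apply: zero_sum_pair.
move=> /clP; rewrite cats0 => /zero_sum_add.
by rewrite pf_addp0 => -[].
Qed.

Lemma pfr_1neq0 : cl [:: pf_one] != 0%R.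
Proof. exact/cl_neq0/pf_one_neq0. Qed.

HB.instance Definition _ := GRing.Zmodule_isComNzRing.Build pfring
  pfr_mulA pfr_mulC pfr_mul1 pfr_mulDl pfr_1neq0.

Local Open Scope ring_scope.

Definition pfr_unit : {pred pfring} := fun x => `[< exists y, y * x = 1 >].

Definition pfr_inv (x : pfring) : pfring :=
  if pselect (exists y, y * x = 1) is left h then sval (cid h) else x.

Lemma pfr_mulVx : {in pfr_unit, left_inverse 1 pfr_inv *%R}.
Proof.
move=> x /asboolP hx; rewrite /pfr_inv; case: pselect => // h.
exact: svalP (cid h).
Qed.

Lemma pfr_unitPl x y : y * x = 1 -> pfr_unit x.
Proof. by move=> h; apply/asboolP; exists y. Qed.

Lemma pfr_invr_out : {in [predC pfr_unit], pfr_inv =1 id}.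
Proof.
move=> x /= h; rewrite /pfr_inv; case: pselect => // h'.
by move: h; rewrite inE /= => /negP []; apply/asboolP.
Qed.

HB.instance Definition _ := GRing.ComNzRing_hasMulInverse.Build pfring
  pfr_mulVx pfr_unitPl pfr_invr_out.

Definition pfin (p : P) : pfring := cl [:: p].

Lemma pfin0 : pfin pf_zero = 0.
Proof. by apply/clP; exists [::], (SumLeaf pf_zero). Qed.

Lemma pfin1 : pfin pf_one = 1. Proof. by []. Qed.

Lemma pfinM p q : pfin (pf_mul p q) = pfin p * pfin q.
Proof. by apply/esym; apply: etrans (cl_mul _ _) _. Qed.

Lemma pfinN p : pfin (pf_opp p) = - pfin p.
Proof. by apply/esym; apply: etrans (cl_opp _) _. Qed.

Lemma pfinD p q r : pfin p + pfin q = pfin r <-> pf_add p q = Some r.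
Proof.
have -> : pfin p + pfin q = cl [:: p; q] by apply: etrans (cl_add _ _) _.
by rewrite -zero_sum_add; apply: clP.
Qed.

Lemma pfin_inj : injective pfin.
Proof.
move=> p q h; have : pfin p + pfin pf_zero = pfin q by rewrite pfin0 addr0.
by move=> /pfinD; rewrite pf_addp0 => -[].
Qed.

Lemma cl_sum s : cl s = \sum_(p <- s) pfin p.
Proof.
elim: s => [|p s ih]; first by rewrite big_nil.
by rewrite big_cons -ih; apply/esym; apply: etrans (cl_add _ _) _.
Qed.

(** The cancelling pairs that [pf_sum] allows are exactly what turns definedness of a sum into
    membership of its ring value in the image of [pfin]. Determinants translate through this. *)
Lemma pfin_sum s r : \sum_(p <- s) pfin p = pfin r <-> pf_sum s r.
Proof.
rewrite -cl_sum; split=> [/clP h|h].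
  apply: (@pf_sum_cancel _ _ [:: r]).
  have hr : pf_sum [:: r] r by exists [::], (SumLeaf r).
  apply: pf_sum_perm (pf_sum_cat h hr (pf_add0p r)).
  by apply/seq.permP=> a; rewrite !count_cat; lia.
apply/clP; apply: pf_sum_cat h _ (pf_addpN r).
by exists [::], (SumLeaf (pf_opp r)).
Qed.

End PartialFieldRing.

(** * Extension of homomorphisms to the rings *)

Section Homomorphism.

Variables (Ph P : partial_field) (phi : Ph -> P) (up : P -> Ph).
Hypotheses (hphi : pf_hom phi) (hup : lifting_function phi up).
Local Open Scope ring_scope.

Lemma fundamental0 (Q : partial_field) : @fundamental Q pf_zero.
Proof. by exists pf_one; rewrite pf_opp0 pf_addp0. Qed.

Lemma fundamental1 (Q : partial_field) : @fundamental Q pf_one.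
Proof. by exists pf_zero; rewrite pf_addpN. Qed.

Lemma pf_hom0 : phi pf_zero = pf_zero.
Proof.
have [h _ _] := hup (fundamental0 P) (fundamental0 P).
by rewrite -(pf_mul0p (up pf_zero)) hphi.1 h pf_mulp0.
Qed.

(** The constant map 0 satisfies [pf_hom]; it is excluded because the lifting function provides a
    preimage of 1. *)
Lemma pf_hom1 : phi pf_one = pf_one.
Proof.
have [h _ _] := hup (fundamental1 P) (fundamental1 P).
by rewrite -[LHS]pf_mul1t pf_mulCt -{1}h -hphi.1 pf_mul1t.
Qed.

Lemma pf_homN p : phi (pf_opp p) = pf_opp (phi p).
Proof. by apply: pf_opp_uniq; rewrite (hphi.2 _ _ _ (pf_addpN p)) pf_hom0. Qed.

Lemma zero_sum_hom s : zero_sum s -> zero_sum (map phi s).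
Proof.
move=> [z [t [h1 h2]]].
pose mt := fix mt (t : sum_tree Ph) : sum_tree P := match t with
  | SumLeaf p => SumLeaf (phi p) | SumNode l r => SumNode (mt l) (mt r) end.
have mtL u : leaves (mt u) = map phi (leaves u).
  by elim: u => //= l -> r ->; rewrite map_cat.
have mtR u r : root_label pf_add u = Some r ->
    root_label pf_add (mt u) = Some (phi r).
  elim: u r => [p|l ihl r' ihr] r /=; first by move=> [->].
  case El : (root_label _ l) => [a|//] /=; case Er : (root_label _ r') => [b|//] /=.
  by move=> /hphi.2; rewrite (ihl _ El) /= (ihr _ Er).
exists (map phi z), (mt t); split; last by rewrite (mtR _ _ h2) pf_hom0.
rewrite mtL; apply: perm_trans (perm_map _ h1) _.
by rewrite !map_cat -!map_comp (eq_map pf_homN).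
Qed.

Definition ring_hom (x : pfring Ph) : pfring P := cl (map phi (rep x)).

Lemma ring_hom_cl s : ring_hom (cl s) = cl (map phi s).
Proof.
have /clP /zero_sum_hom h := repK (cl s).
apply/clP; move: h; rewrite map_cat -!map_comp.
by rewrite (eq_map pf_homN).
Qed.

Lemma ring_hom_in p : ring_hom (pfin p) = pfin (phi p).
Proof. exact: ring_hom_cl. Qed.

Lemma ring_hom_add : zmod_morphism ring_hom.
Proof.
move=> x y; rewrite -(repK x) -(repK y).
have E (Q : partial_field) (s t : seq Q) :
    cl s - cl t = cl (s ++ map pf_opp t) :> pfring Q.
  by apply: etrans (congr1 _ (cl_opp t)) _; apply: etrans (cl_add _ _) _.
by rewrite E !ring_hom_cl E map_cat -!map_comp (eq_map pf_homN).
Qed.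

Lemma ring_hom_mul : monoid_morphism ring_hom.
Proof.
split; first by rewrite -[1%R]/(cl [:: pf_one]) ring_hom_cl /= pf_hom1.
move=> x y; rewrite -(repK x) -(repK y).
have E (Q : partial_field) (s t : seq Q) :
  cl s * cl t = cl (allpairs pf_mul s t) :> pfring Q by apply: etrans (cl_mul _ _) _.
rewrite E !ring_hom_cl E /allpairs map_allpairs allpairs_mapl allpairs_mapr.
by congr cl; apply: eq_allpairs => p q; rewrite hphi.1.
Qed.

HB.instance Definition _ :=
  GRing.isZmodMorphism.Build (pfring Ph) (pfring P) ring_hom ring_hom_add.
HB.instance Definition _ :=
  GRing.isMonoidMorphism.Build (pfring Ph) (pfring P) ring_hom ring_hom_mul.

Definition ring_rmorphism : {rmorphism pfring Ph -> pfring P} := ring_hom.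

End Homomorphism.

Local Open Scope ring_scope.

(** * Pivots *)

(* The image of a partial field in its ring: zero together with a group of
   units that contains -1. *)
Record pfset (R : comUnitRingType) (S : R -> Prop) : Prop := PfSet {
  ps0 : S 0;
  ps1 : S 1;
  psN : forall x, S x -> S (- x);
  psM : forall x y, S x -> S y -> S (x * y);
  psV : forall x, S x -> S x^-1;
  psU : forall x, S x -> x != 0 -> x \is a GRing.unit
}.

Section Pivots.

Variables (R : comUnitRingType) (S : R -> Prop) (E : finType).
Hypothesis HS : pfset S.
Implicit Types (M N : E -> E -> R) (X Y : {set E}) (x y u v : E).

(** The pivot acts on all of [E], so rows and columns outside the current label sets are transformed
    along. Hence pivots of a submatrix are literally pivots of any larger matrix ([reach_sub],
    [reach_addcols]). *)
Definition piv M x y : E -> E -> R := fun u v =>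
  if u == y then (if v == x then (M x y)^-1 else (M x y)^-1 * M x v)
  else if v == x then - ((M x y)^-1 * M u y)
  else M u v - (M x y)^-1 * M u y * M x v.

Lemma piv_yx M x y : piv M x y y x = (M x y)^-1.
Proof. by rewrite /piv !eqxx. Qed.

Lemma piv_yv M x y v : v != x -> piv M x y y v = (M x y)^-1 * M x v.
Proof. by rewrite /piv eqxx => /negPf ->. Qed.

Lemma piv_ux M x y u : u != y -> piv M x y u x = - ((M x y)^-1 * M u y).
Proof. by rewrite /piv eqxx => /negPf ->. Qed.

Lemma piv_uv M x y u v : u != y -> v != x ->
  piv M x y u v = M u v - (M x y)^-1 * M u y * M x v.
Proof. by rewrite /piv => /negPf -> /negPf ->. Qed.

(** Only pivots are recorded: scalings are absorbed by [seqv], and deletions by [sub_closed]. *)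
Inductive reach X Y M : {set E} -> {set E} -> (E -> E -> R) -> Prop :=
| reach0 : reach X Y M X Y M
| reachS X' Y' M' x y of reach X Y M X' Y' M' & x \in X' & y \in Y'
    & M' x y \is a GRing.unit :
    reach X Y M (y |: X' :\ x) (x |: Y' :\ y) (piv M' x y).

Lemma reach1 X Y M x y : x \in X -> y \in Y -> M x y \is a GRing.unit ->
  reach X Y M (y |: X :\ x) (x |: Y :\ y) (piv M x y).
Proof. by move=> *; apply: reachS => //; apply: reach0. Qed.

Lemma reach_trans X Y M X1 Y1 M1 X2 Y2 M2 : reach X Y M X1 Y1 M1 ->
  reach X1 Y1 M1 X2 Y2 M2 -> reach X Y M X2 Y2 M2.
Proof. by move=> h; elim=> // X' Y' M' x y _ ih *; apply: reachS. Qed.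

Lemma disj_neq X Y x y : [disjoint X & Y] -> x \in X -> y \in Y -> x != y.
Proof.
move=> d xX yY; apply: contraL yY => /eqP <-.
by rewrite (disjointFr d xX).
Qed.

Lemma disj_piv X Y x y : [disjoint X & Y] -> x \in X -> y \in Y ->
  [disjoint y |: X :\ x & x |: Y :\ y].
Proof.
move=> d xX yY; have xy := disj_neq d xX yY.
rewrite disjoint_subset; apply/subsetP => u; rewrite !inE negb_or negb_and.
case: (eqVneq u y) => [->|uy] /=; first by rewrite eq_sym xy.
by case/andP=> ux uX; rewrite ux (disjointFr d uX).
Qed.

Lemma reach_disj X Y M X' Y' M' : reach X Y M X' Y' M' ->
  [disjoint X & Y] -> [disjoint X' & Y'].
Proof. by move=> h d; elim: h => // *; apply: disj_piv. Qed.

Lemma reach_cover X Y M X' Y' M' : reach X Y M X' Y' M' ->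
  X' :|: Y' = X :|: Y.
Proof.
elim=> // X1 Y1 M1 x y _ <- xX yY _; apply/setP => u; rewrite !inE.
case: (eqVneq u x) => [e1|_]; case: (eqVneq u y) => [e2|_];
by rewrite ?e1 ?e2 ?xX ?yY /= ?orbT.
Qed.

Lemma reach_card X Y M X' Y' M' : reach X Y M X' Y' M' ->
  [disjoint X & Y] -> (#|X'| = #|X|) /\ (#|Y'| = #|Y|).
Proof.
move=> h d; elim: h => // X1 Y1 M1 x y h1 [ih1 ih2] xX yY _.
have d1 := reach_disj h1 d.
rewrite !cardsU1 !inE (disjointFr d1 xX) (disjointFl d1 yY) !andbF /= -ih1 -ih2.
by rewrite (cardsD1 x X1) xX (cardsD1 y Y1) yY.
Qed.

Definition su (a : R) := S a /\ a \is a GRing.unit.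

Lemma su1 : su 1. Proof. by split; [apply: ps1|apply: unitr1]. Qed.
Lemma suM a b : su a -> su b -> su (a * b).
Proof. by move=> [? ?] [? ?]; split; [apply: psM|rewrite unitrM; apply/andP]. Qed.
Lemma suV a : su a -> su a^-1.
Proof. by move=> [? ?]; split; [apply: psV|rewrite unitrV]. Qed.
Lemma suN a : su a -> su (- a).
Proof. by move=> [? ?]; split; [apply: psN|rewrite unitrN]. Qed.

Definition seqv X Y M N := exists r c : E -> R,
  [/\ forall u, su (r u), forall v, su (c v)
    & forall u v, u \in X -> v \in Y -> N u v = r u * M u v * c v].

Lemma seqv_agree X Y M N :
  (forall u v, u \in X -> v \in Y -> N u v = M u v) -> seqv X Y M N.
Proof.
move=> h; exists (fun _ => 1), (fun _ => 1).
by split=> [_|_|u v uX vY]; rewrite ?mul1r ?mulr1; [apply: su1|apply: su1|apply: h].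
Qed.

Lemma seqv_refl X Y M : seqv X Y M M.
Proof. exact: seqv_agree. Qed.

Lemma seqv_sym X Y M N : seqv X Y M N -> seqv X Y N M.
Proof.
move=> [r [c [hr hc h]]]; exists (fun u => (r u)^-1), (fun v => (c v)^-1).
split=> [u|v|u v uX vY]; [exact/suV/hr|exact/suV/hc|rewrite h //].
have [_ ru] := hr u; have [_ cv] := hc v.
ring: (mulrV ru) (mulrV cv).
Qed.

Lemma seqv_trans X Y M N N' : seqv X Y M N -> seqv X Y N N' -> seqv X Y M N'.
Proof.
move=> [r [c [hr hc h]]] [r' [c' [hr' hc' h']]].
exists (fun u => r' u * r u), (fun v => c v * c' v).
split=> [u|v|u v uX vY]; [exact: suM|exact: suM|rewrite h' // h //; ring].
Qed.

Lemma seqv_sub X Y X' Y' M N : X' \subset X -> Y' \subset Y ->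
  seqv X Y M N -> seqv X' Y' M N.
Proof.
move=> /subsetP sX /subsetP sY [r [c [hr hc h]]]; exists r, c.
by split=> // u v /sX uX /sY vY; apply: h.
Qed.

Lemma seqv_tr X Y M N :
  seqv X Y M N -> seqv Y X (fun u v => M v u) (fun u v => N v u).
Proof.
move=> [r [c [hr hc h]]]; exists c, r; split=> // u v uX vY.
by rewrite h //; ring.
Qed.

Lemma seqv_unit X Y M N x y : seqv X Y M N -> x \in X -> y \in Y ->
  (N x y \is a GRing.unit) = (M x y \is a GRing.unit).
Proof.
move=> [r [c [hr hc h]]] xX yY; rewrite h // !unitrM.
by rewrite (hr x).2 (hc y).2 andbT.
Qed.

Lemma seqv_eq0 X Y M N x y : seqv X Y M N -> x \in X -> y \in Y ->
  (N x y == 0) = (M x y == 0).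
Proof.
move=> [r [c [hr hc h]]] xX yY; rewrite h //.
apply/eqP/eqP => [|->]; last by ring.
move=> e; have [_ ru] := hr x; have [_ cv] := hc y.
have : (r x)^-1 * (r x * M x y * c y) * (c y)^-1 = 0 by rewrite e; ring.
by move=> <-; ring: (mulrV ru) (mulrV cv).
Qed.

Lemma seqv_piv X Y M N x y : [disjoint X & Y] -> x \in X -> y \in Y ->
  M x y \is a GRing.unit -> seqv X Y M N ->
  seqv (y |: X :\ x) (x |: Y :\ y) (piv M x y) (piv N x y).
Proof.
(* The exchanged labels also exchange their factors: the new row y inherits the inverse of the old
   column factor, the new column x that of the old row factor. *)
move=> d xX yY aU [r [c [hr hc h]]]; have xy := disj_neq d xX yY.
exists (fun u => if u == y then (c y)^-1 else r u),
  (fun v => if v == x then (r x)^-1 else c v).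
split=> [u|v|u v].
- by case: eqP => _; [apply/suV/hc|apply: hr].
- by case: eqP => _; [apply/suV/hr|apply: hc].
have [_ rx] := hr x; have [_ cy] := hc y.
rewrite !inE /piv h // !invrM ?unitrM ?rx ?aU ?cy //.
have [->|uy] := eqVneq u y; have [->|vx] := eqVneq v x => //=.
- by move=> _ _; ring.
- by move=> _ /andP [vy vY]; rewrite h //; ring: (mulrV rx).
- by move=> /andP [ux uX] _; rewrite h //; ring: (mulrV cy).
move=> /andP [ux uX] /andP [vy vY]; rewrite !h //.
ring: (mulrV cy) (mulrV rx).
Qed.

Lemma reach_seqv X Y M N X' Y' M' : [disjoint X & Y] -> seqv X Y M N ->
  reach X Y M X' Y' M' ->
  exists N', reach X Y N X' Y' N' /\ seqv X' Y' M' N'.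
Proof.
move=> d MN; elim=> [|X1 Y1 M1 x y h1 [N1 [rN1 sN1]] xX yY aU].
  by exists N; split=> //; apply: reach0.
exists (piv N1 x y); split.
  by apply: reachS => //; rewrite (seqv_unit sN1).
by apply: seqv_piv => //; apply: reach_disj h1 d.
Qed.

Lemma seqv_piv_tr X Y M x y : [disjoint X & Y] -> x \in X -> y \in Y ->
  seqv (x |: Y :\ y) (y |: X :\ x) (fun u v => piv M x y v u)
    (piv (fun u v => M v u) y x).
Proof.
move=> d xX yY; have xy := disj_neq d xX yY.
(* A pivot puts a minus sign on its column but not on its row, so transposition is compatible with
   it only up to these two signs. *)
exists (fun u => if u == x then -1 else 1), (fun v => if v == y then -1 else 1).
split=> [u|v|u v].
- by case: eqP => _; [apply/suN/su1|apply: su1].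
- by case: eqP => _; [apply/suN/su1|apply: su1].
rewrite !inE /piv.
by have [->|ux] := eqVneq u x; have [->|vy] := eqVneq v y => //= *; ring.
Qed.

Lemma reach_tr X Y M X' Y' M' : [disjoint X & Y] -> reach X Y M X' Y' M' ->
  exists N', reach Y X (fun u v => M v u) Y' X' N'
    /\ seqv Y' X' (fun u v => M' v u) N'.
Proof.
move=> d; elim=> [|X1 Y1 M1 x y h1 [N1 [rN1 sN1]] xX yY aU].
  by exists (fun u v => M v u); split; [apply: reach0|apply: seqv_refl].
have d1 := reach_disj h1 d; have d1' : [disjoint Y1 & X1] by rewrite disjoint_sym.
exists (piv N1 y x); split.
  by apply: reachS => //; rewrite (seqv_unit sN1).
apply: seqv_trans (seqv_piv d1' yY xX _ sN1) => //.
exact: seqv_piv_tr.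
Qed.

Lemma piv_invol X Y M x y u v : [disjoint X & Y] -> x \in X -> y \in Y ->
  M x y \is a GRing.unit -> u \in X -> v \in Y ->
  piv (piv M x y) y x u v = M u v.
Proof.
move=> d xX yY aU uX vY; have xy := disj_neq d xX yY.
have uy := disj_neq d uX yY; have vx : v != x.
  by rewrite eq_sym; apply: disj_neq d xX vY.
rewrite {1}/piv piv_yx invrK.
have [->|ux] := eqVneq u x; have [->|vy] := eqVneq v y => //.
- by rewrite piv_yv //; ring: (mulrV aU).
- by rewrite piv_ux //; ring: (mulrV aU).
by rewrite piv_ux // piv_yv // piv_uv //; ring: (mulrV aU).
Qed.

Lemma reach_sub X Y M X' Y' M' X0 Y0 : reach X Y M X' Y' M' ->
  X \subset X0 -> Y \subset Y0 ->
  exists X0' Y0', [/\ reach X0 Y0 M X0' Y0' M', X' \subset X0' & Y' \subset Y0'].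
Proof.
move=> h sX sY; elim: h => [|X1 Y1 M1 x y h1 [X2 [Y2 [h2 s1 s2]]] xX yY aU].
  by exists X0, Y0; split=> //; apply: reach0.
exists (y |: X2 :\ x), (x |: Y2 :\ y).
have xX2 := subsetP s1 _ xX; have yY2 := subsetP s2 _ yY.
by split; [apply: reachS|apply/setUS/setSD|apply/setUS/setSD].
Qed.

Definition mprop := {set E} -> {set E} -> (E -> E -> R) -> Prop.

(* The states reached by pivots stand for the strongly equivalent matrices. *)
Definition hereditary (Q : mprop) : mprop := fun X Y M =>
  [disjoint X & Y] /\ forall X' Y' M', reach X Y M X' Y' M' -> Q X' Y' M'.

Definition seqv_closed (Q : mprop) :=
  forall X Y M N, seqv X Y M N -> Q X Y M -> Q X Y N.
Definition sub_closed (Q : mprop) :=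
  forall X Y M X' Y', X' \subset X -> Y' \subset Y -> Q X Y M -> Q X' Y' M.
Definition tr_closed (Q : mprop) :=
  forall X Y M, Q X Y M -> Q Y X (fun u v => M v u).

Lemma hereditary_now Q X Y M : hereditary Q X Y M -> Q X Y M.
Proof. by move=> [_ h]; apply/h/reach0. Qed.

Lemma hereditary_disj Q X Y M : hereditary Q X Y M -> [disjoint X & Y].
Proof. by case. Qed.

Lemma hereditary_reach Q X Y M X' Y' M' : hereditary Q X Y M -> reach X Y M X' Y' M' ->
  hereditary Q X' Y' M'.
Proof.
move=> [d h] r; split; first exact: reach_disj r d.
by move=> X1 Y1 M1 r1; apply/h/(reach_trans r).
Qed.

Lemma hereditary_piv Q X Y M x y : hereditary Q X Y M -> x \in X -> y \in Y ->
  M x y \is a GRing.unit -> hereditary Q (y |: X :\ x) (x |: Y :\ y) (piv M x y).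
Proof. by move=> h xX yY a; apply/(hereditary_reach h)/reach1. Qed.

Lemma hereditary_seqv Q X Y M N : seqv_closed Q -> seqv X Y M N -> hereditary Q X Y M ->
  hereditary Q X Y N.
Proof.
move=> hQ MN [d h]; split=> // X' Y' N' r.
have [M' [rM sM]] := reach_seqv d (seqv_sym MN) r.
exact: hQ (seqv_sym sM) (h _ _ _ rM).
Qed.

Lemma hereditary_sub Q X Y M X' Y' : sub_closed Q -> X' \subset X -> Y' \subset Y ->
  hereditary Q X Y M -> hereditary Q X' Y' M.
Proof.
move=> hQ sX sY [d h]; split; first exact: disjointW d.
move=> X1 Y1 M1 r; have [X2 [Y2 [r2 s1 s2]]] := reach_sub r sX sY.
exact: hQ s1 s2 (h _ _ _ r2).
Qed.

Lemma hereditary_tr Q X Y M : seqv_closed Q -> tr_closed Q -> hereditary Q X Y M ->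
  hereditary Q Y X (fun u v => M v u).
Proof.
move=> hQ tQ [d h]; have d' : [disjoint Y & X] by rewrite disjoint_sym.
split=> // Y' X' N' r; have [M' [rM sM]] := reach_tr d' r.
by apply: hQ (seqv_tr (seqv_sym sM)) _; apply/tQ/h.
Qed.

End Pivots.

(** * Subdeterminants and pivots *)

Section Determinants.

Variables (R : comUnitRingType) (S : R -> Prop) (E : finType).
Hypothesis HS : pfset S.
Implicit Types (M N : E -> E -> R) (X Y : {set E}) (x y u v : E).

Definition entin : mprop R E :=
  fun X Y M => forall u v, u \in X -> v \in Y -> S (M u v).

Lemma entin_seqv : seqv_closed S entin.
Proof.
move=> X Y M N [r [c [hr hc h]]] hM u v uX vY; rewrite h //.
by apply: (psM HS); [apply: (psM HS); [case: (hr u)|apply: hM]|case: (hc v)].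
Qed.

Lemma entin_sub : sub_closed entin.
Proof. by move=> X Y M X' Y' /subsetP sX /subsetP sY h u v /sX ? /sY ?; apply: h. Qed.

Lemma entin_tr : tr_closed entin.
Proof. by move=> X Y M h u v uX vY; apply: h. Qed.

(** This is the elimination matrix: multiplying by it on the left scales row i0 by c and adds d i
    times row i0 to every other row i. *)
Lemma det_elim n (i0 : 'I_n) (c : R) (d : 'I_n -> R) :
  \det (\matrix_(i, k) (if i == i0 then c * (k == i0)%:R
                        else (k == i)%:R + (k == i0)%:R * d i)) = c.
Proof.
case: n i0 d => [[]//|n] i0 d; rewrite (expand_det_row _ i0).
rewrite (bigD1 i0) //= mxE !eqxx mulr1 big1 ?addr0; last first.
  by move=> k /negPf k0; rewrite mxE eqxx k0 mulr0 mul0r.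
rewrite /cofactor -signr_odd oddD addbb mul1r.
rewrite (_ : row' _ _ = 1%:M) ?det1 ?mulr1 //.
have nl k : (lift i0 k == i0) = false by rewrite eq_sym (negPf (neq_lift _ _)).
apply/matrixP => i j; rewrite !mxE !nl (inj_eq lift_inj).
by rewrite mul0r addr0 eq_sym.
Qed.

Lemma det_sgnS n (i : 'I_n) (j : 'I_n) (a : R) : S a -> S ((-1) ^+ (i + j) * a).
Proof.
move=> Sa; rewrite -signr_odd; case: odd; rewrite ?expr1 ?expr0 ?mulN1r ?mul1r //.
exact: (psN HS).
Qed.

Definition dets : mprop R E := fun X Y M =>
  forall n (f g : 'I_n -> E), injective f -> injective g ->
  (forall i, f i \in X) -> (forall j, g j \in Y) ->
  S (\det (\matrix_(i, j) M (f i) (g j))).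

Definition ext X M u e : R := if e \in X then (u == e)%:R else M u e.

(* Unit columns expand away, so the maximal minors of [I | A] carry no more
   information than the minors of A. *)
Lemma dets_ext X Y M n (f g : 'I_n -> E) : dets X Y M -> injective f ->
  (forall i, f i \in X) -> (forall j, g j \in X :|: Y) ->
  S (\det (\matrix_(i, j) ext X M (f i) (g j))).
Proof.
move=> hM; elim: n f g => [|n ih] f g injf fX gXY.
  by rewrite det_mx00; apply: (ps1 HS).
have [/existsP [j0 gj0]|/existsPn gY] := boolP [exists j, g j \in X]; last first.
  have [/injectiveP injg|/injectivePn [j1 [j2 j12 e12]]] := boolP (injectiveb g).
    have gY' j : g j \in Y.
      by have := gXY j; rewrite inE (negPf (gY j)).
    rewrite (_ : \matrix_(i, j) _ = \matrix_(i, j) M (f i) (g j)); first exact: hM.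
    by apply/matrixP => i j; rewrite !mxE /ext (negPf (gY j)).
  rewrite -det_tr (determinant_alternate j12); first exact: (ps0 HS).
  move=> k.
  by rewrite !mxE e12.
rewrite (expand_det_col _ j0).
have [/existsP [i0 /eqP fi0]|/existsPn nf] := boolP [exists i, f i == g j0].
  rewrite (bigD1 i0) //= !mxE /ext gj0 fi0 eqxx mul1r big1 ?addr0; last first.
    move=> i ii0; rewrite !mxE gj0 -fi0 (inj_eq injf) (negPf ii0) mul0r //.
  apply: det_sgnS.
  have := ih (fun i => f (lift i0 i)) (fun j => g (lift j0 j)).
  rewrite /ext; set A := \matrix_(i, j) _ => h.
  rewrite (_ : \det _ = \det A); last first.
    by congr (\det _); apply/matrixP => i j; rewrite !mxE.
  by apply: h => // i1 i2 /injf /lift_inj.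
rewrite big1; first exact: (ps0 HS).
move=> i _; by rewrite !mxE /ext gj0 (negPf (nf i)) mul0r.
Qed.

(** Row operations turn [I | M] into the extended matrix of the pivot. A square submatrix of the
    latter that uses row y is therefore an elimination matrix times a submatrix of [I | M], with row
    x in the place of row y. *)
Lemma dets_piv X Y M x y : [disjoint X & Y] -> x \in X -> y \in Y ->
  M x y \is a GRing.unit -> dets X Y M ->
  dets (y |: X :\ x) (x |: Y :\ y) (piv M x y).
Proof.
move=> d xX yY aU hM; have xy := disj_neq d xX yY.
have yX : y \notin X by rewrite (disjointFl d yY).
have Sa : S (M x y)^-1.
  apply: (psV HS); have := hM 1%N (fun _ => x) (fun _ => y).
  by rewrite det_mx11 mxE; apply=> // i j _; rewrite !ord1.
set X' := y |: X :\ x; set M' := piv M x y.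
have key n (f g : 'I_n -> E) i0 : injective f -> (forall i, f i \in X') ->
    (forall j, g j \in X :|: Y) -> f i0 = y ->
    S (\det (\matrix_(i, j) ext X' M' (f i) (g j))).
  move=> injf fX' gXY fi0.
  pose f1 i := if i == i0 then x else f i.
  have f1X i : f1 i \in X.
    rewrite /f1; case: eqP => // /eqP ii0; have := fX' i.
    by rewrite !inE -fi0 (inj_eq injf) (negPf ii0) => /andP [].
  have nfx i : f i != x.
    have := fX' i; rewrite !inE; case: eqP => [->|_ /andP [] //].
    by rewrite eq_sym xy.
  have injf1 : injective f1.
    move=> i j; rewrite /f1; case: eqP => [->|_]; case: eqP => [->|_] //.
    - by move/esym/eqP; rewrite (negPf (nfx _)).
    - by move/eqP; rewrite (negPf (nfx _)).
    exact: injf.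
  pose L := \matrix_(i < n, k < n) (if i == i0 then (M x y)^-1 * (k == i0)%:R
     else (k == i)%:R + (k == i0)%:R * (- ((M x y)^-1 * M (f i) y))).
  rewrite (_ : \matrix_(i, j) _ = L *m \matrix_(i, j) ext X M (f1 i) (g j)).
    rewrite det_mulmx det_elim; apply: (psM HS) => //.
    exact: dets_ext hM injf1 f1X gXY.
  have LE i k : L i k = if i == i0 then (M x y)^-1 * (k == i0)%:R
     else (k == i)%:R + (k == i0)%:R * (- ((M x y)^-1 * M (f i) y)).
    by rewrite mxE.
  apply/matrixP => i j; rewrite [LHS]mxE [RHS]mxE; under eq_bigr do rewrite LE mxE.
  rewrite (bigD1 i0) //= !eqxx /f1 eqxx.
  have [ii0|ii0] := eqVneq i i0.
    rewrite big1 ?addr0; last first.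
      by move=> k /negPf k0; rewrite k0 mulr0 mul0r.
    rewrite ii0 fi0 /ext /X' /M' !inE mulr1.
    have [->|gy] := eqVneq (g j) y => /=.
      by rewrite (negPf yX) mulVr.
    have [->|gx] := eqVneq (g j) x => /=.
      by rewrite xX piv_yx mulr1.
    rewrite piv_yv //; case: ifP => // gX.
    by rewrite mulr0.
  rewrite (bigD1 i) //= eqxx big1 ?addr0; last first.
    move=> k /andP [/negPf k0 /negPf ki]; rewrite k0 ki.
    by rewrite mul0r addr0 mul0r.
  rewrite /= !(mulr0n, mulr1n) add0r mul1r (negPf ii0) mul0r addr0 mul1r.
  have fy : f i != y by rewrite -fi0 (inj_eq injf).
  rewrite /ext /X' /M' !inE.
  have [->|gy] := eqVneq (g j) y => /=.
    rewrite (negPf yX) (negPf fy) /=; ring: (mulrV aU).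
  have [->|gx] := eqVneq (g j) x => /=.
    by rewrite xX piv_ux // (negPf (nfx i)) /=; ring.
  rewrite piv_uv //; case: ifP => // gX; last by ring.
  by rewrite /=; ring.
have cov e : e \in X' :|: (x |: Y :\ y) -> e \in X :|: Y.
  rewrite !inE => /orP [/orP [/eqP ->|/andP [_ ->]]|/orP [/eqP ->|/andP [_ ->]]] //.
  - by rewrite yY orbT.
  - by rewrite xX.
  by rewrite orbT.
move=> n f g injf injg fX gY.
have gE j : g j \in X' = false.
  by apply: disjointFl (gY j); apply: disj_piv.
have gXY j : g j \in X :|: Y by apply: cov; rewrite inE gY orbT.
have -> : \matrix_(i, j) M' (f i) (g j) = \matrix_(i, j) ext X' M' (f i) (g j).
  by apply/matrixP => i j; rewrite !mxE /ext gE.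
have [/existsP [i0 /eqP fi0]|/existsPn nf] := boolP [exists i, f i == y].
  exact: key fi0.
(* If y is not among the rows, the submatrix is bordered by row y and column y. In the extended
   matrix that column is a unit column, so the determinant does not change. *)
pose f2 i := oapp f y (unlift ord0 i); pose g2 i := oapp g y (unlift ord0 i).
have := @key n.+1 f2 g2 ord0; rewrite /f2 unlift_none /= => h.
rewrite (_ : \det _ = \det (\matrix_(i, j) ext X' M' (f2 i) (g2 j))).
  apply: h => //.
  - move=> i j; case: unliftP => [k ->|->]; case: unliftP => [l ->|->] //=.
    + by move=> /injf ->.
    + by move/eqP; rewrite (negPf (nf _)).
    by move/esym/eqP; rewrite (negPf (nf _)).
  - by move=> i; case: unliftP => [k _|_] //=; rewrite !inE eqxx.
  by move=> j; rewrite /g2; case: unliftP => [k _|_] //=; rewrite inE yY orbT.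
rewrite [RHS](expand_det_col _ ord0) (bigD1 ord0) //= big1 ?addr0; last first.
  move=> i i0; rewrite !mxE /ext /f2 /g2 unlift_none /= !inE eqxx /=.
  case: unliftP i0 => [k -> _|->]; last by rewrite eqxx.
  by rewrite /= (negPf (nf k)) mul0r.
rewrite !mxE /ext /f2 /g2 unlift_none /= !inE !eqxx mul1r.
rewrite /cofactor /= expr0 mul1r; congr (\det _).
by apply/matrixP => i j; rewrite !mxE !liftK.
Qed.

Lemma dets_her X Y M : [disjoint X & Y] -> dets X Y M -> hereditary entin X Y M.
Proof.
move=> d hM; split=> // X' Y' M' r.
have {hM} hM' : dets X' Y' M'.
  elim: r => // X1 Y1 M1 x y r1 ih xX yY aU.
  by apply: dets_piv => //; apply: reach_disj r1 d.
move=> u v uX vY; have := hM' 1%N (fun _ => u) (fun _ => v).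
by rewrite det_mx11 mxE; apply=> // i j _; rewrite !ord1.
Qed.

(** Induction on the size by Schur complements: a nonzero entry of the first column is pivoted on,
    and the determinant is up to sign this entry times a smaller determinant of the pivoted
    matrix. *)
Lemma hereditary_dets X Y M : hereditary entin X Y M -> dets X Y M.
Proof.
move=> hM n; elim: n X Y M hM => [|n ih] X Y M hM f g injf injg fX gY.
  by rewrite det_mx00; apply: (ps1 HS).
set A := \matrix_(i, j) _.
have [/existsP [i0 a0]|/existsPn z] := boolP [exists i, M (f i) (g ord0) != 0];
  last first.
  rewrite (expand_det_col _ ord0) big1; first exact: (ps0 HS).
  move=> i _; by rewrite !mxE; have := z i; rewrite negbK => /eqP ->; rewrite mul0r.
pose x := f i0; pose y := g ord0.
have aS : S (M x y) by apply: (hereditary_now hM); rewrite ?fX ?gY.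
have aU : M x y \is a GRing.unit by apply: (psU HS).
pose L := \matrix_(i < n.+1, k < n.+1) (if i == i0 then 1 * (k == i0)%:R
     else (k == i)%:R + (k == i0)%:R * (- ((M x y)^-1 * M (f i) y))).
have -> : \det A = \det (L *m A) by rewrite det_mulmx det_elim mul1r.
have LA i j : (L *m A) i j = if i == i0 then M x (g j) else
    M (f i) (g j) - (M x y)^-1 * M (f i) y * M x (g j).
  rewrite mxE; under eq_bigr do rewrite !mxE.
  rewrite (bigD1 i0) //= !eqxx.
  have [_|ii0] := eqVneq i i0.
    by rewrite big1 ?addr0 ?mulr1 ?mul1r // => k /negPf k0; rewrite k0 mulr0 mul0r.
  rewrite (bigD1 i) //= eqxx big1 ?addr0; last first.
    move=> k /andP [/negPf k0 /negPf ki]; rewrite k0 ki.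
    by rewrite mul0r addr0 mul0r.
  rewrite /= !(mulr0n, mulr1n) (negPf ii0) -/x -/y mulr0n; ring.
rewrite (expand_det_col _ ord0) (bigD1 i0) //= big1 ?addr0; last first.
  move=> i ii0; rewrite LA (negPf ii0) -/y.
  rewrite (_ : _ - _ = 0) ?mul0r //; ring: (mulrV aU).
rewrite LA eqxx; apply: (psM HS) => //; apply: det_sgnS.
have xX : x \in X by apply: fX. have yY : y \in Y by apply: gY.
have := ih _ _ _ (hereditary_piv hM xX yY aU)
  (fun i => f (lift i0 i)) (fun j => g (lift ord0 j)).
set B := \matrix_(i, j) _ => h; rewrite (_ : \det _ = \det B).
  apply: h.
  - by move=> i j /injf /lift_inj.
  - by move=> i j /injg /lift_inj.
  - by move=> i; rewrite !inE fX andbT (_ : _ != x) ?orbT // (inj_eq injf) eq_sym neq_lift.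
  by move=> j; rewrite !inE gY andbT (_ : _ != y) ?orbT // (inj_eq injg) eq_sym neq_lift.
have d := hereditary_disj hM.
congr (\det _); apply/matrixP => i j; rewrite 2!mxE LA [RHS]mxE eq_sym (negPf (neq_lift _ _)).
rewrite piv_uv //; first exact: disj_neq d _ _.
by rewrite eq_sym; apply: disj_neq d _ _.
Qed.

End Determinants.

(** * States are determined by their basis and the row space *)

Section RowSpace.

Variables (R : comUnitRingType) (S : R -> Prop) (E : finType).
Hypothesis HS : pfset S.
Implicit Types (M N : E -> E -> R) (X Y D : {set E}) (x y u v : E).

(* The row space of [I | M]. *)
Definition rowsp X Y M (w : E -> R) : Prop :=
  forall v, v \in Y -> w v = \sum_(u in X) w u * M u v.

Lemma rowsp_piv X Y M x y w : [disjoint X & Y] -> x \in X -> y \in Y ->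
  M x y \is a GRing.unit -> rowsp X Y M w ->
  rowsp (y |: X :\ x) (x |: Y :\ y) (piv M x y) w.
Proof.
move=> d xX yY aU hw v; have xy := disj_neq d xX yY.
have yX : y \notin X :\ x by rewrite inE (disjointFl d yY) andbF.
rewrite big_setU1 //=; set sm := \sum_(u in X :\ x) w u * M u y.
have wy : w y = w x * M x y + sm by rewrite hw // (big_setD1 x) //.
have nuy u : u \in X :\ x -> u != y.
  by move=> h; apply: contraNneq yX => <-.
rewrite !inE; have [->|vx] := eqVneq v x => /=.
  move=> _; rewrite piv_yx (eq_bigr (fun u => w u * M u y * - (M x y)^-1)).
    by rewrite -mulr_suml -/sm wy; ring: (mulrV aU).
  by move=> u /nuy uy; rewrite piv_ux //; ring.
case/andP => vy vY; rewrite piv_yv // hw // (big_setD1 x) //=.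
rewrite [in RHS](eq_bigr (fun u => w u * M u v - w u * M u y * ((M x y)^-1 * M x v))).
  by rewrite sumrB -mulr_suml -/sm wy; ring: (mulrV aU).
by move=> u /nuy uy; rewrite piv_uv //; ring.
Qed.

Lemma piv_sets X Y x y : [disjoint X & Y] -> x \in X -> y \in Y ->
  x |: (y |: X :\ x) :\ y = X.
Proof.
move=> d xX yY; apply/setP => u; rewrite !inE.
have [->//|ux] := eqVneq u x.
by have [->|uy] //= := eqVneq u y; rewrite (disjointFl d yY).
Qed.

Lemma piv_sets' X Y x y : [disjoint X & Y] -> x \in X -> y \in Y ->
  y |: (x |: Y :\ y) :\ x = Y.
Proof. by move=> d xX yY; apply: (@piv_sets Y X y x); rewrite // disjoint_sym. Qed.

Lemma rowsp_agree X Y M N w : (forall u v, u \in X -> v \in Y -> M u v = N u v) ->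
  rowsp X Y M w -> rowsp X Y N w.
Proof.
move=> h hw v vY; rewrite hw //; apply: eq_bigr => u uX; by rewrite h.
Qed.

Lemma rowsp_pivE X Y M x y w : [disjoint X & Y] -> x \in X -> y \in Y ->
  M x y \is a GRing.unit ->
  rowsp (y |: X :\ x) (x |: Y :\ y) (piv M x y) w <-> rowsp X Y M w.
Proof.
move=> d xX yY aU; split; last exact: rowsp_piv.
move=> h.
have aU' : piv M x y y x \is a GRing.unit by rewrite piv_yx unitrV.
have := rowsp_piv (disj_piv d xX yY) (setU11 _ _) (setU11 _ _) aU' h.
rewrite (piv_sets d) // (piv_sets' d) //; apply: rowsp_agree => u v uX vY.
exact: (piv_invol d).
Qed.

Lemma rowsp_reach X Y M X' Y' M' w : [disjoint X & Y] ->
  reach X Y M X' Y' M' -> rowsp X' Y' M' w <-> rowsp X Y M w.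
Proof.
move=> d; elim=> // X1 Y1 M1 x y r1 ih xX yY aU.
by rewrite rowsp_pivE //; apply: reach_disj r1 d.
Qed.

Lemma rowsp0 X Y M w v : rowsp X Y M w -> (forall u, u \in X -> w u = 0) ->
  v \in X :|: Y -> w v = 0.
Proof.
move=> hw w0; rewrite inE => /orP [/w0 //|vY]; rewrite hw // big1 // => u uX.
by rewrite w0 // mul0r.
Qed.

Definition rvec X Y M u e : R :=
  if e \in X then (e == u)%:R else if e \in Y then M u e else 0.

Lemma rvecP X Y M u : [disjoint X & Y] -> u \in X -> rowsp X Y M (rvec X Y M u).
Proof.
move=> d uX v vY; rewrite /rvec (disjointFl d vY) vY (big_setD1 u) //= uX eqxx.
rewrite mul1r big1 ?addr0 // => e; rewrite !inE => /andP [/negPf eu ->].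
by rewrite eu mul0r.
Qed.

Lemma rowsp_entry X Y M w u v : rowsp X Y M w -> u \in X -> v \in Y ->
  (forall e, e \in X -> w e = (e == u)%:R) -> w v = M u v.
Proof.
move=> hw uX vY h; rewrite hw // (big_setD1 u) //= h // eqxx mul1r.
rewrite big1 ?addr0 // => e; rewrite !inE => /andP [/negPf eu eX].
by rewrite h // eu mul0r.
Qed.

(** Row u of [I | M] is the only vector of the row space that restricts to the unit vector of u on
    the basis X. *)
Lemma rowsp_uniq X Y M M' : [disjoint X & Y] ->
  (forall w, rowsp X Y M w -> rowsp X Y M' w) ->
  forall u v, u \in X -> v \in Y -> M' u v = M u v.
Proof.
move=> d h u v uX vY; have hr := h _ (rvecP M d uX).
rewrite -(rowsp_entry hr uX vY) /rvec ?(disjointFl d vY) ?vY //.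
by move=> e ->.
Qed.

(** Basis exchange: if row u had no nonzero entry in a column of X', the corresponding vector would
    vanish on the basis X' and so be zero, although its coordinate at u is 1. *)
Lemma rowsp_exch X Y M X' Y' M' u : [disjoint X & Y] ->
  X' :|: Y' = X :|: Y -> (forall w, rowsp X Y M w -> rowsp X' Y' M' w) ->
  u \in X -> u \notin X' ->
  exists v, [/\ v \in Y, v \in X' & M u v != 0].
Proof.
move=> d cov h uX uX'.
have [/existsP [v /and3P [? ? ?]]|/existsPn nv] :=
  boolP [exists v, [&& v \in Y, v \in X' & M u v != 0]]; first by exists v.
have hr := h _ (rvecP M d uX).
suff : rvec X Y M u u = 0 by rewrite /rvec uX eqxx => /eqP; rewrite oner_eq0.
apply: (rowsp0 hr); last by rewrite cov inE uX.
move=> e eX'; rewrite /rvec; case: ifP => eX.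
  by case: eqP => // eu; rewrite -eu eX' in uX'.
case: ifP => // eY; have := nv e; rewrite eY eX' /= negbK => /eqP //.
Qed.

Lemma reach_addcols X Y M X' Y' M' D : reach X Y M X' Y' M' ->
  [disjoint X :|: Y & D] -> reach X (Y :|: D) M X' (Y' :|: D) M'.
Proof.
move=> h d; elim: h => [|X1 Y1 M1 x y r1 ih xX yY aU]; first exact: reach0.
have yD : y \notin D.
  rewrite (disjointFr d) // -(reach_cover r1) inE yY orbT //.
rewrite (_ : (x |: Y1 :\ y) :|: D = x |: (Y1 :|: D) :\ y).
  by apply: reachS => //; rewrite inE yY.
apply/setP => e; rewrite !inE; case: (eqVneq e y) => [->|] /=.
  by rewrite (negPf yD) !orbF.
by rewrite orbA.
Qed.

(* A state whose basis avoids D is reached by pivots that avoid D. *)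
Lemma reach_avoid X Y M D X' Y' M' : hereditary (@entin _ S E) X Y M ->
  [disjoint X :|: Y & D] -> [disjoint X' & Y'] ->
  X' :|: Y' = X :|: (Y :|: D) -> [disjoint X' & D] -> #|X'| = #|X| ->
  (forall w, rowsp X (Y :|: D) M w <-> rowsp X' Y' M' w) ->
  exists N, [/\ reach X Y M X' (Y' :\: D) N, Y' = (Y' :\: D) :|: D
    & forall u v, u \in X' -> v \in Y' -> M' u v = N u v].
Proof.
move=> hM dD d' cov dX' cX hsp.
have [n] := ubnP #|X :\: X'|; elim: n X Y M hM dD cov cX hsp => // n ih.
move=> X Y M hM dD cov cX hsp; rewrite ltnS => le.
have d := hereditary_disj hM.
have dF e : e \in D -> e \in X :|: Y = false by move=> eD; rewrite (disjointFl dD eD).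
have dfull : [disjoint X & Y :|: D].
  rewrite -setI_eq0 setIUr setU_eq0 !setI_eq0 d /=.
  by apply: disjointWl dD; apply: subsetUl.
have [e0|] := eqVneq (X :\: X') set0.
  have sX : X \subset X' by rewrite -setD_eq0 e0.
  have eX : X = X' by apply/eqP; rewrite eqEcard sX cX leqnn.
  subst X'.
  have eY : Y' = Y :|: D.
    apply/setP => e; move/setP/(_ e): cov; rewrite !inE.
    have [eX|_] /= := boolP (e \in X); last by [].
    have := disjointFr d' eX; rewrite -[e \in Y']/(e \in Y') => -> _.
    by have := disjointFr dfull eX; rewrite inE => ->.
  have eY' : Y' :\: D = Y.
    rewrite eY; apply/setP => e; rewrite !inE.
    have [/dF|_] /= := boolP (e \in D); last by rewrite orbF.
    by rewrite !inE => /norP [_ /negPf ->].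
  exists M; split; first by rewrite eY'; apply: reach0.
    by rewrite eY'.
  move=> u v uX vY.
  apply: (@rowsp_uniq X Y' M M') => //.
  by move=> w; rewrite {1}eY => /hsp.
case/set0Pn => u; rewrite inE => /andP [uX' uX].
have [v [vY vX' nz]] := rowsp_exch dfull cov (fun w => (hsp w).1) uX uX'.
(* The exchange partner lies in the target basis X', which avoids D. So the pivot exists in the
   matrix without D, and it brings the basis one element closer to X'. *)
have vD : v \notin D by rewrite (disjointFr dX').
have {}vY : v \in Y by move: vY; rewrite inE (negPf vD) orbF.
have aU : M u v \is a GRing.unit by apply: (psU HS) => //; apply: (hereditary_now hM).
have r1 := reach1 uX vY aU.
have [] // := ih _ _ _ (hereditary_piv hM uX vY aU).
- by rewrite (reach_cover r1).
- by rewrite cov [LHS]setUA [RHS]setUA (reach_cover r1).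
- by rewrite (reach_card r1 d).1.
- by move=> w; rewrite -hsp; apply: rowsp_reach => //; apply: reach_addcols.
- apply: leq_trans le; apply: proper_card; apply/properP; split.
    apply/subsetP => e; rewrite !inE => /andP [eX' /orP [/eqP ev|/andP [_ ->]]].
      by rewrite ev vX' in eX'.
    by rewrite eX'.
  by exists u; rewrite !inE ?uX ?uX' ?eqxx //= orbF; apply: (disj_neq d).
move=> N [rN eN hN]; exists N; split=> //; exact: reach_trans r1 rN.
Qed.

End RowSpace.

(** * Cross ratios and lifts *)

Definition fund (R : comUnitRingType) (S : R -> Prop) p := S p /\ S (1 - p).

Record lifting (R Rh : comUnitRingType) (S : R -> Prop) (Sh : Rh -> Prop)
    (f : {rmorphism Rh -> R}) (U : R -> Rh) : Prop := Lifting {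
  lif_S : pfset S;
  lif_Sh : pfset Sh;
  lif_f : forall x, Sh x -> S (f x);
  lif_U : forall p, fund S p -> Sh (U p);
  lif_fU : forall p, fund S p -> f (U p) = p;
  lif_B : forall p, fund S p -> U (1 - p) = 1 - U p;
  lif_V : forall p, fund S p -> p != 0 -> U p^-1 = (U p)^-1
}.

Section CrossRatio.

Variables (R : comUnitRingType) (S : R -> Prop) (E : finType).
Hypothesis HS : pfset S.
Implicit Types (M N : E -> E -> R) (X Y : {set E}) (a b x y : E).

(** This is the signature of the four-cycle a, x, b, y (see [csig4]). The denominators are inverted
    as one product, so a zero in the numerator causes no harm. *)
Definition cr M a b x y : R := M a x * M b y * (M a y * M b x)^-1.

Lemma crtr M a b x y : cr (fun u v => M v u) x y a b = cr M a b x y.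
Proof. by rewrite /cr [in RHS]mulrC [_^-1 * _]mulrC [M b x * _]mulrC. Qed.

Lemma cr_seqv X Y M N a b x y : seqv S X Y M N -> entin S X Y M ->
  a \in X -> b \in X -> x \in Y -> y \in Y ->
  M a y != 0 -> M b x != 0 -> cr N a b x y = cr M a b x y.
Proof.
move=> [r [c [hr hc h]]] hM aX bX xY yY nay nbx.
have ua : M a y \is a GRing.unit by apply: (psU HS) => //; apply: hM.
have ub : M b x \is a GRing.unit by apply: (psU HS) => //; apply: hM.
have [[_ ra] [_ rb] [_ cx] [_ cy]] := And4 (hr a) (hr b) (hc x) (hc y).
rewrite /cr !h // !invrM ?unitrM ?ra ?rb ?cx ?cy ?ua ?ub //.
ring: (mulrV ra) (mulrV rb) (mulrV cx) (mulrV cy).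
Qed.

(** Pivoting over (a, y) turns the entry at (b, x) into (1 - cr) times [M b x], and this entry still
    lies in the partial field. *)
Lemma hereditary_fund X Y M a b x y : hereditary (@entin _ S E) X Y M ->
  a \in X -> b \in X -> x \in Y -> y \in Y ->
  M a x != 0 -> M a y != 0 -> M b x != 0 -> M b y != 0 ->
  fund S (cr M a b x y).
Proof.
move=> hM aX bX xY yY n1 n2 n3 n4.
have hS := hereditary_now hM; have d := hereditary_disj hM.
have u1 : M a x \is a GRing.unit by apply: (psU HS) => //; apply: hS.
have u2 : M a y \is a GRing.unit by apply: (psU HS) => //; apply: hS.
have u3 : M b x \is a GRing.unit by apply: (psU HS) => //; apply: hS.
have SM := psM HS; have SV := psV HS.
split; first by apply: (SM); [apply: (SM)|apply: (SV); apply: (SM)]; apply: hS.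
have [<-|ab] := eqVneq a b.
  by rewrite /cr mulrC [M a y * _]mulrC mulVr ?unitrM ?u1 ?u2 // subrr; apply: (ps0 HS).
have [<-|xy] := eqVneq x y.
  by rewrite /cr mulrV ?unitrM ?u1 ?u3 // subrr; apply: (ps0 HS).
have := hereditary_now (hereditary_piv hM aX yY u2); move=> /(_ b x).
rewrite !inE [b == a]eq_sym ab bX xy xY !orbT => /(_ isT isT).
have ny := disj_neq d bX yY; have nx := disj_neq d aX xY.
rewrite piv_uv ?[x == a]eq_sym // => h; rewrite (_ : 1 - _ =
  (M b x - (M a y)^-1 * M b y * M a x) * (M b x)^-1).
  by apply: (SM) => //; apply/(SV)/hS.
by rewrite /cr invrM //; ring: (mulrV u3).
Qed.

End CrossRatio.

Section Lifting.

Variables (R Rh : comUnitRingType) (S : R -> Prop) (Sh : Rh -> Prop).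
Variables (f : {rmorphism Rh -> R}) (U : R -> Rh) (E : finType).
Hypothesis HL : lifting S Sh f U.
Implicit Types (M N : E -> E -> Rh) (A : E -> E -> R) (X Y : {set E}) (a b x y : E).

Let HS := lif_S HL.
Let HSh := lif_Sh HL.

Lemma lif_eq0 c : Sh c -> (f c == 0) = (c == 0).
Proof.
move=> Sc; apply/eqP/eqP => [|->]; last by rewrite rmorph0.
move=> fc; apply/eqP; apply: contraT => nz.
have /(rmorph_unit f) := psU HSh Sc nz.
by rewrite fc unitr0.
Qed.

Lemma fund0 : fund S 0.
Proof. by split; [apply: (ps0 HS)|rewrite subr0; apply: (ps1 HS)]. Qed.

Lemma lif_U0 : U 0 = 0.
Proof.
by apply/eqP; rewrite -lif_eq0 ?(lif_fU HL fund0) //; apply: (lif_U HL fund0).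
Qed.

Lemma lif_U1 : U 1 = 1.
Proof. by have := lif_B HL fund0; rewrite subr0 lif_U0 subr0. Qed.

Definition good (c : Rh) := [/\ Sh c, Sh (1 - c) & U (f c) = c].

Lemma good_fund c : good c -> fund S (f c).
Proof.
by case=> h1 h2 _; split; [apply: (lif_f HL)|rewrite -[1](rmorph1 f) -rmorphB; apply: (lif_f HL)].
Qed.

Lemma good1 : good 1.
Proof.
by split; [apply: (ps1 HSh)|rewrite subrr; apply: (ps0 HSh)|rewrite rmorph1 lif_U1].
Qed.

(** Together with [goodV] this is all that the axioms of a lifting function offer: stability under c
    -> 1 - c and c -> 1/c, that is, under reordering four points on a line. *)
Lemma goodB c : good c -> good (1 - c).
Proof.
move=> h; have fc := good_fund h; case: h => h1 h2 h3; split=> //.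
  by rewrite opprB addrC subrK.
by rewrite rmorphB rmorph1 (lif_B HL fc) h3.
Qed.

Lemma goodV c : good c -> c != 0 -> good c^-1.
Proof.
move=> h nz; have fc := good_fund h; case: h => h1 h2 h3.
have cU := psU HSh h1 nz.
split; first exact: (psV HSh).
  rewrite (_ : _ - _ = - (c^-1 * (1 - c))); last by ring: (mulrV cU).
  by apply: (psN HSh); apply: (psM HSh) => //; apply: (psV HSh).
by rewrite rmorphV // (lif_V HL fc) ?h3 // lif_eq0.
Qed.

Lemma good_U p : fund S p -> good (U p).
Proof.
move=> hp; split; first exact: (lif_U HL).
  rewrite -(lif_B HL) //; apply: (lif_U HL); case: hp => h1 h2; split=> //.
  by rewrite opprB addrC subrK.
by rewrite (lif_fU HL).
Qed.

Lemma good_lift c : fund S (f c) -> U (f c) = c -> good c.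
Proof. by move=> /good_U h e; rewrite -e. Qed.

Definition good2 M a b x y := M a x != 0 -> M a y != 0 -> M b x != 0 ->
  M b y != 0 -> good (cr M a b x y).

Lemma crV M a b x y : Sh (M a x) -> Sh (M a y) -> Sh (M b x) -> Sh (M b y) ->
  M a x != 0 -> M a y != 0 -> M b x != 0 -> M b y != 0 ->
  (cr M a b x y)^-1 = cr M b a x y /\ (cr M a b x y)^-1 = cr M a b y x
  /\ cr M a b x y != 0.
Proof.
move=> S1 S2 S3 S4 n1 n2 n3 n4.
have [u1 u2 u3 u4] := And4 (psU HSh S1 n1) (psU HSh S2 n2) (psU HSh S3 n3) (psU HSh S4 n4).
rewrite /cr !invrM ?unitrM ?unitrV ?unitrM ?u1 ?u2 ?u3 ?u4 // !invrK.
split; first by ring.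
split; first by ring.
apply: contraTneq (oner_neq0 Rh) => e; rewrite negbK; apply/eqP.
suff -> : 1 = M a x * M b y * ((M b x)^-1 * (M a y)^-1) * ((M a x)^-1 * (M b y)^-1 * M b x * M a y).
  by rewrite e mul0r.
ring: (mulrV u1) (mulrV u2) (mulrV u3) (mulrV u4).
Qed.

Lemma good2_rows M a b x y : Sh (M a x) -> Sh (M a y) -> Sh (M b x) ->
  Sh (M b y) -> good2 M a b x y -> good2 M b a x y.
Proof.
move=> S1 S2 S3 S4 h n1 n2 n3 n4.
have [<- [_ nz]] := crV S1 S2 S3 S4 n3 n4 n1 n2.
by apply: goodV => //; apply: h.
Qed.

Lemma good2_cols M a b x y : Sh (M a x) -> Sh (M a y) -> Sh (M b x) ->
  Sh (M b y) -> good2 M a b x y -> good2 M a b y x.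
Proof.
move=> S1 S2 S3 S4 h n1 n2 n3 n4.
have [_ [<- nz]] := crV S1 S2 S3 S4 n2 n1 n4 n3.
by apply: goodV => //; apply: h.
Qed.

Lemma good2_tr M a b x y : good2 M a b x y -> good2 (fun u v => M v u) x y a b.
Proof. by move=> h n1 n2 n3 n4; rewrite crtr; apply: h. Qed.

Definition good_ratios : mprop Rh E := fun X Y M => entin Sh X Y M /\
  forall a b x y, a \in X -> b \in X -> x \in Y -> y \in Y -> good2 M a b x y.

Lemma good_ratios_seqv : seqv_closed Sh good_ratios.
Proof.
move=> X Y M N MN [hS hg]; split; first exact: (entin_seqv HSh MN).
move=> a b x y aX bX xY yY.
rewrite /good2 !(seqv_eq0 MN) // => n1 n2 n3 n4.
by rewrite (cr_seqv HSh MN) //; apply: hg.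
Qed.

Lemma good_ratios_sub : sub_closed good_ratios.
Proof.
move=> X Y M X' Y' sX sY [hS hg]; split; first exact: entin_sub hS.
move=> a b x y /(subsetP sX) aX /(subsetP sX) bX /(subsetP sY) xY /(subsetP sY) yY.
exact: hg.
Qed.

Lemma good_ratios_tr : tr_closed good_ratios.
Proof.
move=> X Y M [hS hg]; split; first exact: entin_tr hS.
by move=> x y a b *; apply: good2_tr; apply: hg.
Qed.

(** A generic entry of the pivot is [M u v] times 1 minus a cross ratio, and good ratios have 1 - c
    in the partial field. *)
Lemma good_ratios_piv X Y M x y : [disjoint X & Y] -> x \in X -> y \in Y ->
  M x y \is a GRing.unit -> good_ratios X Y M ->
  entin Sh (y |: X :\ x) (x |: Y :\ y) (piv M x y).
Proof.
move=> d xX yY aU [hS hg] u v.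
have Sa : Sh (M x y)^-1 by apply/(psV HSh)/hS.
rewrite !inE; have [->|uy] /= := eqVneq u y; have [->|vx] /= := eqVneq v x.
- by rewrite piv_yx.
- by move=> _ /andP [_ vY]; rewrite piv_yv //; apply: (psM HSh) => //; apply: hS.
- move=> /andP [_ uX] _; rewrite piv_ux //.
  by apply/(psN HSh)/(psM HSh) => //; apply: hS.
move=> /andP [_ uX] /andP [_ vY]; rewrite piv_uv //.
have [e|n1] := eqVneq (M u v) 0.
  rewrite e sub0r; apply/(psN HSh)/(psM HSh); last exact: hS.
  by apply/(psM HSh); last exact: hS.
have [e|n2] := eqVneq (M u y) 0; first by rewrite e mulr0 mul0r subr0; apply: hS.
have [e|n3] := eqVneq (M x v) 0; first by rewrite e mulr0 subr0; apply: hS.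
have n4 : M x y != 0 by apply: contraTneq aU => ->; rewrite unitr0.
have [_ h _] := hg u x y v uX xX yY vY n2 n1 n4 n3.
rewrite (_ : _ - _ = M u v * (1 - cr M u x y v)).
  by apply: (psM HSh) => //; apply: hS.
have u1 : M u v \is a GRing.unit by apply: (psU HSh) => //; apply: hS.
by rewrite /cr invrM //; ring: (mulrV u1).
Qed.

(* The ring-level form of global lifts, by [global_csig]. *)
Definition global := hereditary good_ratios.

Lemma global_entin X Y M : global X Y M -> hereditary (@entin _ Sh E) X Y M.
Proof. by case=> d h; split=> // X' Y' M' /h []. Qed.

(** Membership of the entries need only be assumed at the start: along a sequence of pivots the good
    ratios of one state keep the entries of the next one in the partial field. *)
Lemma globI X Y M : [disjoint X & Y] -> entin Sh X Y M ->
  (forall X' Y' M', reach X Y M X' Y' M' -> entin Sh X' Y' M' ->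
   forall a b x y, a \in X' -> b \in X' -> x \in Y' -> y \in Y' ->
   good2 M' a b x y) -> global X Y M.
Proof.
move=> d hS h; split=> // X' Y' M' r; have hr := r.
suff e : entin Sh X' Y' M' by split=> //; apply: h hr e.
elim: r {hr} => // X1 Y1 M1 x y r1 ih xX yY aU.
by apply: good_ratios_piv => //; [apply: reach_disj r1 d|split=> //; apply: h r1 ih].
Qed.

(** Pivoting on a corner of the 2 x 2 submatrix replaces its cross ratio by 1 minus it. If [M u c]
    is 0, the new ratio is 1. *)
Lemma good2_piv X Y M x v u c : [disjoint X & Y] -> entin Sh X Y M ->
  x \in X -> v \in Y -> u \in X -> c \in Y -> u != x -> c != v ->
  M x v != 0 -> good2 M x u v c -> good2 (piv M x v) v u x c.
Proof.
move=> d hS xX vY uX cY ux cv n h.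
have uv := disj_neq d uX vY.
have cx : c != x by rewrite eq_sym; apply: disj_neq d xX cY.
have aU : M x v \is a GRing.unit by apply: (psU HSh) => //; apply: hS.
rewrite /good2 /cr piv_yx piv_yv // piv_ux // piv_uv // => _ n2 n3 _.
have n2' : M x c != 0 by apply: contraNneq n2 => ->; rewrite mulr0.
have n3' : M u v != 0 by apply: contraNneq n3 => ->; rewrite mulr0 oppr0.
have u2 : M x c \is a GRing.unit by apply: (psU HSh) => //; apply: hS.
have u3 : M u v \is a GRing.unit by apply: (psU HSh) => //; apply: hS.
have -> : (M x v)^-1 * (M u c - (M x v)^-1 * M u v * M x c) *
    ((M x v)^-1 * M x c * - ((M x v)^-1 * M u v))^-1
    = 1 - M x v * M u c * (M x c * M u v)^-1.
  rewrite mulrN invrN !invrM ?unitrM ?unitrV ?aU ?u2 ?u3 // invrK.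
  ring: (mulrV u2) (mulrV u3) (mulrV aU).
have [->|n4] := eqVneq (M u c) 0.
  by rewrite mulr0 mul0r subr0; apply: good1.
by apply/goodB/h.
Qed.

Lemma f_cr M a b x y : Sh (M a y) -> Sh (M b x) -> M a y != 0 -> M b x != 0 ->
  f (cr M a b x y) = cr (fun u v => f (M u v)) a b x y.
Proof.
move=> S1 S2 n1 n2; rewrite /cr !rmorphM rmorphV ?rmorphM //.
by rewrite unitrM (psU HSh S1 n1) (psU HSh S2 n2).
Qed.

(* The ring-level content of the two obstructions and (via [lift_laws]) of their
   transposes: U is multiplicative on the cross ratios of five points on a
   line, and U(-1) = -1 whenever a non-Fano configuration is present. *)
Definition quotient_law X Y A := forall a b x y z, a \in X -> b \in X -> x \in Y ->
  y \in Y -> z \in Y -> A a x != 0 -> A a y != 0 -> A a z != 0 ->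
  A b x != 0 -> A b y != 0 -> A b z != 0 ->
  U (cr A a b z y * (cr A a b z x)^-1)
  = U (cr A a b z y) * (U (cr A a b z x))^-1.

Definition minus_one_law X Y A := forall a b c x1 x2 x3 w, a \in X -> b \in X -> c \in X ->
  x1 \in Y -> x2 \in Y -> x3 \in Y -> w \in Y ->
  A a x1 = 0 -> A a x2 != 0 -> A a x3 != 0 -> A a w != 0 ->
  A b x1 != 0 -> A b x2 = 0 -> A b x3 != 0 -> A b w != 0 ->
  A c x1 != 0 -> A c x2 != 0 -> A c x3 = 0 -> A c w != 0 ->
  cr A a b x3 w = 1 -> cr A a c x2 w = 1 -> cr A b c x1 w = 1 ->
  U (-1) = -1.

Definition lift_laws : mprop R E := fun X Y A =>
  entin S X Y A /\ [/\ quotient_law X Y A, quotient_law Y X (fun u v => A v u), minus_one_law X Y A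
    & minus_one_law Y X (fun u v => A v u)].

Lemma quotient_law_seqv X Y A B : seqv S X Y A B -> entin S X Y A -> quotient_law X Y A -> quotient_law X Y B.
Proof.
move=> AB hS h a b x y z aX bX xY yY zY; rewrite !(seqv_eq0 AB) // => *.
by rewrite !(cr_seqv HS AB) //; apply: h.
Qed.

Lemma minus_one_law_seqv X Y A B : seqv S X Y A B -> entin S X Y A -> minus_one_law X Y A -> minus_one_law X Y B.
Proof.
move=> AB hS h a b c x1 x2 x3 w aX bX cX x1Y x2Y x3Y wY.
move=> /eqP z1 n2 n3 n4 n5 /eqP z6 n7 n8 n9 n10 /eqP z11 n12.
move: z1 n2 n3 n4 n5 z6 n7 n8 n9 n10 z11 n12; rewrite !(seqv_eq0 AB) //.
move=> /eqP z1 n2 n3 n4 n5 /eqP z6 n7 n8 n9 n10 /eqP z11 n12.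
rewrite !(cr_seqv HS AB) //; exact: (h a b c x1 x2 x3 w).
Qed.

Lemma lift_laws_seqv : seqv_closed S lift_laws.
Proof.
move=> X Y A B AB [hS [h1 h2 h3 h4]]; split; first exact: (entin_seqv HS AB).
have hS' := entin_tr hS; have AB' := seqv_tr AB.
by split; [apply: quotient_law_seqv h1|apply: quotient_law_seqv h2|apply: minus_one_law_seqv h3|apply: minus_one_law_seqv h4].
Qed.

Lemma quotient_law_sub X Y A X' Y' : X' \subset X -> Y' \subset Y -> quotient_law X Y A -> quotient_law X' Y' A.
Proof.
move=> /subsetP sX /subsetP sY h a b x y z /sX ? /sX ? /sY ? /sY ? /sY ?.
exact: h.
Qed.

Lemma minus_one_law_sub X Y A X' Y' : X' \subset X -> Y' \subset Y -> minus_one_law X Y A -> minus_one_law X' Y' A.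
Proof.
move=> /subsetP sX /subsetP sY h a b c x1 x2 x3 w.
move=> /sX ? /sX ? /sX ? /sY ? /sY ? /sY ? /sY ?.
exact: (h a b c x1 x2 x3 w).
Qed.

Lemma lift_laws_sub : sub_closed lift_laws.
Proof.
move=> X Y A X' Y' sX sY [hS [h1 h2 h3 h4]]; split; first exact: entin_sub hS.
by split; [apply: quotient_law_sub h1|apply: quotient_law_sub h2|apply: minus_one_law_sub h3|apply: minus_one_law_sub h4].
Qed.

Lemma lift_laws_tr : tr_closed lift_laws.
Proof. by move=> X Y A [hS [h1 h2 h3 h4]]; split=> //; apply: entin_tr hS. Qed.

Definition obstruction_free := hereditary lift_laws.

Lemma obstruction_free_entin X Y A : obstruction_free X Y A -> hereditary (@entin _ S E) X Y A.
Proof. by case=> d h; split=> // X' Y' M' /h []. Qed.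

(** Two rows with three columns are five points on a line: the ratio on x, y is the quotient of
    those on z, y and z, x. The lifting axioms say nothing about quotients; [quotient_law] supplies
    the missing multiplicativity. *)
Lemma good2_trans X Y M a b x y z : entin Sh X Y M ->
  obstruction_free X Y (fun u v => f (M u v)) -> a \in X -> b \in X ->
  x \in Y -> y \in Y -> z \in Y -> M a z != 0 -> M b z != 0 ->
  good2 M a b z x -> good2 M a b z y -> good2 M a b x y.
Proof.
move=> hS hf aX bX xY yY zY naz nbz h1 h2 n1 n2 n3 n4.
have [_ [O _ _ _]] := hereditary_now hf.
have {h1} g1 := h1 naz n1 nbz n3; have {h2} g2 := h2 naz n2 nbz n4.
have e : cr M a b x y = cr M a b z y * (cr M a b z x)^-1.
  have u u' v : M u' v != 0 -> u' \in X -> v \in Y -> M u' v \is a GRing.unit.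
    by move=> n uX vY; apply: (psU HSh) => //; apply: hS.
  have [u1 u2] := conj (u a z naz aX zY) (u b z nbz bX zY).
  have [u3 u4] := conj (u a x n1 aX xY) (u b x n3 bX xY).
  have [u5 u6] := conj (u a y n2 aX yY) (u b y n4 bX yY).
  rewrite /cr !invrM ?unitrM ?unitrV ?unitrM ?u1 ?u2 ?u3 ?u4 ?u5 ?u6 // ?invrK.
  ring: (mulrV u1) (mulrV u2) (mulrV u3) (mulrV u4) (mulrV u5) (mulrV u6).
have Se u v : u \in X -> v \in Y -> Sh (M u v) by exact: hS.
have nf u v : u \in X -> v \in Y -> M u v != 0 -> f (M u v) != 0.
  by move=> uX vY; rewrite lif_eq0 //; apply: Se.
have fcr x' y' : x' \in Y -> y' \in Y -> M a y' != 0 -> M b x' != 0 ->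
    f (cr M a b x' y') = cr (fun u v => f (M u v)) a b x' y'.
  by move=> x'Y y'Y n n'; apply: f_cr => //; apply: Se.
apply: good_lift.
  by rewrite fcr //; apply: (hereditary_fund HS (obstruction_free_entin hf)) => //; apply: nf.
have nz : cr M a b z x \is a GRing.unit.
  have [_ [_ nz]] := crV (Se _ _ aX zY) (Se _ _ aX xY) (Se _ _ bX zY) (Se _ _ bX xY) naz n1 nbz n3.
  by case: g1 => h _ _; apply: (psU HSh).
rewrite e rmorphM rmorphV // !fcr // O ?nf //.
rewrite -!fcr //.
by case: g1 => _ _ ->; case: g2 => _ _ ->.
Qed.

Lemma good2_transT X Y M a b c x y : entin Sh X Y M ->
  obstruction_free X Y (fun u v => f (M u v)) -> a \in X -> b \in X -> c \in X ->
  x \in Y -> y \in Y -> M c x != 0 -> M c y != 0 ->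
  good2 M c a x y -> good2 M c b x y -> good2 M a b x y.
Proof.
move=> hS hf aX bX cX xY yY n1 n2 h1 h2.
have hf' := hereditary_tr HS lift_laws_seqv lift_laws_tr hf.
have := good2_trans (entin_tr hS) hf' xY yY aX bX cX n1 n2
  (good2_tr h1) (good2_tr h2).
exact: good2_tr.
Qed.

End Lifting.

(** * Two columns whose deletion leaves global lifts *)

Section RowsOut.

Variables (R Rh : comUnitRingType) (S : R -> Prop) (Sh : Rh -> Prop).
Variables (f : {rmorphism Rh -> R}) (U : R -> Rh) (E : finType).
Hypothesis HL : lifting S Sh f U.
Implicit Types (M N : E -> E -> Rh) (A : E -> E -> R) (X Y : {set E}).
Implicit Types (a b c d u v x y : E).

Let HS := lif_S HL.
Let HSh := lif_Sh HL.
Notation good_ratios := (good_ratios Sh f U).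
Notation global := (global Sh f U).
Notation good := (good Sh f U).
Notation good2 := (good2 Sh f U).
Notation obstruction_free := (obstruction_free S U).

Definition map_entries M : E -> E -> R := fun u v => f (M u v).

Lemma reach_map X Y M X' Y' M' : reach X Y M X' Y' M' ->
  reach X Y (map_entries M) X' Y' (map_entries M').
Proof.
elim=> [|X1 Y1 M1 x y r1 ih xX yY aU]; first exact: reach0.
rewrite (_ : map_entries (piv M1 x y) = piv (map_entries M1) x y).
  by apply: reachS => //; apply: rmorph_unit.
apply/funext => u; apply/funext => v; rewrite /map_entries /piv.
by case: ifP => _; case: ifP => _;
  rewrite ?rmorphN ?rmorphB ?rmorphM ?rmorphV.
Qed.

Lemma good2_ext M N a b x y : M a x = N a x -> M a y = N a y ->
  M b x = N b x -> M b y = N b y -> good2 N a b x y -> good2 M a b x y.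
Proof. by rewrite /good2 /cr => -> -> -> ->. Qed.

Lemma good2_same_rows M a x y : Sh (M a x) -> Sh (M a y) -> good2 M a a x y.
Proof.
move=> S1 S2 n1 n2 _ _; rewrite /cr [M a y * _]mulrC mulrV; first exact: good1 HL.
by rewrite unitrM (psU HSh S1 n1) (psU HSh S2 n2).
Qed.

Lemma good2_same_cols M a b x : Sh (M a x) -> Sh (M b x) -> good2 M a b x x.
Proof.
move=> S1 S2 n1 _ n2 _; rewrite /cr mulrV; first exact: good1 HL.
by rewrite unitrM (psU HSh S1 n1) (psU HSh S2 n2).
Qed.

(** Pivoting back over (c, x) recovers [M], and [good2_piv] applies to that pivot. *)
Lemma good2_from_piv X Y M x c u d : [disjoint X & Y] -> entin Sh X Y M ->
  x \in X -> c \in Y -> u \in X -> d \in Y ->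
  good_ratios (c |: X :\ x) (x |: Y :\ c) (piv M x c) -> good2 M x u c d.
Proof.
move=> dj hS xX cY uX dY [hS' hg].
have [->|ux] := eqVneq u x; first by apply: good2_same_rows; apply: hS.
have [->|dc] := eqVneq d c; first by apply: good2_same_cols; apply: hS.
move=> n1; have aU : M x c \is a GRing.unit by apply: (psU HSh) => //; apply: hS.
have dj' := disj_piv dj xX cY.
set N := piv M x c in hS' hg *.
have cX' : c \in c |: X :\ x by rewrite setU11.
have xY' : x \in x |: Y :\ c by rewrite setU11.
have uX' : u \in c |: X :\ x by rewrite !inE ux uX orbT.
have dY' : d \in x |: Y :\ c by rewrite !inE dc dY orbT.
have uc := disj_neq dj uX cY; have dx : d != x.
  by rewrite eq_sym; apply: disj_neq dj xX dY.
have n : N c x != 0.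
  by rewrite /N piv_yx; apply: contraTneq (aU) => e; rewrite -unitrV e unitr0.
have h := good2_piv HL dj' hS' cX' xY' uX' dY' uc dx n (hg _ _ _ _ cX' uX' xY' dY').
have inv e e' : e \in X -> e' \in Y -> M e e' = piv N c x e e'.
  by move=> eX eY; rewrite (piv_invol dj).
by apply: (good2_ext _ _ _ _ h) n1; apply: inv.
Qed.

(* A pivot on (x, c) makes x a column; [M] inherits goodness on column c. *)
Lemma good2_out X Y M x a b c d : [disjoint X & Y] -> entin Sh X Y M ->
  obstruction_free X Y (map_entries M) -> x \in X -> a \in X -> b \in X -> c \in Y -> d \in Y ->
  M x c != 0 -> good_ratios (c |: X :\ x) (x |: Y :\ c) (piv M x c) -> good2 M a b c d.
Proof.
move=> dj hS hf xX aX bX cY dY n hq.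
have h u : u \in X -> good2 M x u c d.
  by move=> uX; apply: (good2_from_piv dj).
have [->|ax] := eqVneq a x; first exact: h.
have [->|bx] := eqVneq b x.
  by apply: (good2_rows HL); try (by apply: hS); apply: h.
have [->|dc] := eqVneq d c; first by apply: good2_same_cols; apply: hS.
(* If [M x d] is nonzero, row x serves as a third row. Otherwise the pivot leaves column d unchanged
   outside row x, and its column x is a multiple of the old column c, so the same cross ratio is
   found in columns x, d of the pivot. *)
have [e|n'] := eqVneq (M x d) 0; last first.
  exact: (good2_transT HL hS hf aX bX xX cY dY n n' (h _ aX) (h _ bX)).
have aU : M x c \is a GRing.unit by apply: (psU HSh) => //; apply: hS.
have aV : (M x c)^-1 != 0.
  by apply: contraTneq (aU) => e'; rewrite -unitrV e' unitr0.
have [_ hg] := hq.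
have xY' : x \in x |: Y :\ c by rewrite setU11.
have uX' u : u \in X -> u != x -> u \in c |: X :\ x.
  by move=> uX ux; rewrite !inE ux uX orbT.
have dY' : d \in x |: Y :\ c by rewrite !inE dc dY orbT.
have := hg a b x d (uX' _ aX ax) (uX' _ bX bx) xY' dY'.
have dx : d != x by rewrite eq_sym; apply: disj_neq dj xX dY.
have ac := disj_neq dj aX cY; have bc := disj_neq dj bX cY.
rewrite /good2 /cr !piv_ux // !piv_uv // e !mulr0 !subr0.
move=> H n1 n2 n3 n4.
have u1 : M a c \is a GRing.unit by apply: (psU HSh) => //; apply: hS.
have u2 : M b c \is a GRing.unit by apply: (psU HSh) => //; apply: hS.
have u3 : M a d \is a GRing.unit by apply: (psU HSh) => //; apply: hS.
have nz u : M u c \is a GRing.unit -> - ((M x c)^-1 * M u c) != 0.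
  move=> uu; have : - ((M x c)^-1 * M u c) \is a GRing.unit.
    by rewrite unitrN unitrM unitrV aU.
  by apply: contraTneq => ->; rewrite unitr0.
rewrite (_ : _ * _ = - ((M x c)^-1 * M a c) * M b d
    * (M a d * - ((M x c)^-1 * M b c))^-1); first by apply: H => //; apply: nz.
rewrite mulrN !invrN !invrM ?unitrM ?unitrV ?aU ?u1 ?u2 ?u3 // invrK.
ring: (mulrV aU).
Qed.

(** Either pair of zeros makes the correction term of the pivot over (x, v) vanish on rows a, b and
    columns c, d, so the four entries are the same before and after. *)
Lemma good2_out0 X Y M x a b c d v : [disjoint X & Y] -> entin Sh X Y M ->
  x \in X -> a \in X -> b \in X -> c \in Y -> d \in Y -> v \in Y ->
  (M a v = 0 /\ M b v = 0) \/ (M x c = 0 /\ M x d = 0) ->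
  M x v != 0 -> c != v -> d != v -> a != x -> b != x ->
  good_ratios (v |: X :\ x) (x |: Y :\ v) (piv M x v) -> good2 M a b c d.
Proof.
move=> dj hS xX aX bX cY dY vY hz n cv dv ax bx [_ hg].
have uX' u : u \in X -> u != x -> u \in v |: X :\ x.
  by move=> uX ux; rewrite !inE ux uX orbT.
have eY' e : e \in Y -> e != v -> e \in x |: Y :\ v.
  by move=> eY ev; rewrite !inE ev eY orbT.
apply: (good2_ext _ _ _ _ (hg a b c d _ _ _ _));
  rewrite ?uX' ?eY' //; rewrite piv_uv ?(disj_neq dj _ vY) //;
  try (by rewrite eq_sym; apply: (disj_neq dj));
  by case: hz => -[e1 e2]; rewrite ?e1 ?e2 ?mulr0 ?mul0r subr0.
Qed.

End RowsOut.

Lemma disj_UD (E : finType) (X Y D D' : {set E}) : [disjoint X & Y] ->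
  D \subset Y -> D \subset D' -> [disjoint X :|: (Y :\: D') & D].
Proof.
move=> d /subsetP sD /subsetP sD'; rewrite disjoint_sym disjoint_subset.
apply/subsetP => e eD; rewrite !inE (disjointFl d) ?sD //=.
by rewrite sD'.
Qed.

Section Step.

Variables (R Rh : comUnitRingType) (S : R -> Prop) (Sh : Rh -> Prop).
Variables (f : {rmorphism Rh -> R}) (U : R -> Rh) (E : finType).
Hypothesis HL : lifting S Sh f U.

Let HS := lif_S HL.
Let HSh := lif_Sh HL.
Notation good_ratios := (good_ratios Sh f U).
Notation global := (global Sh f U).
Notation good2 := (good2 Sh f U).
Notation obstruction_free := (obstruction_free S U).
Implicit Types (D X Y : {set E}) (M N : E -> E -> Rh).

Variables (X Y : {set E}) (M : E -> E -> Rh).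

(** While x and y both remain columns, the ratios in exactly these two columns are the only ones
    that neither deletion controls; the last clause supplies them. Its pivots never use x or y, yet
    [piv] updates both columns. *)
Definition almost_glob (x y : E) :=
  [/\ x \in Y, y \in Y, x != y, [disjoint X & Y] &
   [/\ global X (Y :\ x) M, global X (Y :\ y) M, obstruction_free X Y (map_entries f M) &
    forall X' Y' M', reach X (Y :\: [set x; y]) M X' Y' M' ->
      forall a b, a \in X' -> b \in X' -> good2 M' a b x y]].

Lemma almost_globC x y : almost_glob x y -> almost_glob y x.
Proof.
case=> xY yY xy d [hx hy hf hb]; split=> //; first by rewrite eq_sym.
split=> // X' Y' M'; rewrite setUC => r a b aX bX.
have hS c : c \in X' -> Sh (M' c x) /\ Sh (M' c y).
  have D1 : [disjoint X :|: Y :\: [set x; y] & [set x]].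
    by apply: disj_UD; rewrite ?sub1set ?inE ?eqxx.
  have D2 : [disjoint X :|: Y :\: [set x; y] & [set y]].
    by apply: disj_UD; rewrite ?sub1set ?inE ?eqxx ?orbT.
  move=> cX; have e1 : (Y :\: [set x; y]) :|: [set x] = Y :\ y.
    apply/setP => e; rewrite !inE; case: (eqVneq e x) => [->|] /=.
      by rewrite ?orbT xY xy.
    by rewrite orbF.
  have e2 : (Y :\: [set x; y]) :|: [set y] = Y :\ x.
    apply/setP => e; rewrite !inE; case: (eqVneq e y) => [->|] /=.
      by rewrite ?orbT ?orbF yY eq_sym xy.
    by rewrite !orbF.
  have r1 := reach_addcols r D1; have r2 := reach_addcols r D2.
  rewrite e1 in r1; rewrite e2 in r2.
  split; first by apply: (hereditary_now (hereditary_reach hy r1)).1; rewrite ?inE ?eqxx ?orbT.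
  by apply: (hereditary_now (hereditary_reach hx r2)).1; rewrite ?inE ?eqxx ?orbT.
apply: (good2_cols HL); try (by case: (hS a aX)); try (by case: (hS b bX)).
exact: hb r _ _ aX bX.
Qed.

(** The pivots leading to the state may have used D; only its final basis has to avoid D. By
    [reach_avoid] the state then restricts to one of the matrix without D, where goodness is
    known. *)
Lemma avoid_QG D X' Y' M' : D \subset Y -> global X (Y :\: D) M ->
  [disjoint X & Y] -> reach X Y M X' Y' M' -> [disjoint X' & D] ->
  exists N, [/\ reach X (Y :\: D) M X' (Y' :\: D) N, D \subset Y' &
    forall u v, u \in X' -> v \in Y' -> M' u v = N u v].
Proof.
move=> sD hD d r dD.
have eY : (Y :\: D) :|: D = Y.
  by apply/setP => e; rewrite !inE; case: (boolP (e \in D)) => [eD|_] /=;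
    rewrite ?orbF ?(subsetP sD e eD).
have := reach_avoid HSh (global_entin hD) (D := D) (X' := X') (Y' := Y') (M' := M').
rewrite eY; case.
- exact: disj_UD.
- exact: reach_disj r d.
- exact: reach_cover r.
- by [].
- exact: (reach_card r d).1.
- by move=> w; rewrite (rowsp_reach w d r).
move=> N [h1 h2 h3]; exists N; split=> //.
by rewrite h2 subsetUr.
Qed.

Variables (x y : E).
Hypothesis hxy : almost_glob x y.

Lemma state_cols X' Y' M' e : reach X Y M X' Y' M' -> [disjoint X' & [set e]] ->
  e \in Y -> global X (Y :\ e) M -> good_ratios X' (Y' :\ e) M'.
Proof.
case: (hxy) => _ _ _ d _ r dD eY hg.
have [|N [rN sD hN]] := avoid_QG _ hg d r dD; first by rewrite sub1set.
apply: (good_ratios_seqv HL) (hereditary_now (hereditary_reach hg rN)).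
apply: (seqv_agree HSh).
by move=> u v uX; rewrite !inE => /andP [_ vY]; apply: hN.
Qed.

(** Both x and y are columns: a ratio that misses one of them is seen after deleting it, and the
    others lie in columns x and y. *)
Lemma state0 X' Y' M' : reach X Y M X' Y' M' -> x \in Y' -> y \in Y' ->
  good_ratios X' Y' M'.
Proof.
case: (hxy) => xY yY xy d [hx hy hf hb] r xY' yY'.
have d' := reach_disj r d.
have dx : [disjoint X' & [set x]] by rewrite disjoint_sym disjoints1 (disjointFl d').
have dy : [disjoint X' & [set y]] by rewrite disjoint_sym disjoints1 (disjointFl d').
have [Sx gx] := state_cols r dx xY hx; have [Sy gy] := state_cols r dy yY hy.
have hS : entin Sh X' Y' M'.
  move=> u v uX vY; have [e|vx] := eqVneq v x; last by apply: Sx; rewrite ?inE ?vx.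
  by apply: Sy; rewrite ?inE ?vY ?e ?xy ?xY'.
split=> // a b c e aX bX cY eY.
have [/andP [h1 h2]|h1] := boolP ((c != x) && (e != x)).
  by apply: gx; rewrite ?inE ?h1 ?h2.
have [/andP [h2 h3]|h2] := boolP ((c != y) && (e != y)).
  by apply: gy; rewrite ?inE ?h3 ?h2.
have dxy : [disjoint X' & [set x; y]].
  by rewrite -setI_eq0 setIUr setU_eq0 !setI_eq0 dx dy.
have sxy : [set x; y] \subset Y by rewrite subUset !sub1set xY.
have hg : global X (Y :\: [set x; y]) M.
  by apply: hereditary_sub hx => //; [apply: good_ratios_sub|apply: setDS; rewrite sub1set setU11].
have [N [rN sD hN]] := avoid_QG sxy hg d r dxy.
have key : good2 M' a b x y.
  by apply: (good2_ext _ _ _ _ (hb _ _ _ rN a b aX bX)); apply: hN.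
have key' : good2 M' a b y x by apply: (good2_cols HL) key; apply: hS.
move: h1 h2; rewrite !negb_and !negbK => /orP [] /eqP e1 /orP [] /eqP e2.
- by move: xy; rewrite -e1 -e2 eqxx.
- by rewrite e1 e2.
- by rewrite e1 e2.
- by move: xy; rewrite -e1 -e2 eqxx.
Qed.

(** With x in the basis and y outside it, ratios without column y come from deleting y. For the
    others x is pivoted out, which leads to a state covered by [state0]. *)
Lemma state1 X' Y' M' : reach X Y M X' Y' M' -> x \in X' -> y \in Y' ->
  good_ratios X' Y' M'.
Proof.
case: (hxy) => xY yY xy d [hx hy hf hb] r xX yY'.
have d' := reach_disj r d; have hf' := hereditary_reach hf (reach_map f r).
have {r xX yY'} : reach X Y M X' Y' M' /\ (x \in X' /\ y \in Y') by [].
(* These facts are stated for every state with x a row and y a column, as they are needed again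
   after one further pivot. The column v comes from the original basis by exchange, hence differs
   from y. *)
have base X1 Y1 M1 : reach X Y M X1 Y1 M1 /\ (x \in X1 /\ y \in Y1) ->
  [/\ entin Sh X1 Y1 M1, good_ratios X1 (Y1 :\ y) M1,
   forall c, c \in Y1 -> c != y -> M1 x c != 0 ->
     good_ratios (c |: X1 :\ x) (x |: Y1 :\ c) (piv M1 x c)
   & exists v, [/\ v \in Y1, v != y & M1 x v != 0]].
  move=> [r [xX yY1]]; have d1 := reach_disj r d.
  have dy : [disjoint X1 & [set y]] by rewrite disjoint_sym disjoints1 (disjointFl d1).
  have [Sy gy] := state_cols r dy yY hy.
  have hq c : c \in Y1 -> c != y -> M1 x c != 0 ->
     good_ratios (c |: X1 :\ x) (x |: Y1 :\ c) (piv M1 x c).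
    move=> cY cy n; apply: state0; last by rewrite !inE [y == c]eq_sym cy yY1 orbT.
      apply: reachS => //; apply: (psU HSh) => //; apply: Sy => //.
      by rewrite !inE cy.
    by rewrite setU11.
  have hv : exists v, [/\ v \in Y1, v != y & M1 x v != 0].
    have xnX : x \notin X by rewrite (disjointFl d).
    have [v [vY vX n]] := rowsp_exch d1 (esym (reach_cover r))
      (fun w => (rowsp_reach w d r).1) xX xnX.
    by exists v; split=> //; apply: disj_neq d vX yY.
  split=> //.
  have [v [vY vy n]] := hv.
  have aU : M1 x v \is a GRing.unit.
    by apply: (psU HSh) => //; apply: Sy; rewrite // !inE vy.
  have aU' : piv M1 x v v x \is a GRing.unit by rewrite piv_yx unitrV.
  have := good_ratios_piv HL (disj_piv d1 xX vY) (setU11 _ _) (setU11 _ _) aU' (hq v vY vy n).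
  rewrite (piv_sets d1) // (piv_sets' d1) // => h e e' eX eY.
  by rewrite -(piv_invol d1 xX vY aU eX eY); apply: h.
move=> st; have [hS gy hq [v [vY vy nv]]] := base _ _ _ st.
case: st => r [xX yY']; split=> // a b c e aX bX.
have main c' a' b' : a' \in X' -> b' \in X' -> c' \in Y' -> good2 M' a' b' c' y.
  move=> {}aX {}bX cY.
  have [->|cy] := eqVneq c' y; first by apply: (good2_same_cols HL); apply: hS.
  have [z|n] := eqVneq (M' x c') 0; last first.
    by apply: (good2_out HL d' hS hf' xX); rewrite ?n //; apply: hq.
  have cv : c' != v by apply: contraNneq nv => <-; rewrite z.
  have [->|ax] := eqVneq a' x; first by move=> n; rewrite z eqxx in n.
  have [->|bx] := eqVneq b' x; first by move=> _ _ n; rewrite z eqxx in n.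
  have yv : y != v by rewrite eq_sym.
  have qv := hq v vY vy nv.
  have [zy|ny] := eqVneq (M' x y) 0.
    by apply: (good2_out0 d' hS xX _ _ _ _ vY) => //; right.
  (* Pivoting over (u1, v) keeps row u2, turns row u1 into a proportional row v, and makes the entry
     of row x in column c' nonzero. In the new state x can be pivoted out through c'. *)
  have red u1 u2 : u1 \in X' -> u2 \in X' -> u1 != x -> u2 != x ->
      M' u1 v != 0 -> M' u2 v = 0 -> good2 M' u1 u2 c' y.
    move=> u1X u2X u1x u2x n1 z2 m1 m2 m3 m4.
    have u1v : M' u1 v \is a GRing.unit by apply: (psU HSh) => //; apply: hS.
    have st' : reach X Y M (v |: X' :\ u1) (u1 |: Y' :\ v) (piv M' u1 v) /\
        (x \in v |: X' :\ u1 /\ y \in u1 |: Y' :\ v).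
      split; first exact: reachS.
      by rewrite !inE xX yY' yv [x == u1]eq_sym u1x !orbT.
    have [hS2 _ hq2 _] := base _ _ _ st'.
    have d2 := disj_piv d' u1X vY.
    have xv := disj_neq d' xX vY; have u2v := disj_neq d' u2X vY.
    have cu : c' != u1 by rewrite eq_sym; apply: disj_neq d' u1X cY.
    have yu : y != u1 by rewrite eq_sym; apply: disj_neq d' u1X yY'.
    have u21 : u2 != u1 by apply: contraNneq n1 => <-; rewrite z2.
    have nu w w' : w \in X' -> w' \in Y' -> M' w w' != 0 -> M' w w' \is a GRing.unit.
      by move=> wX w'Y; apply: (psU HSh); apply: hS.
    have n' : piv M' u1 v x c' != 0.
      rewrite piv_uv // z sub0r; apply: contraTneq (oner_neq0 Rh) => e0.
      have : - ((M' u1 v)^-1 * M' x v * M' u1 c') \is a GRing.unit.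
        by rewrite unitrN !unitrM unitrV u1v !nu.
      by rewrite e0 unitr0.
    have cY2 : c' \in u1 |: Y' :\ v by rewrite !inE cv cY orbT.
    have hf2 := hereditary_reach hf (reach_map f st'.1).
    have [xX2 yY2] := st'.2.
    have vX2 : v \in v |: X' :\ u1 by rewrite setU11.
    have u2X2 : u2 \in v |: X' :\ u1 by rewrite !inE u21 u2X orbT.
    have := good2_out HL d2 hS2 hf2 xX2 vX2 u2X2 cY2 yY2 n' (hq2 _ cY2 cy n').
    rewrite /good2 /cr !piv_yv // !piv_uv // z2 mulr0 !mul0r !subr0.
    have un w : M' u1 w \is a GRing.unit -> (M' u1 v)^-1 * M' u1 w != 0.
      move=> uw; have : (M' u1 v)^-1 * M' u1 w \is a GRing.unit.
        by rewrite unitrM unitrV u1v.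
      by apply: contraTneq => ->; rewrite unitr0.
    move=> /(_ (un _ (nu _ _ u1X cY m1)) (un _ (nu _ _ u1X yY' m2)) m3 m4).
    rewrite (_ : _ * _ * _ = M' u1 c' * M' u2 y * (M' u1 y * M' u2 c')^-1) //.
    have v1 := nu _ _ u1X yY' m2; have v2 := nu _ _ u2X cY m3.
    rewrite !invrM ?unitrM ?unitrV ?u1v ?v1 ?v2 // invrK; ring: (mulrV u1v).
  have Se u w : u \in X' -> w \in Y' -> Sh (M' u w) by exact: hS.
  have [za|na] := eqVneq (M' a' v) 0; have [zb|nb] := eqVneq (M' b' v) 0.
  - by apply: (good2_out0 d' hS xX _ _ _ _ vY) => //; left.
  - apply: (good2_rows HL); rewrite ?Se //; try exact: hS.
    exact: red.
  - exact: red.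
  (* Now rows a' and b' are both nonzero in column v, which serves as a third column; since [M' x v]
     is nonzero too, x can be pivoted out through v. *)
  apply: (good2_trans HL hS hf' aX bX cY yY' vY na nb);
    exact: (good2_out HL d' hS hf' xX).
move=> cY eY.
have [->|ey] := eqVneq e y; first exact: main.
have [->|cy] := eqVneq c y.
  by apply: (good2_cols HL); [apply: hS..|apply: main].
by apply: gy.2; rewrite // !inE ?cy ?ey.
Qed.

End Step.

Section Glue.

Variables (R Rh : comUnitRingType) (S : R -> Prop) (Sh : Rh -> Prop).
Variables (f : {rmorphism Rh -> R}) (U : R -> Rh) (E : finType).
Hypothesis HL : lifting S Sh f U.
Let HSh := lif_Sh HL.
Notation global := (global Sh f U).

(** What remains is a state with both x and y in the basis. Pivoting x out gives one with only y in
    it, so [state1] applies with the roles exchanged. If row x vanishes on both columns of the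
    ratio, a pivot through any other column leaves the ratio alone. *)
Lemma almost_glob_glob X Y (M : E -> E -> Rh) x y :
  almost_glob S Sh f U X Y M x y -> global X Y M.
Proof.
move=> hxy; have hyx := almost_globC HL hxy.
case: (hxy) => xY yY xy d [hx hy hf hb].
apply: (globI HL d).
  move=> u v uX vY; have [e|vx] := eqVneq v x.
    by apply: (hereditary_now hy).1; rewrite // !inE e xy.
  by apply: (hereditary_now hx).1; rewrite // !inE vx.
move=> X' Y' M' r hS a b c e aX bX cY eY.
have d' := reach_disj r d; have hf' := hereditary_reach hf (reach_map f r).
have cov w : w \in Y -> (w \in X') || (w \in Y').
  by move=> wY; rewrite -in_setU (reach_cover r) inE wY orbT.
have [xX|xX] := boolP (x \in X'); last first.
  have xY' : x \in Y' by move: (cov x xY); rewrite (negPf xX).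
  have [yX|yX] := boolP (y \in X').
    by apply: (state1 HL hyx r yX xY').2.
  have yY' : y \in Y' by move: (cov y yY); rewrite (negPf yX).
  by apply: (state0 HL hxy r xY' yY').2.
have [yX|yX] := boolP (y \in X'); last first.
  have yY' : y \in Y' by move: (cov y yY); rewrite (negPf yX).
  by apply: (state1 HL hxy r xX yY').2.
have hq w : w \in Y' -> M' x w != 0 ->
    good_ratios Sh f U (w |: X' :\ x) (x |: Y' :\ w) (piv M' x w).
  move=> wY n; apply: (state1 HL hyx) => //; last by rewrite setU11.
    by apply: reachS => //; apply: (psU HSh) => //; apply: hS.
  by rewrite !inE yX [y == x]eq_sym xy orbT.
have [zc|nc] := eqVneq (M' x c) 0; last first.
  by apply: (good2_out HL d' hS hf' xX) => //; apply: hq.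
have [ze|ne] := eqVneq (M' x e) 0; last first.
  apply: (good2_cols HL); [by apply: hS..|].
  by apply: (good2_out HL d' hS hf' xX) => //; apply: hq.
have [ax|ax] := eqVneq a x; first by move=> n; rewrite ax zc eqxx in n.
have [bx|bx] := eqVneq b x; first by move=> _ _ n; rewrite bx zc eqxx in n.
have xnX : x \notin X by rewrite (disjointFl d).
have [v [vY vX n]] := rowsp_exch d' (esym (reach_cover r))
  (fun w => (rowsp_reach w d r).1) xX xnX.
apply: (good2_out0 d' hS xX _ _ _ _ vY) => //; first by right.
- by apply: contraNneq n => <-; rewrite zc.
- by apply: contraNneq n => <-; rewrite ze.
exact: hq.
Qed.

End Glue.

(** * Connectivity is preserved by pivots *)

Section Connectivity.

Variables (R : comUnitRingType) (E : finType).
Implicit Types (A : E -> E -> R) (X Y : {set E}) (k : E -> bool).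

Definition edge_constant X Y A k := forall u v, u \in X -> v \in Y -> A u v != 0 -> k u = k v.

(** Phrased through two-valued functions that are constant along edges, so that no walks have to be
    followed through pivots, transposes and scalings. *)
Definition connected X Y A := forall k, edge_constant X Y A k ->
  forall w w', w \in X :|: Y -> w' \in X :|: Y -> k w = k w'.

(** A pivot creates an edge u v only when u y and x v were edges, and x y is one as well, so no two
    components are joined. *)
Lemma edge_constant_piv X Y A k x y : [disjoint X & Y] -> x \in X -> y \in Y ->
  A x y \is a GRing.unit -> edge_constant X Y A k ->
  edge_constant (y |: X :\ x) (x |: Y :\ y) (piv A x y) k.
Proof.
move=> d xX yY aU h u v.
have nxy : A x y != 0 by apply: contraTneq aU => ->; rewrite unitr0.
have kxy := h _ _ xX yY nxy.
rewrite !inE; case: (eqVneq u y) => [->|uy] /=; case: (eqVneq v x) => [->|vx] //=.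
- by move=> _ /andP [_ vY]; rewrite piv_yv // -kxy => n; apply: h => //;
    apply: contraNneq n => ->; rewrite mulr0.
- by move=> /andP [_ uX] _; rewrite piv_ux // kxy => n; apply: h => //;
    apply: contraNneq n => ->; rewrite mulr0 oppr0.
move=> /andP [_ uX] /andP [_ vY]; rewrite piv_uv // => n.
have [z|n1] := eqVneq (A u v) 0; last exact: h.
have n2 : A u y != 0 by apply: contraNneq n => ->; rewrite z mulr0 mul0r subr0.
have n3 : A x v != 0 by apply: contraNneq n => ->; rewrite z mulr0 subr0.
by rewrite (h _ _ uX yY n2) -kxy (h _ _ xX vY n3).
Qed.

Lemma connected_piv X Y A x y : [disjoint X & Y] -> x \in X -> y \in Y ->
  A x y \is a GRing.unit -> connected X Y A ->
  connected (y |: X :\ x) (x |: Y :\ y) (piv A x y).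
Proof.
move=> d xX yY aU h k hk w w'.
rewrite (reach_cover (reach1 xX yY aU)); apply: h.
have aU' : piv A x y y x \is a GRing.unit by rewrite piv_yx unitrV.
have := edge_constant_piv (disj_piv d xX yY) (setU11 _ _) (setU11 _ _) aU' hk.
rewrite (piv_sets d) // (piv_sets' d) // => h' u v uX vY.
by rewrite -(piv_invol d xX yY aU uX vY); apply: h'.
Qed.

End Connectivity.

(** * Ratios in the two new columns over a connected matrix *)

Section Bad.

Variables (R Rh : comUnitRingType) (S : R -> Prop) (Sh : Rh -> Prop).
Variables (f : {rmorphism Rh -> R}) (U : R -> Rh) (E : finType).
Hypothesis HL : lifting S Sh f U.
Implicit Types (X Y D : {set E}) (M N : E -> E -> Rh).
Implicit Types (a b c z u v : E).

Let HS := lif_S HL.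
Let HSh := lif_Sh HL.
Notation global := (global Sh f U).
Notation good2 := (good2 Sh f U).
Notation obstruction_free := (obstruction_free S U).

(** Here X and Y describe the matrix without x and y, so pivots in X and Y never move these two
    columns. *)
Definition safe (x y : E) X Y M :=
  [/\ x \notin X :|: Y, y \notin X :|: Y, x != y &
   [/\ global X (y |: Y) M, global X (x |: Y) M & obstruction_free X (x |: (y |: Y)) (map_entries f M)]].

Lemma safeC x y X Y M : safe x y X Y M -> safe y x X Y M.
Proof.
case=> h1 h2 h3 [h4 h5 h6]; split=> //; first by rewrite eq_sym.
by split=> //; rewrite setUCA.
Qed.

Lemma safe_entin x y X Y M : safe x y X Y M -> entin Sh X (x |: (y |: Y)) M.
Proof.
case=> h1 h2 h3 [h4 h5 h6] u v uX; rewrite !inE => hv.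
have [e|vx] := eqVneq v x.
  by apply: (hereditary_now h5).1; rewrite // !inE e eqxx.
by apply: (hereditary_now h4).1; rewrite // !inE; move: hv; rewrite (negPf vx).
Qed.

Lemma safe_disj x y X Y M : safe x y X Y M -> [disjoint X & x |: (y |: Y)].
Proof. by case=> _ _ _ [_ _ h]; exact: hereditary_disj h. Qed.

Lemma safe_unit x y X Y M u v : safe x y X Y M -> u \in X -> v \in x |: (y |: Y) ->
  M u v != 0 -> M u v \is a GRing.unit.
Proof. by move=> h uX vY; apply: (psU HSh); apply: (safe_entin h). Qed.

Lemma safe_piv x y X Y M u v : safe x y X Y M -> u \in X -> v \in Y ->
  M u v \is a GRing.unit -> safe x y (v |: X :\ u) (u |: Y :\ v) (piv M u v).
Proof.
move=> hs uX vY aU; have d := safe_disj hs.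
case: hs => h1 h2 h3 [h4 h5 h6].
have cov w : w \in (v |: X :\ u) :|: (u |: Y :\ v) -> w \in X :|: Y.
  rewrite !inE => /orP [/orP [/eqP ->|/andP [_ ->]]|/orP [/eqP ->|/andP [_ ->]]];
  by rewrite ?vY ?uX ?orbT.
have yv : v != y by apply: contraNneq h2 => <-; rewrite inE vY orbT.
have xv : v != x by apply: contraNneq h1 => <-; rewrite inE vY orbT.
have e1 w D : v != w -> u |: (w |: D) :\ v = w |: (u |: D :\ v).
  move=> vw; apply/setP => e; rewrite !inE; case: (eqVneq e w) => [->|] /=.
    by rewrite [w == v]eq_sym vw orbT.
  by [].
split=> //; [by apply: contra h1 => /cov|by apply: contra h2 => /cov|].
split.
- by rewrite -e1 //; apply: hereditary_piv => //; rewrite inE vY orbT.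
- by rewrite -e1 //; apply: hereditary_piv => //; rewrite inE vY orbT.
have vD : v \in x |: (y |: Y) by rewrite !inE vY !orbT.
have := hereditary_reach h6 (reach_map f (reach1 uX vD aU)).
by rewrite e1 // e1.
Qed.

(** A common neighbour z of the two rows serves as a third column; the ratios on z, x and on z, y
    each miss one of the new columns. *)
Lemma good2_common x y X Y M a b z : safe x y X Y M -> a \in X -> b \in X ->
  z \in Y -> M a z != 0 -> M b z != 0 -> good2 M a b x y.
Proof.
move=> hs aX bX zY n1 n2; have hS := safe_entin hs.
case: (hs) => h1 h2 h3 [h4 h5 h6].
have cX : x \in x |: (y |: Y) by rewrite !inE eqxx.
have cY : y \in x |: (y |: Y) by rewrite !inE eqxx orbT.
have cZ : z \in x |: (y |: Y) by rewrite !inE zY !orbT.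
apply: (good2_trans HL hS h6 aX bX cX cY cZ n1 n2).
  by apply: (hereditary_now h5).2; rewrite // !inE ?eqxx ?zY ?orbT.
by apply: (hereditary_now h4).2; rewrite // !inE ?eqxx ?zY ?orbT.
Qed.

(** The induced path a, z1, c, z2, b, which is the shortest way to join two rows that have no common
    neighbour. *)
Definition config X Y M a b c z1 z2 := [/\ [/\ a \in X, b \in X & c \in X],
  [/\ z1 \in Y & z2 \in Y], [/\ M a z1 != 0 & M a z2 = 0],
  [/\ M b z1 = 0 & M b z2 != 0] & [/\ M c z1 != 0 & M c z2 != 0]].

Lemma configC X Y M a b c z1 z2 :
  config X Y M a b c z1 z2 -> config X Y M b a c z2 z1.
Proof. by case=> [[? ? ?] [? ?] [? ?] [? ?] [? ?]]. Qed.

Lemma config_neq X Y M a b c z1 z2 : config X Y M a b c z1 z2 ->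
  [/\ a != b, a != c, b != c & z1 != z2].
Proof.
case=> [_ _ [n1 n2] [n3 n4] [n5 n6]]; split.
- by apply: contraNneq n1 => ->; rewrite n3.
- by apply: contraNneq n6 => <-; rewrite n2.
- by apply: contraNneq n5 => <-; rewrite n3.
- by apply: contraNneq n1 => ->; rewrite n2.
Qed.

Lemma config_K x y X Y M a b c z1 z2 : safe x y X Y M ->
  config X Y M a b c z1 z2 -> M c x != 0 -> M c y != 0 -> good2 M a b x y.
Proof.
move=> hs [[aX bX cX] [z1Y z2Y] [n1 n2] [n3 n4] [n5 n6]] nx ny.
case: (hs) => _ _ _ [_ _ hf]; have hS := safe_entin hs.
apply: (good2_transT HL hS hf aX bX cX) => //; rewrite ?inE ?eqxx ?orbT //.
  exact: (good2_common hs cX aX z1Y).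
exact: (good2_common hs cX bX z2Y).
Qed.

(** As row c vanishes in columns x and y, the pivot over (c, z1) does not touch these columns, while
    it fills the entry (a, z2). After it a and b share the neighbour z2. *)
Lemma config_K0 x y X Y M a b c z1 z2 : safe x y X Y M ->
  config X Y M a b c z1 z2 -> M c x = 0 -> M c y = 0 -> good2 M a b x y.
Proof.
move=> hs hc zx zy; have [ab ac bc z12] := config_neq hc.
case: hc => [[aX bX cX] [z1Y z2Y] [n1 n2] [n3 n4] [n5 n6]].
have full z : z \in Y -> z \in x |: (y |: Y) by move=> zY; rewrite !inE zY !orbT.
have u5 := safe_unit hs cX (full _ z1Y) n5.
have u6 := safe_unit hs cX (full _ z2Y) n6.
have u1 := safe_unit hs aX (full _ z1Y) n1.
have hs' := safe_piv hs cX z1Y u5.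
have d := safe_disj hs.
have az := disj_neq d aX (full _ z1Y); have bz := disj_neq d bX (full _ z1Y).
have cz : z2 != c by rewrite eq_sym; apply: (disj_neq d cX); apply: full.
have xc : x != c by rewrite eq_sym; apply: (disj_neq d cX); rewrite !inE eqxx.
have yc : y != c by rewrite eq_sym; apply: (disj_neq d cX); rewrite !inE eqxx orbT.
have h : good2 (piv M c z1) a b x y.
  apply: (good2_common hs' (z := z2)).
  - by rewrite !inE ac aX orbT.
  - by rewrite !inE bc bX orbT.
  - by rewrite !inE z2Y [z2 == z1]eq_sym z12 orbT.
  - rewrite piv_uv // n2 sub0r.
    have : - ((M c z1)^-1 * M a z1 * M c z2) \is a GRing.unit.
      by rewrite unitrN !unitrM unitrV u5 u1 u6.
    by apply: contraTneq => ->; rewrite unitr0.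
  by rewrite piv_uv // n3 mulr0 mul0r subr0.
by apply: good2_ext h; rewrite piv_uv // ?zx ?zy mulr0 subr0.
Qed.

(** The pivot exchanges a with z1 in the path, keeps row b, and makes row z1 proportional to the old
    row a, so the ratio sought is unaffected. Only row c changes in columns x and y: this is the
    freedom used to reach [config_K]. *)
Lemma config_piv x y X Y M a b c z1 z2 : safe x y X Y M ->
  config X Y M a b c z1 z2 ->
  [/\ safe x y (z1 |: X :\ a) (a |: Y :\ z1) (piv M a z1),
      config (z1 |: X :\ a) (a |: Y :\ z1) (piv M a z1) z1 b c a z2,
      good2 (piv M a z1) z1 b x y -> good2 M a b x y,
      piv M a z1 b x = M b x /\ piv M a z1 b y = M b y &
      [/\ piv M a z1 b z2 = M b z2, piv M a z1 c z2 = M c z2,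
          piv M a z1 c x = M c x - (M a z1)^-1 * M c z1 * M a x &
          piv M a z1 c y = M c y - (M a z1)^-1 * M c z1 * M a y]].
Proof.
move=> hs hc; have [ab ac bc z12] := config_neq hc.
case: hc => [[aX bX cX] [z1Y z2Y] [n1 n2] [n3 n4] [n5 n6]].
have full z : z \in Y -> z \in x |: (y |: Y) by move=> zY; rewrite !inE zY !orbT.
have xF : x \in x |: (y |: Y) by rewrite !inE eqxx.
have yF : y \in x |: (y |: Y) by rewrite !inE eqxx orbT.
have u1 := safe_unit hs aX (full _ z1Y) n1.
have u5 := safe_unit hs cX (full _ z1Y) n5.
have d := safe_disj hs.
have bz := disj_neq d bX (full _ z1Y); have cz := disj_neq d cX (full _ z1Y).
have za : z2 != a by rewrite eq_sym; apply: (disj_neq d aX); apply: full.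
have xa : x != a by rewrite eq_sym; apply: (disj_neq d aX).
have ya : y != a by rewrite eq_sym; apply: (disj_neq d aX).
have nV : (M a z1)^-1 != 0.
  by apply: contraTneq (u1) => e; rewrite -unitrV e unitr0.
have Ex e : e != a -> piv M a z1 b e = M b e.
  by move=> ea; rewrite piv_uv // n3 mulr0 mul0r subr0.
split; [exact: safe_piv| | | by rewrite !Ex |].
- split; [|split| | |split].
  + by rewrite !inE [b == a]eq_sym [c == a]eq_sym ab ac bX cX eqxx !orbT.
  + by rewrite !inE eqxx.
  + by rewrite !inE [z2 == z1]eq_sym z12 z2Y orbT.
  + by rewrite piv_yx piv_yv // n2 mulr0.
  + by rewrite piv_ux // n3 mulr0 oppr0 Ex.
  + rewrite piv_ux //.
    have : - ((M a z1)^-1 * M c z1) \is a GRing.unit by rewrite unitrN unitrM unitrV u1.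
    by apply: contraTneq => ->; rewrite unitr0.
  by rewrite piv_uv // n2 mulr0 subr0.
- rewrite /good2 /cr !piv_yv // !Ex // => h m1 m2 m3 m4.
  have v2 := safe_unit hs aX yF m2; have v3 := safe_unit hs bX xF m3.
  have un w : M a w \is a GRing.unit -> (M a z1)^-1 * M a w != 0.
    move=> uw; have : (M a z1)^-1 * M a w \is a GRing.unit by rewrite unitrM unitrV u1.
    by apply: contraTneq => ->; rewrite unitr0.
  rewrite (_ : _ * _ * _ = (M a z1)^-1 * M a x * M b y
      * ((M a z1)^-1 * M a y * M b x)^-1).
    by apply: h => //; apply: un => //; apply: (safe_unit hs aX xF).
  by rewrite !invrM ?unitrM ?unitrV ?u1 ?v2 ?v3 // invrK; ring: (mulrV u1).
by rewrite Ex // !piv_uv // n2 mulr0 subr0.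
Qed.

(* With [M c x = 0] the two pivots on (a, z1) and (b, z2) change row c; unless
   one of them makes both [M c x] and [M c y] nonzero, the cross ratio is -1
   and the seven elements form a non-Fano configuration. *)
Lemma config_good0 x y X Y M a b c z1 z2 : safe x y X Y M ->
  config X Y M a b c z1 z2 -> M c x = 0 -> M c y != 0 -> good2 M a b x y.
Proof.
move=> hs hc zx ny m1 m2 m3 m4.
have [hs1 hc1 t1 [e1x e1y] [e1b e1z e1cx e1cy]] := config_piv hs hc.
have [hs2 hc2 t2 [e2x e2y] [e2b e2z e2cx e2cy]] := config_piv hs (configC hc).
have [hs3 hc3 t3 [e3x e3y] [e3b e3z e3cx e3cy]] := config_piv hs1 (configC hc1).
have [ab ac bc z12] := config_neq hc.
case: (hc) => [[aX bX cX] [z1Y z2Y] [n1 n2] [n3 n4] [n5 n6]].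
have full z : z \in Y -> z \in x |: (y |: Y) by move=> zY; rewrite !inE zY !orbT.
have xF : x \in x |: (y |: Y) by rewrite !inE eqxx.
have yF : y \in x |: (y |: Y) by rewrite !inE eqxx orbT.
have [u1 u4] := conj (safe_unit hs aX (full _ z1Y) n1) (safe_unit hs bX (full _ z2Y) n4).
have [u5 u6] := conj (safe_unit hs cX (full _ z1Y) n5) (safe_unit hs cX (full _ z2Y) n6).
have [v1 v2] := conj (safe_unit hs aX xF m1) (safe_unit hs aX yF m2).
have [v3 v4] := conj (safe_unit hs bX xF m3) (safe_unit hs bX yF m4).
have uy := safe_unit hs cX yF ny.
have hS := safe_entin hs.
have nu (r : Rh) : r \is a GRing.unit -> r != 0.
  by apply: contraTneq => ->; rewrite unitr0.
have rows N a' b' X' Y' : safe x y X' Y' N -> a' \in X' -> b' \in X' ->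
    good2 N a' b' x y -> good2 N b' a' x y.
  move=> hs' a'X b'X; have hS' := safe_entin hs'.
  by apply: (good2_rows HL); apply: hS'; rewrite // !inE eqxx ?orbT.
(* Three attempts to make row c nonzero in both x and y: the pivot on (a, z1), the one on (b, z2),
   and both in succession. Each one that succeeds ends the proof by [config_K]. *)
have [h1|nh1] := eqVneq (piv M a z1 c y) 0; last first.
  apply: t1 => //; apply: (config_K hs1 hc1) => //.
  by rewrite e1cx zx sub0r; apply: nu; rewrite unitrN !unitrM unitrV u1 u5 v1.
have [h2|nh2] := eqVneq (piv M b z2 c y) 0; last first.
  apply: (rows _ _ _ _ _ hs bX aX) => //; apply: t2; apply: (config_K hs2 hc2) => //.
  by rewrite e2cx zx sub0r; apply: nu; rewrite unitrN !unitrM unitrV u4 u6 v3.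
have [h3|nh3] := eqVneq (piv (piv M a z1) b z2 c x) 0; last first.
  apply: t1 => //; case: (hc1) => [[z1X' bX' _] _ _ _ _].
  apply: (rows _ _ _ _ _ hs1 bX' z1X').
  apply: t3; apply: (config_K hs3 hc3) => //.
  rewrite e3cy h1 sub0r e1b e1z e1y; apply: nu.
  by rewrite unitrN !unitrM unitrV u4 u6 v4.
have {h1} E1 : M c y = (M a z1)^-1 * M c z1 * M a y.
  by apply/eqP; rewrite -subr_eq0 -e1cy h1.
have {h2} E2 : M c y = (M b z2)^-1 * M c z2 * M b y.
  by apply/eqP; rewrite -subr_eq0 -e2cy h2.
have {h3} E3 : (M b z2)^-1 * M c z2 * M b x = - ((M a z1)^-1 * M c z1 * M a x).
  by move: h3; rewrite e3cx e1b e1z e1x e1cx zx sub0r => /eqP; rewrite subr_eq0 => /eqP ->.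
have vb : M b x = - (M b z2 * (M c z2)^-1 * ((M a z1)^-1 * M c z1 * M a x)).
  by rewrite -mulrN -E3; ring: (mulrV u4) (mulrV u6).
have vt : M a y = M a z1 * (M c z1)^-1 * M c y.
  by rewrite E1; ring: (mulrV u1) (mulrV u5).
have vv : M b y = M b z2 * (M c z2)^-1 * M c y.
  by rewrite E2; ring: (mulrV u4) (mulrV u6).
have crE : cr M a b x y = -1.
  rewrite /cr vb vt vv mulrN invrN !invrM ?unitrM ?unitrV ?u1 ?u4 ?u5 ?u6 ?v1 ?uy // !invrK.
  ring: (mulrV u1) (mulrV u4) (mulrV u5) (mulrV u6) (mulrV v1) (mulrV uy).
have hf : obstruction_free X (x |: (y |: Y)) (map_entries f M) by case: (hs) => _ _ _ [].
have nf u v : u \in X -> v \in x |: (y |: Y) -> M u v != 0 -> map_entries f M u v != 0.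
  by move=> uX vY; rewrite /map_entries (lif_eq0 HL) //; apply: hS.
have fN1 : f (-1) = -1 by rewrite rmorphN rmorph1.
rewrite crE; apply: (good_lift HL); rewrite fN1.
  rewrite -fN1 -crE (f_cr HL) ?hS //; try exact: hS.
  by apply: (hereditary_fund HS (obstruction_free_entin hf)) => //; apply: nf.
(* This pivot displays the pattern of [minus_one_law]: rows z1, a, b have their zeros in columns x,
   y, c respectively, and column z2 has none. *)
set N := piv M c z1.
have hN : obstruction_free (z1 |: X :\ c) (c |: (x |: (y |: Y)) :\ z1) (map_entries f N).
  by apply: (hereditary_reach hf); apply/reach_map/reach1 => //; apply: full.
have [_ [_ _ o1 _]] := hereditary_now hN.
have d := safe_disj hs.
have xc : x != c by rewrite eq_sym; apply: (disj_neq d cX).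
have yc : y != c by rewrite eq_sym; apply: (disj_neq d cX).
have z2c : z2 != c by rewrite eq_sym; apply: (disj_neq d cX); apply: full.
have az := disj_neq d aX (full _ z1Y); have bz := disj_neq d bX (full _ z1Y).
have [xz yz] : x != z1 /\ y != z1.
  case: (hs) => hx hy _ _; split; apply: contraTneq z1Y => <-.
    by move: hx; rewrite inE negb_or => /andP [].
  by move: hy; rewrite inE negb_or => /andP [].
have N1x : N z1 x = 0 by rewrite /N piv_yv // zx mulr0.
have N1y : N z1 y = (M c z1)^-1 * M c y by rewrite /N piv_yv.
have N1c : N z1 c = (M c z1)^-1 by rewrite /N piv_yx.
have N1z : N z1 z2 = (M c z1)^-1 * M c z2 by rewrite /N piv_yv.
have N2x : N a x = M a x by rewrite /N piv_uv // zx mulr0 subr0.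
have N2y : N a y = 0 by rewrite /N piv_uv // vt; ring: (mulrV u1) (mulrV u5).
have N2c : N a c = - ((M c z1)^-1 * M a z1) by rewrite /N piv_ux.
have N2z : N a z2 = - ((M c z1)^-1 * M a z1 * M c z2) by rewrite /N piv_uv // n2 sub0r.
have N3 e : e != c -> N b e = M b e.
  by move=> ec; rewrite /N piv_uv // n3 mulr0 mul0r subr0.
have N3c : N b c = 0 by rewrite /N piv_ux // n3 mulr0 oppr0.
have hSN : entin Sh (z1 |: X :\ c) (x |: (y |: (c |: Y :\ z1))) N.
  exact/safe_entin/safe_piv.
have mem1 : z1 \in z1 |: X :\ c by rewrite setU11.
have mem2 : a \in z1 |: X :\ c by rewrite !inE ac aX orbT.
have mem3 : b \in z1 |: X :\ c by rewrite !inE bc bX orbT.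
have inj0 u v (w : Rh) : u \in z1 |: X :\ c -> v \in x |: (y |: (c |: Y :\ z1)) ->
    N u v = w -> w \is a GRing.unit -> map_entries f N u v != 0.
  by move=> uX vY e wU; rewrite /map_entries e; apply: contraTneq (rmorph_unit f wU) => ->; rewrite unitr0.
have cx : x \in x |: (y |: (c |: Y :\ z1)) by rewrite !inE eqxx.
have cy : y \in x |: (y |: (c |: Y :\ z1)) by rewrite !inE eqxx !orbT.
have cc : c \in x |: (y |: (c |: Y :\ z1)) by rewrite !inE eqxx !orbT.
have cz : z2 \in x |: (y |: (c |: Y :\ z1)) by rewrite !inE z2Y [z2 == z1]eq_sym z12 !orbT.
have fcr a' b' x' y' : N a' y' * N b' x' \is a GRing.unit ->
    N a' x' * N b' y' = N a' y' * N b' x' -> cr (map_entries f N) a' b' x' y' = 1.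
  move=> wU e; rewrite /cr /map_entries -!rmorphM e mulrV //; exact: rmorph_unit.
apply: (o1 z1 a b x y c z2) => //.
- by rewrite !inE xz eqxx !orbT.
- by rewrite !inE yz eqxx !orbT.
- by rewrite !inE eqxx.
- by rewrite !inE z2Y [z2 == z1]eq_sym z12 !orbT.
- by rewrite /map_entries N1x rmorph0.
- by apply: (inj0 _ _ _ _ _ N1y); rewrite // unitrM unitrV u5.
- by apply: (inj0 _ _ _ _ _ N1c); rewrite // unitrV.
- by apply: (inj0 _ _ _ _ _ N1z); rewrite // unitrM unitrV u5.
- by apply: (inj0 _ _ _ _ _ N2x).
- by rewrite /map_entries N2y rmorph0.
- by apply: (inj0 _ _ _ _ _ N2c); rewrite // unitrN unitrM unitrV u5.
- by apply: (inj0 _ _ _ _ _ N2z); rewrite // unitrN !unitrM unitrV u5 u1.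
- by apply: (inj0 _ _ _ _ _ (N3 _ xc)).
- by apply: (inj0 _ _ _ _ _ (N3 _ yc)).
- by rewrite /map_entries N3c rmorph0.
- by apply: (inj0 _ _ _ _ _ (N3 _ z2c)).
- apply: fcr; first by rewrite N1z N2c unitrM unitrN !unitrM unitrV u5 u6 u1.
  by rewrite N1c N2z N1z N2c; ring.
- apply: fcr; first by rewrite N1z !N3 // !unitrM unitrV u5 u6 v4.
  by rewrite N1y N1z !N3 // vv; ring: (mulrV u6).
apply: fcr; first by rewrite N2z !N3 // unitrM unitrN !unitrM unitrV u5 u6 u1 v3.
by rewrite N2x N2z !N3 // vb; ring: (mulrV u6) (mulrV u5) (mulrV u1).
Qed.

Lemma config_good x y X Y M a b c z1 z2 : safe x y X Y M ->
  config X Y M a b c z1 z2 -> good2 M a b x y.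
Proof.
move=> hs hc; have [zx|nx] := eqVneq (M c x) 0; have [zy|ny] := eqVneq (M c y) 0.
- exact: (config_K0 hs hc).
- exact: (config_good0 hs hc).
- case: (hc) => [[aX bX _] _ _ _ _]; have hS := safe_entin hs.
  apply: (good2_cols HL); try (by apply: hS; rewrite // !inE eqxx ?orbT).
  exact: (config_good0 (safeC hs) hc).
exact: (config_K hs hc).
Qed.

Definition rowadj Y M : rel E := fun u v => [exists z in Y, (M u z != 0) && (M v z != 0)].

Lemma rowadjP Y M u v :
  reflect (exists z, [/\ z \in Y, M u z != 0 & M v z != 0]) (rowadj Y M u v).
Proof.
apply: (iffP existsP) => [[z /and3P [? ? ?]]|[z [? ? ?]]]; exists z => //.
exact/and3P.
Qed.

(** Induction on the length of the path of rows. Chords at its first two vertices shorten it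
    directly; two steps without a chord are a [config]; and from a longer path a pivot removes the
    second row. *)
Lemma path_good n x y X Y M a p : safe x y X Y M -> path (rowadj Y M) a p ->
  a \in X -> {subset p <= X} -> (size p < n)%N -> good2 M a (last a p) x y.
Proof.
elim: n X Y M a p => // n ih X Y M a p hs hp aX pX; rewrite ltnS => hn.
have hS := safe_entin hs; have d := safe_disj hs.
have xF : x \in x |: (y |: Y) by rewrite !inE eqxx.
have yF : y \in x |: (y |: Y) by rewrite !inE eqxx orbT.
case: p hp pX hn => [|c1 [|c2 p]] hp pX hn.
- by apply: (good2_same_rows HL); apply: hS.
- move: hp => /= /andP [/rowadjP [z [zY n1 n2]] _].
  by apply: (good2_common hs aX _ zY n1 n2); apply: pX; rewrite inE.
have c1X : c1 \in X by apply: pX; rewrite !inE eqxx.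
have c2X : c2 \in X by apply: pX; rewrite !inE eqxx orbT.
have pX2 u : u \in p -> u \in X by move=> up; apply: pX; rewrite !inE up !orbT.
have /and3P [ac1 c12 hp2] : [&& rowadj Y M a c1, rowadj Y M c1 c2 & path (rowadj Y M) c2 p] := hp.
have [/hasP [u uin au]|/hasPn na] := boolP (has (rowadj Y M a) (c2 :: p)).
  have [q1 [q2 eq]] : exists q1 q2, c2 :: p = q1 ++ u :: q2.
    by case/splitPr: uin => q1 q2; exists q1, q2.
  have -> : last a [:: c1, c2 & p] = last a (u :: q2).
    by rewrite -[LHS]/(last c1 (c2 :: p)) eq last_cat.
  have sub : {subset u :: q2 <= [:: c1, c2 & p]}.
    by move=> e eu; rewrite inE eq mem_cat eu !orbT.
  apply: ih hs _ aX _ _.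
  - rewrite /= au /=; have : path (rowadj Y M) c1 (c2 :: p) by rewrite /= c12.
    by rewrite eq cat_path /= => /and3P [].
  - by move=> e /sub /pX.
  - apply: leq_trans hn; rewrite -[size [:: c1, c2 & p]]/(size (c2 :: p)).+1 eq size_cat /=.
    by rewrite ltnS leq_addl.
have [/hasP [u uin cu]|/hasPn nc] := boolP (has (rowadj Y M c1) p).
  have [q1 [q2 eq]] : exists q1 q2, p = q1 ++ u :: q2.
    by case/splitPr: uin => q1 q2; exists q1, q2.
  have -> : last a [:: c1, c2 & p] = last a [:: c1, u & q2].
    by rewrite -[LHS]/(last c2 p) eq last_cat.
  apply: ih hs _ aX _ _.
  - rewrite /= ac1 cu /=; move: hp2; by rewrite eq cat_path /= => /and3P [].
  - move=> e; rewrite inE => /orP [/eqP -> //|eu]; apply: pX2.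
    by rewrite eq mem_cat eu orbT.
  - apply: leq_trans hn; rewrite /= eq size_cat /=; lia.
have /rowadjP [z1 [z1Y n1 n2]] := ac1; have /rowadjP [z2 [z2Y n3 n4]] := c12.
have na2 : rowadj Y M a c2 = false by apply/negbTE/na; rewrite inE eqxx.
have z2a : M a z2 = 0.
  apply/eqP; apply: contraFT na2 => n5; apply/rowadjP; by exists z2.
have z1c : M c2 z1 = 0.
  apply/eqP; apply: contraFT na2 => n5; apply/rowadjP; by exists z1.
case: p {hp pX} pX2 hn na nc hp2 => [|c3 p] pX2 hn na nc hp2.
  exact: (config_good hs (a := a) (b := c2) (c := c1) (z1 := z1) (z2 := z2)).
have full z : z \in Y -> z \in x |: (y |: Y) by move=> zY; rewrite !inE zY !orbT.
(* The pivot over (c1, z2) removes c1 from the rows. Row c2 picks up column z1 from row c1 and so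
   becomes adjacent to a. Row a and the rows from c3 on are zero in column z2, hence unchanged, and
   a, c2, c3, ... is a shorter path with the same ends. *)
have uz : M c1 z2 \is a GRing.unit by apply: (safe_unit hs) => //; apply: full.
have hs' := safe_piv hs c1X z2Y uz.
have pz u : u \in c3 :: p -> M u z2 = 0.
  move=> up; apply/eqP; apply: contraT => n5.
  by have /negP [] := nc u up; apply/rowadjP; exists z2.
have xc : x != c1 by rewrite eq_sym; apply: (disj_neq d c1X).
have yc : y != c1 by rewrite eq_sym; apply: (disj_neq d c1X).
have row0 u e : u \in X -> M u z2 = 0 -> e != c1 -> piv M c1 z2 u e = M u e.
  move=> uX e0 ec; rewrite piv_uv ?e0 ?mulr0 ?mul0r ?subr0 //.
  by apply: (disj_neq d uX); apply: full.
have memX u : u \in X -> M u z2 = 0 -> u \in z2 |: X :\ c1.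
  by move=> uX u0; rewrite !inE uX andbT; apply/orP; right; apply: contraNneq n3 => <-; rewrite u0.
have neY z : z \in Y -> z != c1.
  by move=> zY; rewrite eq_sym; apply: (disj_neq d c1X); apply: full.
have memY z u : z \in Y -> M u z2 = 0 -> M u z != 0 -> z \in c1 |: Y :\ z2.
  move=> zY u0 uz'; rewrite !inE zY andbT; apply/orP; right.
  by apply: contraNneq uz' => ->; rewrite u0.
have c21 : c2 != c1 by apply: contraNneq n2 => <-; rewrite z1c.
have c2z : c2 != z2 by apply: (disj_neq d c2X); apply: full.
have c3in : c3 \in c3 :: p by rewrite inE eqxx.
have lin : last c3 p \in c3 :: p by apply: mem_last.
have h : good2 (piv M c1 z2) a (last a [:: c2, c3 & p]) x y.
  apply: ih hs' _ (memX _ aX z2a) _ _ => //=.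
  - apply/and3P; split.
    + apply/rowadjP; exists z1; split; first exact: memY n1.
        by rewrite row0 ?neY.
      rewrite piv_uv ?neY // z1c sub0r.
      have : - ((M c1 z2)^-1 * M c2 z2 * M c1 z1) \is a GRing.unit.
        rewrite unitrN !unitrM unitrV uz.
        by rewrite !(safe_unit hs) ?full.
      by apply: contraTneq => ->; rewrite unitr0.
    + move: hp2 => /= /andP [/rowadjP [z3 [z3Y n5 n6]] _].
      have z3c : M c1 z3 = 0.
        apply/eqP; apply: contraT => n7.
        by have /negP [] := nc c3 c3in; apply/rowadjP; exists z3.
      apply/rowadjP; exists z3; split; first exact: memY (pz _ c3in) n6.
        by rewrite piv_uv ?neY // z3c mulr0 subr0.
      by rewrite row0 ?neY ?pz ?pX2.
    move: hp2 => /= /andP [_].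
    apply: (@sub_in_path _ (fun u => (u \in X) && (M u z2 == 0))).
      move=> u v /andP [uX /eqP u0] /andP [vX /eqP v0] /rowadjP [z [zY m1 m2]].
      by apply/rowadjP; exists z; split; [apply: memY m1|rewrite row0 ?neY|rewrite row0 ?neY].
    by apply/allP => u up; rewrite pX2 // pz //=.
  - move=> u; rewrite inE => /orP [/eqP ->|up]; first by rewrite !inE c21 c2X orbT.
    by apply: memX; [apply: pX2|apply: pz].
by apply: good2_ext h; rewrite ?(row0 _ _ aX z2a) ?(row0 _ _ (pX2 _ lin) (pz _ lin)).
Qed.

Lemma connected_path x y X Y M a b : safe x y X Y M -> connected X Y M ->
  a \in X -> b \in X -> exists p, [/\ path (rowadj Y M) a p, {subset p <= X}
    & b = last a p].
Proof.
move=> hs hc aX bX; have d : [disjoint X & Y].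
  by have := safe_disj hs; apply: disjointWr; rewrite !setUA subsetUr.
pose e u v := [&& u \in X, v \in X & rowadj Y M u v].
pose k w := if w \in X then connect e a w
            else [exists u in X, (M u w != 0) && connect e a u].
have hk : edge_constant X Y M k.
  move=> u v uX vY n; rewrite /k uX (disjointFl d vY).
  apply/idP/existsP => [h|[u' /and3P [u'X n' h]]].
    by exists u; rewrite uX n h.
  apply: connect_trans h _; apply: connect1; rewrite /e u'X uX /=.
  by apply/rowadjP; exists v.
have : k b.
  rewrite -(hc k hk a b) ?inE ?aX ?bX //.
  by rewrite /k aX connect0.
rewrite /k bX => /connectP [p hp ->]; exists p; split=> //.
  by apply: sub_path hp => u v /and3P [].
elim: p a {aX hk k hc} hp => //= c p ih a /andP [/and3P [_ cX _] hp] u.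
by rewrite inE => /orP [/eqP ->|/(ih _ hp)].
Qed.

Lemma safe_conn_good2 x y X Y M a b : safe x y X Y M -> connected X Y M ->
  a \in X -> b \in X -> good2 M a b x y.
Proof.
move=> hs hc aX bX; have [p [hp sp ->]] := connected_path hs hc aX bX.
exact: (path_good hs hp aX sp (ltnSn _)).
Qed.

Lemma safe_glob x y X Y M : safe x y X Y M -> connected X Y M ->
  global X (x |: (y |: Y)) M.
Proof.
move=> hs hc; have d := safe_disj hs; case: (hs) => hx hy xy [h1 h2 h3].
have [xY yY] : x \notin Y /\ y \notin Y.
  by move: hx hy; rewrite !inE !negb_or => /andP [_ ->] /andP [_ ->].
apply: (almost_glob_glob HL (x := x) (y := y)); split=> //.
- by rewrite !inE eqxx.
- by rewrite !inE eqxx orbT.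
have e1 : (x |: (y |: Y)) :\ x = y |: Y.
  by rewrite setU1K // !inE negb_or xy.
have e2 : (x |: (y |: Y)) :\ y = x |: Y.
  by rewrite setUCA setU1K // !inE negb_or eq_sym xy.
rewrite e1 e2; split=> //.
have e3 : (x |: (y |: Y)) :\: [set x; y] = Y.
  apply/setP => e; rewrite !inE; case: (eqVneq e x) => [->|_] /=.
    by rewrite (negPf xY).
  by case: (eqVneq e y) => [->|_] //=; rewrite (negPf yY).
rewrite e3 => X' Y' M' r a b aX bX.
suff [hs' hc'] : safe x y X' Y' M' /\ connected X' Y' M' by apply: safe_conn_good2 hs' hc' aX bX.
elim: r {a b aX bX} => // X1 Y1 M1 u v r1 [hs1 hc1] uX vY aU.
split; first exact: safe_piv.
apply: connected_piv => //; have := safe_disj hs1; apply: disjointWr.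
by rewrite !setUA subsetUr.
Qed.

End Bad.

(** * Signatures and uniqueness of lifts *)

Section Walks.

Variables (R : comUnitRingType) (E : finType).
Implicit Types (w : E -> E -> R) (e : rel E) (x y : E) (p c : seq E).

Fixpoint wprod w x p : R := if p is y :: p' then w x y * wprod w y p' else 1.

Definition cycprod w c : R := if c is x :: p then wprod w x (rcons p x) else 1.

Lemma wprod_cat w x p q : wprod w x (p ++ q) = wprod w x p * wprod w (last x p) q.
Proof. by elim: p x => [|y p ih] x /=; rewrite ?mul1r // ih mulrA. Qed.

Lemma cycprod_rot w n c : cycprod w (rot n c) = cycprod w c.
Proof.
rewrite /rot -[in RHS](cat_take_drop n c).
case: (drop n c) => [|x p]; first by rewrite cats0.
case: (take n c) => [|y q] /=; first by rewrite cats0.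
rewrite -!cats1 -!catA /= -![_ :: _ ++ _]/((_ :: _) ++ _).
rewrite -(cat1s y) -(cat1s x) !catA !wprod_cat !last_cat /=.
by ring.
Qed.

Lemma cycprod_split w x p q :
  cycprod w (x :: p ++ x :: q) = cycprod w (x :: p) * cycprod w (x :: q).
Proof. by rewrite /= rcons_cat -cat_rcons wprod_cat last_rcons. Qed.

Lemma cycle_split e x p q :
  path.cycle e (x :: p ++ x :: q) = path.cycle e (x :: p) && path.cycle e (x :: q).
Proof. by rewrite /= rcons_cat -cat_rcons cat_path last_rcons. Qed.

Lemma wprod_next w (g : E -> E) x p : path (frel g) x p ->
  wprod w x p = \prod_(v <- belast x p) w v (g v).
Proof.
elim: p x => [|y p ih] x /=; first by rewrite big_nil.
by case/andP=> /eqP <- /ih ->; rewrite big_cons.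
Qed.

Lemma cycprod_next w c : uniq c -> cycprod w c = \prod_(v <- c) w v (next c v).
Proof.
case: c => [|x p]; first by rewrite big_nil.
move=> /cycle_next /= h; rewrite (wprod_next _ h) belast_rcons //.
Qed.

Lemma wprod_potential w w' e (g : E -> R) x p : (forall x, g x \is a GRing.unit) ->
  (forall x y, e x y -> w' x y = (g x)^-1 * w x y * g y) -> path e x p ->
  wprod w' x p = (g x)^-1 * wprod w x p * g (last x p).
Proof.
move=> gU h; elim: p x => [|y p ih] x /=; first by rewrite mulr1 mulVr.
case/andP=> /h -> /ih ->; have := gU y => gy; ring: (mulrV gy).
Qed.

Lemma cycprod_potential w w' e (g : E -> R) c : (forall x, g x \is a GRing.unit) ->
  (forall x y, e x y -> w' x y = (g x)^-1 * w x y * g y) -> path.cycle e c ->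
  cycprod w' c = cycprod w c.
Proof.
move=> gU h; case: c => //= x p hp; rewrite (wprod_potential gU h hp) last_rcons.
by have := gU x => gx; ring: (mulrV gx).
Qed.

Definition induced e c := [/\ (2 < size c)%N, ucycle e c &
  forall u v, u \in c -> v \in c -> e u v = (v == next c u) || (u == next c v)].

Section Balanced.

Variables (e : rel E) (w : E -> E -> R).
Hypotheses (esym : symmetric e) (eirr : irreflexive e).
Hypothesis (wV : forall u v, e u v -> w u v * w v u = 1).
Hypothesis (hind : forall c, induced e c -> cycprod w c = 1).

(* A repeated vertex or a chord splits a closed walk into two shorter ones. *)
Lemma cycle_balanced c : path.cycle e c -> cycprod w c = 1.
Proof.
have [n] := ubnP (size c); elim: n c => // n ih c; rewrite ltnS => hn hc.
have [uc|nuc] := boolP (uniq c); last first.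
  have [x [q1 [q2 [q3 ec]]]] : exists x q1 q2 q3, c = q1 ++ x :: q2 ++ x :: q3.
    elim: (c) nuc => //= y s ihs; rewrite negb_and negbK => /orP [ys|/ihs].
      by case/splitPr: ys => s1 s2; exists y, [::], s1, s2.
    by move=> [x [q1 [q2 [q3 ->]]]]; exists x, (y :: q1), q2, q3.
  have : cycprod w c = cycprod w ((x :: q2 ++ x :: q3) ++ q1).
    by rewrite ec -rot_size_cat cycprod_rot.
  have : path.cycle e ((x :: q2 ++ x :: q3) ++ q1).
    by rewrite -rot_size_cat rot_cycle -ec.
  rewrite cat_cons -catA cat_cons cycle_split => /andP [h1 h2] ->.
  rewrite cycprod_split !ih ?mulr1 //.
  - by apply: leq_trans hn; rewrite ec !size_cat /= !size_cat /=; lia.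
  - by apply: leq_trans hn; rewrite ec !size_cat /= !size_cat /=; lia.
(* A closed walk with at most two vertices is empty or traverses one edge in both directions. *)
case: (leqP 3 (size c)) => [sc|]; last first.
  case: c hc {hn uc} => [|x [|y [|z c]]] //=; first by rewrite eirr.
  by rewrite mulr1 => /andP [exy _] _; apply: wV.
have [/forallP ind|] := boolP [forall u in c, forall v in c,
    e u v == ((v == next c u) || (u == next c v))].
  apply: hind; split=> //; first by rewrite /ucycle hc.
  move=> u v uc' vc; apply/eqP.
  by have /implyP/(_ uc')/forallP/(_ v)/implyP/(_ vc) := ind u.
rewrite negb_forall => /existsP [u]; rewrite negb_imply => /andP [uin].
rewrite negb_forall => /existsP [v]; rewrite negb_imply => /andP [vin].
move=> ne; have [euv [nv nu]] : e u v /\ v != next c u /\ u != next c v.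
  move: ne; case: (eqVneq v (next c u)) => [->|nv] /=.
    by rewrite (next_cycle hc).
  case: (eqVneq u (next c v)) => [->|nu] /=.
    by rewrite esym (next_cycle hc).
  by case: (e u v).
have [i p ep] := rot_to uin.
have up : uniq (u :: p) by rewrite -ep rot_uniq.
have cp : path.cycle e (u :: p) by rewrite -ep rot_cycle.
have sp : size (u :: p) = size c by rewrite -ep size_rot.
have nE : next (u :: p) =1 next c by rewrite -ep; apply: next_rot.
rewrite -(cycprod_rot w i) ep.
have vp : v \in p.
  have : v \in u :: p by rewrite -ep mem_rot.
  by rewrite inE => /orP [/eqP vu|//]; move: euv; rewrite vu eirr.
case/splitPr: vp up cp sp nE => p1 p2 up cp sp nE.
case: p1 up cp sp nE => [|a p1] up cp sp nE.
  by move: nv; rewrite -nE /= eqxx eqxx.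
have nvE : next (u :: (a :: p1) ++ v :: p2) v = head u p2.
  rewrite -(next_rot (size (u :: a :: p1)) up) rot_size_cat.
  by case: (p2) => [|b q] /=; rewrite eqxx.
case: p2 up cp sp nE nvE => [|b p2] up cp sp nE nvE.
  by move: nu; rewrite -nE nvE eqxx.
have c1 : path.cycle e (u :: rcons (a :: p1) v) && path.cycle e (u :: v :: b :: p2).
  move: cp; rewrite /= !rcons_path !cat_path !last_cat /= !last_rcons.
  move=> /andP [ua /andP [/and3P [h1 h2 /andP [h3 h4]] h5]].
  by rewrite ua h1 h2 euv h3 h4 h5 esym euv.
move/andP: c1 => [hc1 hc2].
have [i1 i2] : cycprod w (u :: rcons (a :: p1) v) = 1 /\ cycprod w (u :: v :: b :: p2) = 1.
  have {}hn : ((size p1 + (size p2).+2).+2 <= n)%N by move: hn; rewrite -sp /= size_cat.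
  split; apply: ih => //; apply: leq_trans hn; rewrite /= ?size_rcons.
    clear; lia.
  clear; lia.
move: i1 i2; rewrite /cycprod -!cats1 -!catA /=.
rewrite !wprod_cat /= !wprod_cat /= => i1 i2.
(* The two shorter walks traverse the chord in opposite directions, so its weights cancel in the
   product. *)
have wvu := wV euv.
have mul11 (r s : R) : r = 1 -> s = 1 -> r * s = 1 by move=> -> ->; rewrite mulr1.
by apply: etrans (mul11 _ _ i1 i2); ring: wvu.
Qed.

Lemma wprod_back x p : path e x p -> exists q, [/\ path e (last x p) q,
  last (last x p) q = x & wprod w x p * wprod w (last x p) q = 1].
Proof.
elim: p x => [|y p ih] x /=; first by exists [::]; rewrite /= mulr1.
case/andP=> exy /ih [q [hq lq wq]]; exists (rcons q x).
rewrite rcons_path last_rcons lq esym exy hq; split=> //.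
rewrite -cats1 wprod_cat lq /= mulr1.
have := wV exy => h; rewrite -[RHS]h -[in RHS](mulr1 (w x y)) -wq; ring.
Qed.

(** A weight that is trivial on closed walks is a coboundary: g x is the weight of some walk to x
    from the root of its component. The set [T] records that such weights stay in a multiplicative
    set of units. *)
Lemma potential (T : R -> Prop) : T 1 -> (forall a b, T a -> T b -> T (a * b)) ->
  (forall u v, e u v -> T (w u v)) -> (forall a, T a -> a \is a GRing.unit) ->
  exists g : E -> R, (forall x, T (g x)) /\
    forall x y, e x y -> w x y = (g x)^-1 * g y.
Proof.
move=> T1 TM Tw TU.
have cs : connect_sym e by apply: sym_connect_sym.
have Tp x p : path e x p -> T (wprod w x p).
  by elim: p x => //= y p ih x /andP [/Tw h /ih]; apply: TM.
have [x|g hg] := @choice E R (fun x r => exists p,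
    [/\ path e (fingraph.root e x) p, x = last (fingraph.root e x) p
      & r = wprod w (fingraph.root e x) p]).
  have : connect e (fingraph.root e x) x by rewrite cs connect_root.
  by case/connectP => p hp lp; exists (wprod w (fingraph.root e x) p), p.
exists g; split=> [x|x y exy].
  by have [p [hp _ ->]] := hg x; apply: Tp.
have [p [hp lp ->]] := hg x; have [q [hq lq ->]] := hg y.
have rxy : fingraph.root e y = fingraph.root e x by apply/eqP; rewrite eq_sym (root_connect cs) connect1.
rewrite rxy in hq lq *.
have [q' [hq' lq' wq']] := wprod_back hq; rewrite -lq in hq' lq' wq'.
have wpU := TU _ (Tp _ _ hp); have wqU := TU _ (Tp _ _ hq).
have : wprod w (fingraph.root e x) (p ++ y :: q') = 1.
  have hc : path e (fingraph.root e x) (p ++ y :: q').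
    by rewrite cat_path hp /= -lp exy.
  have hl : last (fingraph.root e x) (p ++ y :: q') = fingraph.root e x by rewrite last_cat /= lq'.
  case: (lastP (p ++ y :: q')) hc hl => // s z; rewrite last_rcons => hc hz.
  by rewrite hz in hc *; apply: (@cycle_balanced (fingraph.root e x :: s)).
rewrite wprod_cat -lp /= => h.
have e1 : wprod w y q' = (wprod w (fingraph.root e x) q)^-1.
  by rewrite -[LHS]mul1r -[in LHS](mulVr wqU) -mulrA wq' mulr1.
rewrite e1 in h.
have : (wprod w (fingraph.root e x) p)^-1 * (wprod w (fingraph.root e x) p * (w x y * (wprod w (fingraph.root e x) q)^-1))
   * wprod w (fingraph.root e x) q = (wprod w (fingraph.root e x) p)^-1 * wprod w (fingraph.root e x) q.
  by rewrite h mulr1.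
move=> <-; ring: (mulrV wpU) (mulrV wqU).
Qed.

End Balanced.

End Walks.

Section Adjacency.

Variables (R : comUnitRingType) (E : finType).
Implicit Types (A M N : E -> E -> R) (X Y : {set E}) (c : seq E).

Definition radj X Y A : rel E := fun u v =>
  [&& u \in X, v \in Y & A u v != 0] || [&& v \in X, u \in Y & A v u != 0].

Definition esig X A v w := if v \in X then A v w else (A w v)^-1.

Definition csig X A c := (if odd (size c)./2 then -1 else 1)
  * \prod_(v <- c) esig X A v (next c v).

Lemma radj_sym X Y A : symmetric (radj X Y A).
Proof. by move=> u v; rewrite /radj orbC. Qed.

Lemma radjE X Y A u v : [disjoint X & Y] -> u \in X ->
  radj X Y A u v = (v \in Y) && (A u v != 0).
Proof.
by move=> d uX; rewrite /radj uX (disjointFr d uX) /= andbF orbF.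
Qed.

Lemma radj_irr X Y A : [disjoint X & Y] -> irreflexive (radj X Y A).
Proof.
move=> d u; rewrite /radj; case: (boolP (u \in X)) => //= uX.
by rewrite (disjointFr d uX).
Qed.

Lemma csig_cycprod X A c : uniq c ->
  csig X A c = (if odd (size c)./2 then -1 else 1) * cycprod (esig X A) c.
Proof. by move=> uc; rewrite cycprod_next. Qed.

Lemma induced_rot e n c : @induced E e c -> induced e (rot n c).
Proof.
case=> h1 /andP [h2 h3] h4; split; first by rewrite size_rot.
  by rewrite /ucycle rot_cycle rot_uniq h2.
by move=> u v; rewrite !mem_rot => uc vc; rewrite !next_rot //; apply: h4.
Qed.

Lemma csig_rot X A n c : uniq c -> csig X A (rot n c) = csig X A c.
Proof. by move=> uc; rewrite !csig_cycprod ?rot_uniq // size_rot cycprod_rot. Qed.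

End Adjacency.

Section Signature.

Variables (R Rh : comUnitRingType) (S : R -> Prop) (Sh : Rh -> Prop).
Variables (f : {rmorphism Rh -> R}) (U : R -> Rh) (E : finType).
Hypothesis HL : lifting S Sh f U.
Implicit Types (X Y D : {set E}) (M N : E -> E -> Rh).

Let HS := lif_S HL.
Let HSh := lif_Sh HL.
Notation global := (global Sh f U).

(* Pivoting on an edge of an induced cycle shortens it by two and preserves its
   signature, so everything reduces to four-cycles, i.e. cross ratios. *)
Lemma global_csig X Y M c : global X Y M -> induced (radj X Y M) c ->
  good Sh f U (csig X M c).
Proof.
have [n] := ubnP (size c); elim: n X Y M c => // n ih X Y M c; rewrite ltnS.
move=> hn hg hc; have d := hereditary_disj hg.
wlog [u [c' ec]] : c hn hc / exists u c', u \in X /\ c = u :: c'.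
  move=> wl; case: c hn hc => [|u c'] hn hc; first by case: hc.
  have [uX|uX] := boolP (u \in X); first by apply: wl => //; exists u, c'.
  have uc : uniq (u :: c') by case: hc => _ /andP [].
  rewrite -(csig_rot _ _ 1 uc); apply: wl; first by rewrite size_rot.
    exact: induced_rot.
  case: c' hc {hn uc} => [|v c'] [//] _ /andP [/= /andP [h _] _] _.
  rewrite rot1_cons; exists v, (rcons c' u); split=> //.
  by move: h; rewrite /radj (negPf uX) /= => /and3P [].
case: ec => uX ec; subst c.
case: (hc) => sc /andP [cyc unq] ind.
case: c' hn hc sc cyc unq ind => [|y [|x c']] // hn hc _ cyc unq ind.
have hS : entin Sh X Y M := (hereditary_now hg).1.
move: (cyc) => /= /and3P [auy ayx cyc2].
move: auy; rewrite radjE // => /andP [yY nuy].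
move: ayx; rewrite radj_sym /radj (disjointFl d yY) /= orbF yY /= => /andP [xX nxy].
case: c' hn hc cyc unq ind cyc2 => [|v c'] hn hc cyc unq ind cyc2.
  by move: cyc2 => /= /andP []; rewrite radjE // (disjointFr d uX).
have /andP [axv cyc3] : radj X Y M x v && path (radj X Y M) v (rcons c' u) := cyc2.
move: axv; rewrite radjE // => /andP [vY nxv].
have SU a b : a \in X -> b \in Y -> M a b != 0 -> M a b \is a GRing.unit.
  by move=> aX bY; apply: (psU HSh); apply: hS.
have [uuy [uxy uxv]] := conj (SU _ _ uX yY nuy) (conj (SU _ _ xX yY nxy) (SU _ _ xX vY nxv)).
case: c' hn hc cyc unq ind cyc2 cyc3 => [|w c'] hn hc cyc unq ind cyc2 cyc3.
  move: cyc3 => /=; rewrite andbT radj_sym radjE // => /andP [_ nuv].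
  have uuv := SU _ _ uX vY nuv.
  rewrite csig_cycprod //= mul1r /esig uX xX (disjointFl d yY) (disjointFl d vY) mulr1.
  rewrite (_ : _ * _ = cr M u x y v).
    by apply: (hereditary_now hg).2.
  by rewrite /cr invrM //; ring.
set c := [:: u, y, x, v, w & c'] in hn hc cyc unq ind *.
(* The cycle is u, y, x, v, w, ...; after pivoting over (x, y) its two inner vertices drop out and
   u, v become adjacent. *)
pose c2 := [:: u, v, w & c'].
set N := piv M x y; set X' := y |: X :\ x; set Y' := x |: Y :\ y.
have [unq2 [xc2 yc2]] : uniq c2 /\ x \notin c2 /\ y \notin c2.
  move: unq; rewrite /c /c2 /= !inE !negb_or.
  case/and4P=> /and5P [uy ux -> -> ->] /and4P [yx -> -> ->] /and3P [-> -> ->] ->.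
  by rewrite ![_ == u]eq_sym ux uy.
have c2c e : e \in c2 -> e \in c.
  by rewrite /c /c2 !inE; case/or3P=> [->|->|/orP [->|->]]; rewrite ?orbT.
have nx e : e \in c2 -> e != x by move=> h; apply: contraNneq xc2 => <-.
have ny e : e \in c2 -> e != y by move=> h; apply: contraNneq yc2 => <-.
have nE e : e \in c2 -> next c e = if e == u then y else next c2 e.
  move=> ec2; rewrite /c /c2 /=; case: eqP => // _.
  by rewrite (negPf (ny e ec2)) (negPf (nx e ec2)).
have nEu : next c2 u = v by rewrite /c2 /= eqxx.
have mX' e : e \in c2 -> (e \in X') = (e \in X).
  by move=> ec2; rewrite !inE (negPf (ny e ec2)) (nx e ec2).
have mY' e : e \in c2 -> (e \in Y') = (e \in Y).
  by move=> ec2; rewrite !inE (negPf (nx e ec2)) (ny e ec2).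
have uc2 : u \in c2 by rewrite inE eqxx.
have vc2 : v \in c2 by rewrite !inE eqxx orbT.
have uc := c2c u uc2; have vc := c2c v vc2.
have xc : x \in c by rewrite /c !inE eqxx !orbT.
have yc : y \in c by rewrite /c !inE eqxx !orbT.
have uv : u != v by move: unq2; rewrite /= inE negb_or => /andP [/andP [->]].
have uw : u != w by move: unq2; rewrite /= !inE !negb_or => /andP [/and3P [_ ->]].
have vw : v != w by move: unq2; rewrite /= !inE !negb_or => /and3P [_ /andP [->]].
have nEv : next c2 v = w by rewrite /c2 /= [v == u]eq_sym (negPf uv) eqxx.
have xy := disj_neq d xX yY.
have xu : x == u = false by rewrite eq_sym (negPf (nx u uc2)).
have yu : y == u = false by rewrite eq_sym (negPf (ny u uc2)).
have Ncx : next c x = v by rewrite /c /= xu (negPf xy) eqxx.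
have Ncy : next c y = x by rewrite /c /= yu eqxx.
(* The cycle being induced, column y meets the remaining rows only in u, and row x the remaining
   columns only in v. So (u, v) is the only entry on the short cycle that the pivot changes. *)
have col_y a : a \in c2 -> a \in X -> a != u -> M a y = 0.
  move=> ac aX au; apply/eqP; apply: contraNT au => na.
  have := ind a y (c2c a ac) yc; rewrite radjE // yY na Ncy nE //.
  have [//|_] := eqVneq a u; move=> /esym /orP [/eqP e|/eqP e].
    have : next c2 a \in c2 by rewrite mem_next.
    by rewrite -e (negPf yc2).
  by move: (nx a ac); rewrite e eqxx.
have row_x b : b \in c2 -> b \in Y -> b != v -> M x b = 0.
  move=> bc bY bv; apply/eqP; apply: contraNT bv => nb.
  have := ind x b xc (c2c b bc); rewrite radjE // bY nb Ncx nE //.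
  case/esym/orP=> [//|/eqP]; have [_ e|_ e] := eqVneq b u.
    by move: xy; rewrite e eqxx.
  have : next c2 b \in c2 by rewrite mem_next.
  by rewrite -e (negPf xc2).
have Muv : M u v = 0.
  apply/eqP; apply: contraT => nb.
  have := ind u v uc vc; rewrite radjE // vY nb !nE // eqxx [v == u]eq_sym (negPf uv) nEv.
  by rewrite (negPf uw) (negPf (ny v vc2)).
have NE a b : a \in c2 -> b \in c2 -> a \in X -> b \in Y -> (a, b) != (u, v) -> N a b = M a b.
  move=> ac bc aX bY ab; rewrite /N piv_uv ?ny ?nx //.
  have [au|au] := eqVneq a u; last by rewrite (col_y a) // mulr0 mul0r subr0.
  by rewrite (row_x b) ?mulr0 ?subr0 //; apply: contraNneq ab => ->; rewrite au.
have Nuv : N u v = - ((M x y)^-1 * M u y * M x v).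
  by rewrite /N piv_uv ?ny ?nx // Muv sub0r.
have nNuv : N u v != 0.
  have : N u v \is a GRing.unit by rewrite Nuv unitrN !unitrM unitrV uxy uuy uxv.
  by apply: contraTneq => ->; rewrite unitr0.
have hg' : global X' Y' N by apply: hereditary_piv.
have d' := hereditary_disj hg'.
have ind2 a b : a \in c2 -> b \in c2 ->
    radj X' Y' N a b = (b == next c2 a) || (a == next c2 b).
  have half : forall a b, a \in c2 -> b \in c2 -> a \in X ->
      radj X' Y' N a b = (b == next c2 a) || (a == next c2 b).
    move=> {}a {}b ac bc aX; rewrite radjE ?mX' // mY' //.
    have hab := ind a b (c2c a ac) (c2c b bc); rewrite radjE // !nE // in hab.
    have [bu|bu] := eqVneq b u.
      rewrite bu (disjointFr d uX) !andFb in hab *.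
      rewrite eqxx (negPf (ny a ac)) orbF in hab; rewrite nEu.
      have [au|au] := eqVneq a u; first by rewrite au nEu (negPf uv).
      rewrite (negPf au) in hab; rewrite -hab orFb; apply/esym/eqP => av.
      by move: aX; rewrite av (disjointFl d vY).
    rewrite (negPf bu) in hab.
    have [au|au] := eqVneq a u.
      rewrite au eqxx (negPf (ny b bc)) orFb in hab; rewrite au nEu.
      have [bv|bv] := eqVneq b v; first by rewrite bv vY nNuv.
      rewrite -hab; case: (boolP (b \in Y)) => //= bY.
      by rewrite NE // xpair_eqE eqxx.
    rewrite (negPf au) in hab; rewrite -hab.
    case: (boolP (b \in Y)) => //= bY.
    by rewrite NE // xpair_eqE (negPf au).
  move=> ac bc; have [aX|aX] := boolP (a \in X); first exact: half.
  have [bX|bX] := boolP (b \in X).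
    by rewrite radj_sym half // orbC.
  rewrite {1}/radj !mX' // (negPf aX) (negPf bX).
  have hab := ind a b (c2c a ac) (c2c b bc).
  rewrite /radj (negPf aX) (negPf bX) !nE // in hab.
  move: hab; have -> : (a == u) = false by apply: contraNF aX => /eqP ->.
  have -> : (b == u) = false by apply: contraNF bX => /eqP ->.
  exact.
have hc2 : induced (radj X' Y' N) c2.
  split=> //; rewrite /ucycle unq2 andbT; apply: cycle_from_next => // e ec.
  by rewrite ind2 ?mem_next // eqxx.
have szc2 : (size c2 < n)%N by apply: leq_trans hn; rewrite /c2 /c /=.
suff -> : csig X M c = csig X' N c2 by apply: ih hg' hc2.
(* Losing two vertices flips the sign in the signature; the minus sign of the new entry at (u, v)
   makes up for it. *)
have odd_c : odd (size c)./2 = ~~ odd (size c2)./2 by [].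
have big_c (F : E -> Rh) : \prod_(j <- c) F j =
    F u * (F y * (F x * (F v * (F w * \prod_(j <- c') F j)))) by rewrite /c !big_cons.
have big_c2 (F : E -> Rh) : \prod_(j <- c2) F j =
    F u * (F v * (F w * \prod_(j <- c') F j)) by rewrite /c2 !big_cons.
rewrite /csig odd_c big_c big_c2.
have step e : e \in c2 -> e != u -> esig X' N e (next c2 e) = esig X M e (next c e).
  move=> ec eu; rewrite nE // (negPf eu) /esig mX' //.
  have nc : next c2 e \in c2 by rewrite mem_next.
  have adj : radj X' Y' N e (next c2 e) by rewrite ind2 // eqxx.
  case: ifP => eX.
    move: adj; rewrite radjE ?mX' // mY' // => /andP [nY _].
    by rewrite NE // xpair_eqE (negPf eu).
  move: adj; rewrite /radj !mX' // eX andFb orFb mY' // => /and3P [nX eY _].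
  rewrite NE //; apply: contraTneq (uw) => eqp.
  have e1 : next c2 e = u := congr1 fst eqp; have e2 : e = v := congr1 snd eqp.
  by have e3 := nEv; rewrite -e2 e1 in e3; rewrite e3 eqxx.
have uc' e : e \in c' -> e \in c2 /\ e != u.
  move=> ec; split; first by rewrite /c2 !inE ec !orbT.
  apply: contraTneq ec => ->; move: unq2; rewrite /= !inE !negb_or.
  by case/andP => /and3P [].
have -> : \prod_(j <- c') esig X' N j (next c2 j) = \prod_(j <- c') esig X M j (next c j).
  rewrite big_seq [RHS]big_seq; apply: eq_bigr => e /uc' [h1 h2]; exact: step.
have wc2 : w \in c2 by rewrite /c2 !inE eqxx !orbT.
have vu : v != u by rewrite eq_sym.
have wu : w != u by rewrite eq_sym.
rewrite (step v vc2 vu) (step w wc2 wu).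
rewrite nEu Ncy Ncx nE // eqxx /esig mX' // uX xX (disjointFl d yY) Nuv.
set p := \prod_(j <- c') _; set q := if v \in X then _ else _.
set r := if w \in X then _ else _.
by case: odd => /=; ring.
Qed.

Lemma f_csig X Y M c : [disjoint X & Y] -> entin Sh X Y M ->
  path.cycle (radj X Y M) c -> uniq c -> f (csig X M c) = csig X (map_entries f M) c.
Proof.
move=> d hS hc uc; rewrite /csig rmorphM rmorph_prod; congr (_ * _).
  by case: odd; rewrite ?rmorphN rmorph1.
rewrite big_seq [RHS]big_seq; apply: eq_bigr => v vc.
have := next_cycle hc vc; rewrite /esig /map_entries; case: ifP => // vX.
rewrite /radj vX /= => /and3P [nX vY n]; rewrite rmorphV //.
by apply: (psU HSh) => //; apply: hS.
Qed.

End Signature.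

Section SigScaling.

Variables (R : comUnitRingType) (S : R -> Prop) (E : finType).
Hypothesis HS : pfset S.
Implicit Types (X Y D : {set E}) (M N : E -> E -> R).

(** Scaling changes the weight of an edge by a quotient of vertex factors, which telescopes around a
    cycle. *)
Lemma csig_seqv X Y M N c : [disjoint X & Y] -> entin S X Y M ->
  seqv S X Y M N ->
  path.cycle (radj X Y M) c -> uniq c -> csig X N c = csig X M c.
Proof.
move=> d hS [r [k [hr hk h]]] hc uc; rewrite !csig_cycprod //; congr (_ * _).
pose g e := if e \in X then (r e)^-1 else k e.
have gU e : g e \is a GRing.unit.
  by rewrite /g; case: ifP => _; [rewrite unitrV; case: (hr e)|case: (hk e)].
apply: (cycprod_potential gU _ hc) => x y.
have [_ ry] := hr y; have [_ rx] := hr x; have [_ kx] := hk x; have [_ ky] := hk y.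
rewrite /radj => /orP [/and3P [xX yY n]|/and3P [yX xY n]].
  by rewrite /esig /g xX (disjointFl d yY) h // invrK.
rewrite /esig /g yX (disjointFl d xY) h //.
have u : M y x \is a GRing.unit by apply: (psU HS) => //; apply: hS.
by rewrite !invrM ?unitrM ?ry ?u ?kx // mulrA.
Qed.

(** The quotient of the two edge signatures is trivial on induced cycles, hence on all closed walks,
    hence comes from a potential; the values of the potential are the scaling factors. *)
Lemma seqv_of_csig X Y M N : [disjoint X & Y] -> entin S X Y M -> entin S X Y N ->
  (forall u v, u \in X -> v \in Y -> (M u v == 0) = (N u v == 0)) ->
  (forall c, induced (radj X Y M) c -> csig X M c = csig X N c) ->
  seqv S X Y M N.
Proof.
move=> d hM hN h0 hc.
pose w u v := esig X N u v * (esig X M u v)^-1.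
have adjU u v : radj X Y M u v -> su S (esig X M u v) /\ su S (esig X N u v).
  rewrite /radj /esig => /orP [/and3P [uX vY n]|/and3P [vX uY n]].
    rewrite uX; split; split; try (by apply: hM); try (by apply: hN).
      by apply: (psU HS) => //; apply: hM.
    by apply: (psU HS); [apply: hN|rewrite -h0].
  rewrite (disjointFl d uY); split; apply: (suV HS); split;
    try (by apply: hM); try (by apply: hN).
    by apply: (psU HS) => //; apply: hM.
  by apply: (psU HS); [apply: hN|rewrite -h0].
have wV u v : radj X Y M u v -> w u v * w v u = 1.
  move=> a; have [[_ a1] [_ a2]] := adjU _ _ a; move: a a1 a2.
  rewrite /w /esig /radj => /orP [/and3P [uX vY n]|/and3P [vX uY n]].
    rewrite uX (disjointFl d vY) => a1 a2; rewrite invrK.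
    by ring: (mulrV a1) (mulrV a2).
  rewrite vX (disjointFl d uY) !unitrV => a1 a2; rewrite invrK.
  by ring: (mulrV a1) (mulrV a2).
have cpM c : path.cycle (radj X Y M) c -> uniq c ->
    cycprod w c = cycprod (esig X N) c * (cycprod (esig X M) c)^-1.
  move=> hcy uc; rewrite !cycprod_next //.
  have pU (s : seq E) : {subset s <= c} ->
    \prod_(v <- s) esig X M v (next c v) \is a GRing.unit.
    elim: s => [|e s ihs] hs; first by rewrite big_nil unitr1.
    rewrite big_cons unitrM ihs ?andbT => [|e' e's].
      have /adjU [[_ ->] _] // := next_cycle hcy (hs e (mem_head _ _)).
    by apply: hs; rewrite inE e's orbT.
  suff key (s : seq E) : {subset s <= c} -> \prod_(v <- s) w v (next c v) =
      \prod_(v <- s) esig X N v (next c v) * (\prod_(v <- s) esig X M v (next c v))^-1.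
    exact: key.
  elim: s => [|e s ihs] hs; first by rewrite !big_nil mul1r invr1.
  have hs' : {subset s <= c} by move=> e' e's; apply: hs; rewrite inE e's orbT.
  rewrite !big_cons ihs // invrM ?pU //; last first.
    by have /adjU [[_ ->] _] := next_cycle hcy (hs e (mem_head _ _)).
  by rewrite /w; ring.
have hind c : induced (radj X Y M) c -> cycprod w c = 1.
  move=> hi; have [_ /andP [hcy uc] _] := hi; rewrite cpM //.
  have := hc c hi; rewrite !csig_cycprod //.
  set s := if _ then _ else _ => e.
  have e' : cycprod (esig X M) c = cycprod (esig X N) c.
    have ss : s * s = 1 by rewrite /s; case: ifP => _; ring.
    by rewrite -[LHS]mul1r -[RHS]mul1r -ss -!mulrA e.
  rewrite -e' mulrV //; case: (c) hcy {hi uc e' e s} => [|x p] /=; first by rewrite unitr1.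
  move: (rcons p x) => q; elim: q x => [|y q ihq] x0 /=; first by rewrite unitr1.
  by case/andP=> /adjU [[_ a] _] /ihq; rewrite unitrM a.
have [|||g [gS hg]] := @potential R E (radj X Y M) w (radj_sym X Y M)
  (radj_irr M d) wV hind (su S) (su1 HS).
- by move=> a b; apply: suM.
- by move=> u v /adjU [h1 h2]; apply: (suM HS) => //; apply: (suV HS).
- by move=> a [].
exists (fun u => (g u)^-1), g; split=> //; first by move=> u; apply: (suV HS).
move=> u v uX vY; have [e|n] := eqVneq (M u v) 0.
  by move: (h0 u v uX vY); rewrite e eqxx => /esym/eqP ->; rewrite mulr0 mul0r.
have a : radj X Y M u v by rewrite radjE // vY.
have := hg _ _ a; rewrite /w /esig uX => e.
have [[_ mu] _] := adjU _ _ a; rewrite /esig uX in mu.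
have <- : N u v * (M u v)^-1 * M u v = N u v by ring: (mulrV mu).
by rewrite e; ring.
Qed.

End SigScaling.

Section Uniqueness.

Variables (R Rh : comUnitRingType) (S : R -> Prop) (Sh : Rh -> Prop).
Variables (f : {rmorphism Rh -> R}) (U : R -> Rh) (E : finType).
Hypothesis HL : lifting S Sh f U.
Implicit Types (X Y D : {set E}) (M N : E -> E -> Rh).

Let HS := lif_S HL.
Let HSh := lif_Sh HL.
Notation global := (global Sh f U).

Lemma radj_zeros (R1 R2 : comUnitRingType) X Y (M : E -> E -> R1) (N : E -> E -> R2) :
  (forall u v, u \in X -> v \in Y -> (M u v == 0) = (N u v == 0)) ->
  radj X Y M = radj X Y N.
Proof.
move=> h; apply/funext => u; apply/funext => v; rewrite /radj; congr (_ || _).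
  by case: (boolP (u \in X)) => //= uX; case: (boolP (v \in Y)) => //= vY; rewrite h.
by case: (boolP (v \in X)) => //= uX; case: (boolP (u \in Y)) => //= vY; rewrite h.
Qed.

(** The signatures of a global lift are lifts of the signatures of its image, and those are
    invariant under scaling, so both matrices have the same signatures. *)
Lemma global_uniq X Y M N : global X Y M -> global X Y N ->
  seqv S X Y (map_entries f M) (map_entries f N) -> seqv Sh X Y M N.
Proof.
move=> hM hN h; have d := hereditary_disj hM.
have SM := (hereditary_now hM).1; have SN := (hereditary_now hN).1.
have fS K : entin Sh X Y K -> entin S X Y (map_entries f K).
  by move=> hK u v uX vY; apply: (lif_f HL); apply: hK.
have zM u v : u \in X -> v \in Y -> (map_entries f M u v == 0) = (M u v == 0).
  by move=> uX vY; rewrite /map_entries (lif_eq0 HL) //; apply: SM.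
have zN u v : u \in X -> v \in Y -> (map_entries f N u v == 0) = (N u v == 0).
  by move=> uX vY; rewrite /map_entries (lif_eq0 HL) //; apply: SN.
have z0 u v : u \in X -> v \in Y -> (M u v == 0) = (N u v == 0).
  by move=> uX vY; rewrite -zM // -zN // (seqv_eq0 h).
apply: (seqv_of_csig HSh d) => // c hc.
have hc' : induced (radj X Y N) c by rewrite -(radj_zeros z0).
have [_ /andP [cy uc] _] := hc; have [_ /andP [cy' _] _] := hc'.
have [_ _ <-] := global_csig HL hM hc; have [_ _ <-] := global_csig HL hN hc'.
rewrite !(f_csig HL d) // (csig_seqv HS d _ h) //; first exact: fS.
by rewrite (radj_zeros zM).
Qed.

End Uniqueness.

(** * Existence of lifts *)

Section Leaves.

Variables (E : finType) (e : rel E) (D : {set E}) (w : E).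
Hypothesis eD : forall u v, e u v -> u \in D /\ v \in D.
Hypothesis econn : forall K : {set E}, w \in K ->
  (forall u v, e u v -> u \in K -> v \in K) -> D \subset K.
Hypothesis wD : w \in D.

Fixpoint lev n : {set E} :=
  if n is m.+1 then lev m :|: [set v | [exists u in lev m, e u v]] else [set w].

(* The deepest vertices of three branches of a breadth-first tree rooted at a
   vertex of degree at least three are leaves. *)
Lemma three_leaves (nb : 'I_3 -> E) : injective nb -> (forall i, nb i != w) ->
  (forall i, e w (nb i)) ->
  exists (l : 'I_3 -> E) (par : E -> E) (d : E -> nat),
  [/\ injective l, forall i, l i \in D, forall i, l i != w &
   forall v, v \in D -> v != w ->
     [/\ e (par v) v, (d (par v) < d v)%N & forall i, par v != l i]].
Proof.
move=> injn nw hn.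
have lev_mono m n : (m <= n)%N -> lev m \subset lev n.
  elim: n => [|n ih]; first by rewrite leqn0 => /eqP ->.
  rewrite leq_eqVlt => /orP [/eqP -> //|/ih h].
  by apply: subset_trans h _; apply: subsetUl.
have cov v : v \in D -> exists n, v \in lev n.
  have /subsetP h : D \subset [set v | `[< exists n, v \in lev n >]].
    apply: econn; first by rewrite inE; apply/asboolP; exists 0%N; rewrite inE.
    move=> a b eab; rewrite !inE => /asboolP [n hn']; apply/asboolP; exists n.+1.
    by rewrite /= !inE; apply/orP; right; apply/existsP; exists a; rewrite hn'.
  by move=> /h; rewrite inE => /asboolP.
have [v|d hd] := @choice E nat (fun v n => v \in D ->
    v \in lev n /\ forall m, v \in lev m -> (n <= m)%N).
  have [vD|vD] := boolP (v \in D); last by exists 0%N.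
  by have [n h1 h2] := ex_minnP (cov v vD); exists n.
have dw : d w = 0%N.
  by apply/eqP; rewrite -leqn0; apply: (hd w wD).2; rewrite inE.
have d0 v : v \in D -> d v = 0%N -> v = w.
  by move=> vD dv; have [] := hd v vD; rewrite dv inE => /eqP.
have [v|par hpar] := @choice E E (fun v u => v \in D -> v != w ->
    e u v /\ d v = (d u).+1).
  have [vD|vD] := boolP (v \in D); last by exists v.
  have [->|vw] := eqVneq v w; first by exists w.
  have [h1 h2] := hd v vD; case dv : (d v) => [|n].
    by move: vw; rewrite (d0 v vD dv) eqxx.
  move: h1; rewrite dv /= !inE => /orP [h|/existsP [u /andP [hu euv]]].
    by have := h2 _ h; rewrite dv ltnn.
  exists u => _ _; split=> //; congr _.+1.
  have uD := (eD euv).1; have [h3 h4] := hd u uD.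
  apply/eqP; rewrite eqn_leq h4 // andbT -ltnS -dv; apply: h2.
  by rewrite /= !inE; apply/orP; right; apply/existsP; exists u; rewrite h3.
have parD v : v \in D -> v != w -> par v \in D.
  by move=> vD vw; have [/eD []] := hpar v vD vw.
(* The ancestor of v at distance one from the root, that is, the branch containing v; the
   predecessor on the depth stops the climb just before w. *)
pose br v := iter (d v).-1 par v.
have dn i : d (nb i) = 1%N.
  have nD := (eD (hn i)).2; apply/eqP; rewrite eqn_leq; apply/andP; split.
    apply: (hd _ nD).2; rewrite /= !inE; apply/orP; right.
    by apply/existsP; exists w; rewrite inE eqxx hn.
  by rewrite lt0n; apply: contraNneq (nw i) => h; rewrite (d0 _ nD h).
have brn i : br (nb i) = nb i by rewrite /br dn.
have brp v : v \in D -> v != w -> par v != w -> br v = br (par v).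
  move=> vD vw pw; have [_ dv] := hpar v vD vw.
  rewrite /br dv /=; case dp : (d (par v)) => [|m]; last by rewrite -iterSr.
  by move: pw; rewrite (d0 _ (parD v vD vw) dp) eqxx.
pose P i v := [&& v \in D, v != w & br v == nb i].
have Pn i : P i (nb i) by rewrite /P (eD (hn i)).2 nw brn eqxx.
pose l i := [arg max_(v > nb i | P i v) d v].
have lP i : P i (l i) /\ forall v, P i v -> (d v <= d (l i))%N.
  by rewrite /l; case: arg_maxnP => [|v h1 h2]; first exact: Pn.
exists l, par, d; split.
- move=> i j eij; apply: injn.
  have [/and3P [_ _ /eqP <-] _] := lP i; have [/and3P [_ _ /eqP <-] _] := lP j.
  by rewrite eij.
- by move=> i; have [/and3P []] := lP i.
- by move=> i; have [/and3P []] := lP i.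
move=> v vD vw; have [h1 h2] := hpar v vD vw; split=> //; first by rewrite h2.
move=> i; apply/eqP => ev; have [/and3P [lD lw /eqP bl] mx] := lP i.
have : P i v by rewrite /P vD vw (brp v) // ev // bl eqxx.
by move=> /mx; rewrite h2 ev ltnn.
Qed.

End Leaves.

Section Degree.

Variables (R : comUnitRingType) (S : R -> Prop) (E : finType).
Hypothesis HS : pfset S.
Implicit Types (X Y K : {set E}) (A : E -> E -> R) (a b c u v w x y z : E).

Definition deg3 X Y A := exists w n1 n2 n3, [/\ radj X Y A w n1, radj X Y A w n2,
  radj X Y A w n3 & [/\ n1 != n2, n1 != n3 & n2 != n3]].

Lemma connected_closed X Y A K w : connected X Y A -> w \in X :|: Y -> w \in K ->
  (forall u v, u \in X -> v \in Y -> A u v != 0 -> (u \in K) = (v \in K)) ->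
  X :|: Y \subset K.
Proof.
move=> hc wD wK h; apply/subsetP => u uD.
by rewrite -(hc (fun z => z \in K) h w u wD uD).
Qed.

Lemma connected_rows X Y A (Ka Kv : pred E) w : connected X Y A -> [disjoint X & Y] ->
  w \in X :|: Y -> (if w \in X then Ka w else Kv w) ->
  (forall u v, u \in X -> v \in Y -> A u v != 0 -> (Ka u -> Kv v) /\ (Kv v -> Ka u)) ->
  (forall u, u \in X -> Ka u) /\ (forall v, v \in Y -> Kv v).
Proof.
move=> hc d wD wK h; pose k u := if u \in X then Ka u else Kv u.
have hk : edge_constant X Y A k.
  move=> u v uX vY n; rewrite /k uX (disjointFl d vY).
  by have [h1 h2] := h u v uX vY n; apply/idP/idP.
split=> [u uX|v vY].
  have : k u by rewrite (hc k hk u w) // inE uX.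
  by rewrite /k uX.
have : k v by rewrite (hc k hk v w) // inE vY orbT.
by rewrite /k (disjointFl d vY).
Qed.

(** No vertex has one of the three leaves as its parent, so climbing from any other vertex to the
    root avoids them. Two of the three lie in the same class, and deleting these keeps the rest
    connected. *)
Lemma deg3_leaves X Y A : [disjoint X & Y] -> connected X Y A -> deg3 X Y A ->
  exists l1 l2, [/\ l1 != l2, (l1 \in X) && (l2 \in X) || (l1 \in Y) && (l2 \in Y) &
    connected (X :\: [set l1; l2]) (Y :\: [set l1; l2]) A].
Proof.
move=> d hc [w [n1 [n2 [n3 [a1 a2 a3 [n12 n13 n23]]]]]].
set e := radj X Y A.
have eD u v : e u v -> u \in X :|: Y /\ v \in X :|: Y.
  by rewrite /e /radj !inE => /orP [] /and3P [-> -> _]; rewrite ?orbT.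
have wD := (eD _ _ a1).1.
have econn K : w \in K -> (forall u v, e u v -> u \in K -> v \in K) ->
    X :|: Y \subset K.
  move=> wK h; apply: (connected_closed hc wD wK) => u v uX vY n.
  have euv : e u v by rewrite /e radjE // vY.
  by apply/idP/idP; apply: h; rewrite // /e radj_sym.
pose nb (i : 'I_3) := nth w [:: n1; n2; n3] i.
have hnb i : e w (nb i) by case: i => [[|[|[|]]]].
have injn : injective nb.
  move=> i j /eqP; rewrite /nb nth_uniq //= ?inE ?negb_or ?n12 ?n13 ?n23 //.
  by move/eqP/val_inj.
have nw i : nb i != w.
  by apply: contraTneq (hnb i) => ->; rewrite /e radj_irr.
have [l [par [dd [injl lD lw hl]]]] := three_leaves eD econn wD injn nw hnb.
have key i j : i != j -> (l i \in X) && (l j \in X) || (l i \in Y) && (l j \in Y) ->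
    exists l1 l2, [/\ l1 != l2, (l1 \in X) && (l2 \in X) || (l1 \in Y) && (l2 \in Y) &
    connected (X :\: [set l1; l2]) (Y :\: [set l1; l2]) A].
  move=> ij hij; exists (l i), (l j); split=> //; first by rewrite (inj_eq injl).
  move=> k hk; suff main v : v \in X :|: Y -> v \notin [set l i; l j] -> k v = k w.
    move=> v v'; rewrite -setDUl !inE => /andP [h1 h2] /andP [h3 h4].
    by rewrite (main v) ?(main v') // !inE.
  have [n] := ubnP (dd v); elim: n v => // n ih v; rewrite ltnS => hn vD vl.
  have [->//|vw] := eqVneq v w.
  have [epv dp pl] := hl v vD vw.
  have ppl : par v \notin [set l i; l j] by rewrite !inE negb_or !pl.
  rewrite -(ih (par v)) ?(eD _ _ epv).1 //; last exact: leq_trans dp hn.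
  move: epv; rewrite /e /radj => /orP [] /and3P [h1 h2 h3].
    by apply/esym/hk; rewrite // in_setD ?ppl ?vl.
  by apply: hk; rewrite // in_setD ?ppl ?vl.
have cls i : (l i \in X) || (l i \in Y) by rewrite -in_setU.
pose o k : 'I_3 := inord k.
have [o01 [o02 o12]] : o 0%N != o 1%N /\ o 0%N != o 2%N /\ o 1%N != o 2%N.
  by rewrite -!val_eqE /= !inordK.
have [X0|X0] := boolP (l (o 0%N) \in X); have := cls (o 0%N);
have [X1|X1] := boolP (l (o 1%N) \in X); have := cls (o 1%N);
have [X2|X2] := boolP (l (o 2%N) \in X); have := cls (o 2%N);
  rewrite ?X0 ?X1 ?X2 ?(negPf X0) ?(negPf X1) ?(negPf X2) /= => Y2 Y1 Y0;
  first [by apply: (key _ _ o01); rewrite ?X0 ?X1 ?Y0 ?Y1 ?orbT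
        |by apply: (key _ _ o02); rewrite ?X0 ?X2 ?Y0 ?Y2 ?orbT
        |by apply: (key _ _ o12); rewrite ?X1 ?X2 ?Y1 ?Y2 ?orbT].
Qed.

(* A connected graph of maximum degree two is a path or a cycle; a pivot on a
   suitable edge creates a vertex of degree three. *)
Lemma deg3_piv X Y A : [disjoint X & Y] -> entin S X Y A -> connected X Y A ->
  (2 < #|X|)%N -> (1 < #|Y|)%N -> deg3 X Y A \/
  exists x y, [/\ x \in X, y \in Y, A x y \is a GRing.unit &
    deg3 (y |: X :\ x) (x |: Y :\ y) (piv A x y)].
Proof.
move=> d hS hc cX cY; have [|nd] := pselect (deg3 X Y A); [by left|right].
have SU a v : a \in X -> v \in Y -> A a v != 0 -> A a v \is a GRing.unit.
  by move=> aX vY; apply: (psU HS); apply: hS.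
have nu (r : R) : r \is a GRing.unit -> r != 0.
  by apply: contraTneq => ->; rewrite unitr0.
have row3 b v1 v2 v3 : b \in X -> v1 \in Y -> v2 \in Y -> v3 \in Y ->
    A b v1 != 0 -> A b v2 != 0 -> A b v3 != 0 -> v1 != v2 ->
    v3 = v1 \/ v3 = v2.
  move=> bX h1 h2 h3 n1 n2 n3 n12; have [|v31] := eqVneq v3 v1; [by left|right].
  have [//|v32] := eqVneq v3 v2; case: nd; exists b, v1, v2, v3.
  by split; rewrite ?radjE ?h1 ?h2 ?h3 //; split=> //; rewrite eq_sym.
have col3 v a1 a2 a3 : v \in Y -> a1 \in X -> a2 \in X -> a3 \in X ->
    A a1 v != 0 -> A a2 v != 0 -> A a3 v != 0 -> a1 != a2 ->
    a3 = a1 \/ a3 = a2.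
  move=> vY h1 h2 h3 n1 n2 n3 n12; have [|a31] := eqVneq a3 a1; [by left|right].
  have [//|a32] := eqVneq a3 a2; case: nd; exists v, a1, a2, a3.
  by split; rewrite ?[radj _ _ _ v _]radj_sym ?radjE ?vY //; split=> //; rewrite eq_sym.
have small a b : ~ (forall u, u \in X -> (u == a) || (u == b)).
  move=> h; have : X \subset [set a; b] by apply/subsetP => u /h; rewrite !inE.
  move/subset_leq_card; rewrite cards2 => h'; have := leq_trans cX h'.
  by case: (a != b).
have XY u v : u \in X -> v \in Y -> u = v -> False.
  by move=> uX vY e; have := disj_neq d uX vY; rewrite e eqxx.
(* If every row had at most one neighbour, a column together with its neighbours would be a whole
   component, against the presence of two columns. *)
have [b [x [y [bX xY yY [xy nbx nby]]]]] : exists b x y,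
    [/\ b \in X, x \in Y, y \in Y & [/\ x != y, A b x != 0 & A b y != 0]].
  apply: contrapT => no; have /card_gt1P [v1 [v2 [v1Y v2Y v12]]] := cY.
  have [|||_ /(_ v2 v2Y)] := @connected_rows X Y A (fun u => A u v1 != 0) (pred1 v1) v1 hc d.
  - by rewrite inE v1Y orbT.
  - by rewrite (disjointFl d v1Y) /= eqxx.
  - move=> u v uX vY n /=; split=> [n1|/eqP <- //].
    apply: contraT => vv1; case: no; exists u, v, v1; split=> //.
  by rewrite /= eq_sym (negPf v12).
have rowb v : v \in Y -> A b v != 0 -> v = x \/ v = y.
  by move=> vY n; apply: (row3 b).
(* The case where x' is an end of the path x', b, y', c, z: the pivot over (b, y') makes row c
   adjacent to x', b and z. If no such z exists, b and c are the only rows. *)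
have one_side x' y' : x' \in Y -> y' \in Y -> x' != y' -> A b x' != 0 ->
    A b y' != 0 -> (forall v, v \in Y -> A b v != 0 -> v = x' \/ v = y') ->
    (forall a, a \in X -> A a x' != 0 -> a = b) ->
    (exists c, [/\ c \in X, c != b & A c y' != 0]) ->
    exists x y, [/\ x \in X, y \in Y, A x y \is a GRing.unit &
      deg3 (y |: X :\ x) (x |: Y :\ y) (piv A x y)].
  move=> {}xY {}yY {}xy {}nbx {}nby {}rowb colx [c [cX' cb ncy]].
  have [[z [zY zy ncz]]|noz] := pselect (exists z, [/\ z \in Y, z != y' & A c z != 0]).
    have uby := SU _ _ bX yY nby.
    exists b, y'; split=> //.
    have cx0 : A c x' = 0.
      by apply/eqP; apply: contraNT cb => n; rewrite (colx c cX' n).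
    have zx : z != x' by apply: contraNneq ncz => ->; rewrite cx0.
    have bz0 : A b z = 0.
      apply/eqP; apply: contraT => n; have [e|e] := rowb z zY n.
        by rewrite e eqxx in zx.
      by rewrite e eqxx in zy.
    have cy := disj_neq d cX' yY; have bx := disj_neq d bX xY.
    have bz := disj_neq d bX zY.
    have xb : x' != b by rewrite eq_sym.
    have zb : z != b by rewrite eq_sym.
    have cX1 : c \in y' |: X :\ b by rewrite !inE cb cX' orbT.
    have d1 := disj_piv d bX yY.
    exists c, x', b, z; split.
    - rewrite radjE // !inE xy xY orbT /= piv_uv // cx0 sub0r.
      by apply: nu; rewrite unitrN !unitrM unitrV uby !SU.
    - rewrite radjE // !inE eqxx /= piv_ux //.
      by apply: nu; rewrite unitrN !unitrM unitrV uby !SU.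
    - by rewrite radjE // !inE zy zY orbT /= piv_uv // bz0 mulr0 subr0.
    by split; rewrite // eq_sym.
  exfalso; apply: (small b c).
  have [|||h _] := @connected_rows X Y A (pred2 b c) (pred2 x' y') b hc d; last exact: h.
  - by rewrite inE bX.
  - by rewrite bX /= eqxx.
  move=> u v uX vY n /=; split=> /orP [] /eqP e.
  - by rewrite e in n; case: (rowb v vY n) => ->; rewrite eqxx ?orbT.
  - apply/orP; right; apply: contraT => vy; case: noz; exists v; split=> //.
    by rewrite -e.
  - by rewrite e in n; rewrite (colx u uX n) eqxx.
  - rewrite e in n; rewrite eq_sym in cb.
    by case: (col3 y' b c u yY bX cX' uX nby ncy n cb) => ->; rewrite eqxx ?orbT.
have [[a [aX ab nax]]|noa] := pselect (exists a, [/\ a \in X, a != b & A a x != 0]);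
  last first.
  have colx a : a \in X -> A a x != 0 -> a = b.
    by move=> aX n; apply: contrapT => ab; case: noa; exists a; split=> //; apply/eqP.
  have [hcy|noc] := pselect (exists c, [/\ c \in X, c != b & A c y != 0]).
    exact: (one_side x y).
  exfalso; apply: (small b b).
  have [|||h _] := @connected_rows X Y A (pred2 b b) (pred2 x y) b hc d; last exact: h.
  - by rewrite inE bX.
  - by rewrite bX /= eqxx.
  move=> u v uX vY n /=; split=> /orP [] /eqP e.
  - by rewrite e in n; case: (rowb v vY n) => ->; rewrite eqxx ?orbT.
  - by rewrite e in n; case: (rowb v vY n) => ->; rewrite eqxx ?orbT.
  - by rewrite e in n; rewrite (colx u uX n) eqxx.
  - rewrite e in n; have [_|ub] := eqVneq u b => //.
    by case: noc; exists u.
have [[c [cX' cb ncy]]|noc] := pselect (exists c, [/\ c \in X, c != b & A c y != 0]);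
  last first.
  apply: (one_side y x) => //; first by rewrite eq_sym.
  - by move=> v vY n; have [->|->] := rowb v vY n; [right|left].
  - by move=> c cX' n; apply: contrapT => cb; case: noc; exists c; split=> //; apply/eqP.
  by exists a.
have [e|ac] := eqVneq a c.
  rewrite -{}e in cX' cb ncy; exfalso; apply: (small b a).
  have [|||h _] := @connected_rows X Y A (pred2 b a) (pred2 x y) b hc d; last exact: h.
  - by rewrite inE bX.
  - by rewrite bX /= eqxx.
  have ba : b != a by rewrite eq_sym.
  move=> u v uX vY n /=; split=> /orP [] /eqP e; rewrite e in n.
  - by case: (rowb v vY n) => ->; rewrite eqxx ?orbT.
  - by case: (row3 a x y v aX xY yY vY nax ncy n xy) => ->; rewrite eqxx ?orbT.
  - by case: (col3 x b a u xY bX aX uX nbx nax n ba) => ->; rewrite eqxx ?orbT.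
  - by case: (col3 y b a u yY bX aX uX nby ncy n ba) => ->; rewrite eqxx ?orbT.
have ubx := SU _ _ bX xY nbx.
have ay0 : A a y = 0.
  apply/eqP; apply: contraT => n; have bc : b != c by rewrite eq_sym.
  case: (col3 y b c a yY bX cX' aX nby ncy n bc) => e.
    by rewrite e eqxx in ab.
  by rewrite e eqxx in ac.
have cx0 : A c x = 0.
  apply/eqP; apply: contraT => n; have ba : b != a by rewrite eq_sym.
  case: (col3 x b a c xY bX aX cX' nbx nax n ba) => e.
    by rewrite e eqxx in cb.
  by rewrite e eqxx in ac.
have d1 := disj_piv d bX xY.
have by' := disj_neq d bX yY; have yb : y != b by rewrite eq_sym.
have ax := disj_neq d aX xY; have cx := disj_neq d cX' xY.
have yx : y != x by rewrite eq_sym.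
have yY1 : y \in b |: Y :\ x by rewrite !inE yx yY orbT.
(* On the path a, x, b, y, c the pivot over (b, x) makes column y adjacent to the new row x and to
   a, and keeps its edge to c. *)
exists b, x; split=> //; exists y, x, a, c.
split; rewrite ?[radj _ _ _ y _]radj_sym ?radjE ?yY1 //.
- by rewrite piv_yv //; apply: nu; rewrite unitrM unitrV ubx SU.
- by rewrite !inE eqxx.
- rewrite piv_uv // ay0 sub0r; apply: nu.
  by rewrite unitrN !unitrM unitrV ubx !SU.
- by rewrite !inE ab aX orbT.
- by rewrite piv_uv // cx0 mulr0 mul0r subr0.
- by rewrite !inE cb cX' orbT.
by split=> //; rewrite eq_sym.
Qed.

End Degree.

(** * Gluing lifts and the induction on the size *)

Section Liftable.

Variables (R Rh : comUnitRingType) (S : R -> Prop) (Sh : Rh -> Prop).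
Variables (f : {rmorphism Rh -> R}) (U : R -> Rh) (E : finType).
Hypothesis HL : lifting S Sh f U.
Implicit Types (X Y K : {set E}) (M N : E -> E -> Rh) (A : E -> E -> R).
Implicit Types (a b c u v w x y z : E).

Let HS := lif_S HL.
Let HSh := lif_Sh HL.
Notation good_ratios := (good_ratios Sh f U).
Notation global := (global Sh f U).
Notation good := (good Sh f U).
Notation good2 := (good2 Sh f U).
Notation obstruction_free := (obstruction_free S U).

Definition liftable X Y A := exists M, global X Y M /\ seqv S X Y (map_entries f M) A.

Lemma su_f r : su Sh r -> su S (f r).
Proof. by case=> h1 h2; split; [apply: (lif_f HL)|apply: rmorph_unit]. Qed.

Lemma map_entries_seqv X Y M N : seqv Sh X Y M N -> seqv S X Y (map_entries f M) (map_entries f N).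
Proof.
move=> [r [c [hr hc h]]]; exists (fun u => f (r u)), (fun v => f (c v)).
split=> [u|v|u v uX vY]; [exact: su_f|exact: su_f|].
by rewrite /map_entries h // !rmorphM.
Qed.

Lemma map_entries_piv M x y : M x y \is a GRing.unit -> map_entries f (piv M x y) = piv (map_entries f M) x y.
Proof.
move=> aU; apply/funext => u; apply/funext => v; rewrite /map_entries /piv.
by case: ifP => _; case: ifP => _; rewrite ?rmorphN ?rmorphB ?rmorphM ?rmorphV.
Qed.

Lemma liftable_tr X Y A : liftable X Y A -> liftable Y X (fun u v => A v u).
Proof.
move=> [M [hM h]]; exists (fun u v => M v u); split; last exact: seqv_tr h.
by apply: (hereditary_tr HSh _ _ hM); [apply: (good_ratios_seqv HL)|apply: good_ratios_tr].
Qed.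

Lemma liftable_piv X Y A x y : [disjoint X & Y] -> entin S X Y A ->
  x \in X -> y \in Y ->
  A x y \is a GRing.unit ->
  liftable (y |: X :\ x) (x |: Y :\ y) (piv A x y) -> liftable X Y A.
Proof.
move=> d hA xX yY aU [M [hM h]].
have d' := disj_piv d xX yY.
have yX' := setU11 y (X :\ x); have xY' := setU11 x (Y :\ y).
have mU : M y x \is a GRing.unit.
  apply: (psU HSh); first by apply: (hereditary_now hM).1.
  rewrite -(lif_eq0 HL); last by apply: (hereditary_now hM).1.
  rewrite -[f _]/(map_entries f M y x) -(seqv_eq0 h) // piv_yx.
  by apply: contraTneq aU => e; rewrite -unitrV e unitr0.
exists (piv M y x); split.
  by have := hereditary_piv hM yX' xY' mU; rewrite (piv_sets d) // (piv_sets' d).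
rewrite map_entries_piv //.
have fU : map_entries f M y x \is a GRing.unit by apply: rmorph_unit.
have := seqv_piv HS d' yX' xY' fU h.
rewrite (piv_sets d) // (piv_sets' d) // => h'; apply: (seqv_trans HS h').
by apply: (seqv_agree HS) => u v uX vY; rewrite (piv_invol d).
Qed.

(* Both lifts restrict to lifts of [A] without the columns x and y, hence agree
   there up to scaling; connectivity makes the two scalings to [A] compatible. *)
Lemma glue x y X Y A : x \notin X :|: Y -> y \notin X :|: Y -> x != y ->
  obstruction_free X (x |: (y |: Y)) A -> connected X Y A ->
  liftable X (y |: Y) A -> liftable X (x |: Y) A -> liftable X (x |: (y |: Y)) A.
Proof.
move=> hx hy xy hf hc [M1 [g1 s1]] [M2 [g2 s2]].
have d := hereditary_disj hf.
have hA : entin S X (x |: (y |: Y)) A := (hereditary_now hf).1.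
have [xY yY] : x \notin Y /\ y \notin Y.
  by move: hx hy; rewrite !inE !negb_or => /andP [_ ->] /andP [_ ->].
have subY w : Y \subset w |: Y by apply: subsetUr.
have sub0 (Q : mprop Rh E) : sub_closed Q -> forall w M, hereditary Q X (w |: Y) M -> hereditary Q X Y M.
  by move=> hQ w M; apply: hereditary_sub.
have g1' := sub0 _ (@good_ratios_sub _ _ _ _ _ _) _ _ g1.
have g2' := sub0 _ (@good_ratios_sub _ _ _ _ _ _) _ _ g2.
have s12 : seqv S X Y (map_entries f M1) (map_entries f M2).
  apply: (seqv_trans HS (seqv_sub (subxx _) (subY _) s1)).
  exact: (seqv_sym HS (seqv_sub (subxx _) (subY _) s2)).
have [r [c [hr hk h12]]] := global_uniq HL g1' g2' s12.
(* Column x is taken from the second lift, all else from the first, rescaled to agree with the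
   second on Y. The factor 1 at y is arbitrary, since the second lift says nothing about that
   column. *)
pose M u v := if v == x then M2 u x else r u * M1 u v * (if v == y then 1 else c v).
have Ex u : M u x = M2 u x by rewrite /M eqxx.
have E1 : seqv Sh X (y |: Y) M1 M.
  exists r, (fun v => if v == y then 1 else c v); split=> // [v|u v uX].
    by case: eqP => _; [apply: (su1 HSh)|apply: hk].
  rewrite /M !inE => vY; case: eqP => // vx; move: vY.
  by rewrite vx (negPf xy) (negPf xY).
have E2 u v : u \in X -> v \in x |: Y -> M u v = M2 u v.
  move=> uX; rewrite /M !inE; case: (eqVneq v x) => [-> //|_] /= vY.
  have -> : (v == y) = false by apply: contraNF yY => /eqP <-.
  by rewrite h12.
have gM1 : global X (y |: Y) M by apply: (hereditary_seqv HSh (good_ratios_seqv HL) E1).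
have gM2 : global X (x |: Y) M.
  by apply: (hereditary_seqv HSh (good_ratios_seqv HL) (seqv_agree HSh E2)).
have t1 : seqv S X (y |: Y) (map_entries f M) A.
  exact: (seqv_trans HS (seqv_sym HS (map_entries_seqv E1)) s1).
have t2 : seqv S X (x |: Y) (map_entries f M) A.
  exact: (seqv_trans HS (map_entries_seqv (seqv_sym HSh (seqv_agree HSh E2))) s2).
have zM u v : u \in X -> v \in Y -> M u v != 0 -> A u v != 0.
  move=> uX vY n; have vyY : v \in y |: Y by rewrite inE vY orbT.
  rewrite (seqv_eq0 t1) // /map_entries (lif_eq0 HL) //.
  by apply: (hereditary_now gM1).1.
have zA u v : u \in X -> v \in Y -> A u v != 0 -> M u v \is a GRing.unit.
  move=> uX vY n; have vyY : v \in y |: Y by rewrite inE vY orbT.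
  have Sm : Sh (M u v) by apply: (hereditary_now gM1).1.
  apply: (psU HSh) => //; move: n.
  by rewrite (seqv_eq0 t1) // /map_entries (lif_eq0 HL).
have [r1 [c1 [hr1 hc1 e1]]] := t1; have [r2 [c2 [hr2 hc2 e2]]] := t2.
have dX v : v \in Y -> v \in X = false.
  by move=> vY; rewrite (disjointFl d) // !inE vY !orbT.
have [l [hl lX]] : exists l, su S l /\ forall u, u \in X -> r2 u = r1 u * l.
  have [->|[u0 u0X]] := set_0Vmem X.
    by exists 1; split; [apply: (su1 HS)|move=> u; rewrite inE].
  (* Both scalings produce the same entries of A on Y, so the ratio of the row factors equals the
     inverse ratio of the column factors along each edge. Connectivity makes this ratio a constant,
     which rescales column x. *)
  pose lam w := if w \in X then r2 w * (r1 w)^-1 else c1 w * (c2 w)^-1.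
  exists (lam u0); split.
    by rewrite /lam u0X; apply: (suM HS); [apply: hr2|apply: (suV HS); apply: hr1].
  have edge_constant_lam : edge_constant X Y A (fun w => lam w == lam u0).
    move=> u v uX vY n; suff -> : lam u = lam v by [].
    rewrite /lam uX dX //.
    have [mU [_ ru1] [_ ru2]] := And3 (zA u v uX vY n) (hr1 u) (hr2 u).
    have [[_ cv1] [_ cv2]] := conj (hc1 v) (hc2 v).
    have fU : map_entries f M u v \is a GRing.unit by apply: rmorph_unit.
    have : r1 u * map_entries f M u v * c1 v = r2 u * map_entries f M u v * c2 v.
      by rewrite -e1 -?e2 // !inE vY orbT.
    move: (map_entries f M u v) fU => m mU' e.
    have -> : r2 u * (r1 u)^-1 = (r2 u * m * c2 v) * (m^-1 * (r1 u)^-1 * (c2 v)^-1).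
      ring: (mulrV mU') (mulrV cv2).
    by rewrite -e; ring: (mulrV mU') (mulrV ru1).
  move=> u uX; have := hc _ edge_constant_lam u u0.
  rewrite !inE uX u0X eqxx => /(_ isT isT)/eqP <-.
  by rewrite /lam uX; have [_ ru] := hr1 u; ring: (mulrV ru).
have hM : global X (x |: (y |: Y)) M.
  apply: (safe_glob HL (x := x) (y := y)); last first.
    by move=> k hk'; apply: hc => u v uX vY n; apply: hk' => //;
       apply: contraTneq (zA u v uX vY n) => ->; rewrite unitr0.
  split=> //; split=> //.
  apply: hereditary_seqv hf; [exact: HS|exact: (lift_laws_seqv HL)|apply: (seqv_sym HS)].
  exists r1, (fun v => if v == x then l * c2 x else c1 v); split=> // [v|u v uX].
    by case: eqP => _ //; apply: (suM HS).
  rewrite in_setU1; case: (eqVneq v x) => [->|vx] /= vY; last exact: e1.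
  by rewrite e2 ?inE ?eqxx // lX //; ring.
exists M; split=> //.
exists r1, (fun v => if v == x then l * c2 x else c1 v); split=> // [v|u v uX].
  by case: eqP => _ //; apply: (suM HS).
rewrite in_setU1; case: (eqVneq v x) => [->|vx] /= vY; last exact: e1.
by rewrite e2 ?inE ?eqxx // lX //; ring.
Qed.

Definition part (k : E -> bool) (b : bool) X := [set u in X | k u == b].

Lemma part_sub k (b : bool) X : part k b X \subset X.
Proof. by apply/subsetP => u; rewrite inE => /andP []. Qed.

Lemma part_piv k (b : bool) X x y : k x = b -> k y = b -> x != y ->
  part k b (y |: X :\ x) = y |: (part k b X) :\ x.
Proof.
move=> kx ky xy; apply/setP => u; rewrite !inE.
by case: (eqVneq u y) => [->|_] /=; rewrite ?ky ?eqxx // andbA.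
Qed.

Lemma part_piv0 k (b : bool) X x y : k x != b -> k y != b ->
  part k b (y |: X :\ x) = part k b X.
Proof.
move=> kx ky; apply/setP => u; rewrite !inE.
case: (eqVneq u y) => [->|_] /=; first by rewrite (negPf ky) andbF.
by case: (eqVneq u x) => [->|_] //=; rewrite (negPf kx) andbF.
Qed.

(** A pivot changes only the block that contains it and keeps the blocks apart, and four nonzero
    entries forming a 2 x 2 submatrix lie in one block. *)
Lemma global_parts X Y M k : [disjoint X & Y] -> edge_constant X Y M k ->
  (forall b : bool, global (part k b X) (part k b Y) M) -> global X Y M.
Proof.
move=> d hk hg; split=> // X' Y' M' r.
suff [{}hk {}hg] : edge_constant X' Y' M' k /\ forall b : bool, global (part k b X') (part k b Y') M'.
  have inp u (Z : {set E}) : u \in Z -> u \in part k (k u) Z by move=> uZ; rewrite inE uZ eqxx.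
  have ne u v : u \in X' -> v \in Y' -> M' u v != 0 -> v \in part k (k u) Y'.
    by move=> uX vY n; rewrite (hk u v uX vY n) inp.
  split=> [u v uX vY|a b x y aX bX xY yY n1 n2 n3 n4].
    have [->|n] := eqVneq (M' u v) 0; first exact: (ps0 HSh).
    by apply: (hereditary_now (hg (k u))).1; [apply: inp|apply: ne].
  apply: (hereditary_now (hg (k a))).2 => //; [exact: inp| |exact: ne|exact: ne].
  by rewrite (hk a x aX xY n1) -(hk b x bX xY n3) inp.
elim: r => // X1 Y1 M1 x y r1 [hk1 hg1] xX yY aU.
have d1 := reach_disj r1 d; have xy := disj_neq d1 xX yY.
split; first exact: edge_constant_piv.
have nxy : M1 x y != 0 by apply: contraTneq aU => ->; rewrite unitr0.
have kxy := hk1 x y xX yY nxy.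
move=> b; have [kb|kb] := eqVneq (k x) b.
  rewrite !part_piv // -?kxy // 1?eq_sym //.
  apply: hereditary_piv => //; first exact: hg1.
    by rewrite inE xX kb eqxx.
  by rewrite inE yY -kxy kb eqxx.
rewrite !part_piv0 // -?kxy //.
apply: (hereditary_seqv HSh (good_ratios_seqv HL)) (hg1 b); apply: (seqv_agree HSh).
move=> u v; rewrite !inE => /andP [uX /eqP ku] /andP [vY /eqP kv].
have uy : u != y by apply: contraNneq kb => e; rewrite kxy -e ku.
have vx : v != x by apply: contraNneq kb => e; rewrite -e kv.
rewrite piv_uv //.
have -> : M1 u y = 0.
  apply/eqP; apply: contraT => n; move: kb.
  by rewrite kxy -(hk1 u y uX yY n) ku eqxx.
by rewrite mulr0 mul0r subr0.
Qed.

Lemma liftable_parts X Y A k : [disjoint X & Y] -> edge_constant X Y A k ->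
  (forall b : bool, liftable (part k b X) (part k b Y) A) -> liftable X Y A.
Proof.
move=> d hk hl; have [M1 [g1 [r1 [c1 [hr1 hc1 e1]]]]] := hl true.
have [M2 [g2 [r2 [c2 [hr2 hc2 e2]]]]] := hl false.
pose M u v := if k u then (if k v then M1 u v else 0) else (if k v then 0 else M2 u v).
exists M; split.
  apply: (global_parts (k := k) d).
    by move=> u v uX vY; rewrite /M; case: (k u); case: (k v); rewrite ?eqxx.
  case.
    apply: (hereditary_seqv HSh (good_ratios_seqv HL)) g1; apply: (seqv_agree HSh) => u v.
    by rewrite /M !inE => /andP [_ /eqP ->] /andP [_ /eqP ->].
  apply: (hereditary_seqv HSh (good_ratios_seqv HL)) g2; apply: (seqv_agree HSh) => u v.
  by rewrite /M !inE => /andP [_ /eqP ->] /andP [_ /eqP ->].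
exists (fun u => if k u then r1 u else r2 u), (fun v => if k v then c1 v else c2 v).
split=> [u|v|u v uX vY]; [by case: (k u)|by case: (k v)|].
rewrite /map_entries /M; case ku : (k u); case kv : (k v).
- by rewrite e1 // inE ?uX ?vY ?ku ?kv.
- rewrite rmorph0 mulr0 mul0r; apply/eqP; apply: contraT => n.
  by have := hk u v uX vY n; rewrite ku kv.
- rewrite rmorph0 mulr0 mul0r; apply/eqP; apply: contraT => n.
  by have := hk u v uX vY n; rewrite ku kv.
by rewrite e2 // inE ?uX ?vY ?ku ?kv.
Qed.

Lemma global_col X Y M : [disjoint X & Y] -> entin Sh X Y M -> (#|Y| <= 1)%N ->
  global X Y M.
Proof.
move=> d hS cY; apply: (globI HL d hS) => X' Y' M' r hS' a b x y aX bX xY yY.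
have cY' : (#|Y'| <= 1)%N by rewrite (reach_card r d).2.
have -> : y = x by move/card_le1_eqP: cY'; apply.
by apply: (good2_same_cols HL); apply: hS'.
Qed.

(** A single column scales to zeros and ones, and without a second column there is no cross ratio to
    check. *)
Lemma liftable_col X Y A : [disjoint X & Y] -> entin S X Y A -> (#|Y| <= 1)%N ->
  liftable X Y A.
Proof.
move=> d hA cY; exists (fun u v => if A u v == 0 then 0 else 1); split.
  apply: global_col => // u v _ _; case: ifP => _; [exact: (ps0 HSh)|exact: (ps1 HSh)].
have [->|[v0 v0Y]] := set_0Vmem Y.
  by apply: (seqv_agree HS) => u v _; rewrite inE.
exists (fun u => if (u \in X) && (A u v0 != 0) then A u v0 else 1), (fun _ => 1).
split=> [u|_|u v uX vY].
- case: ifP => [/andP [uX n]|_]; last exact: (su1 HS).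
  by split; [apply: hA|apply: (psU HS) => //; apply: hA].
- exact: (su1 HS).
have -> : v = v0 by move/card_le1_eqP: cY; apply.
rewrite /map_entries uX mulr1 /=; case: eqP => [->|_]; first by rewrite rmorph0 mulr0.
by rewrite rmorph1 mulr1.
Qed.

Lemma reach_nocol X M X' Y' M' : reach X set0 M X' Y' M' -> X' = X /\ M' = M.
Proof.
suff h : forall Y, Y = set0 -> reach X Y M X' Y' M' -> Y' = set0 /\ X' = X /\ M' = M.
  by case/(h _ erefl).
move=> Y eY; elim=> // X1 Y1 M1 x y _ [-> _] _; by rewrite inE.
Qed.

(** The lift has one entry [U p], all others being 1; p = 0 is allowed. As x and y are the only
    columns, no pivot avoids both, so [almost_glob] asks only about this matrix itself. *)
Lemma liftable_22 a b x y A : a != b -> x != y ->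
  obstruction_free [set a; b] [set x; y] A -> A a y != 0 -> A b x != 0 -> A b y != 0 ->
  liftable [set a; b] [set x; y] A.
Proof.
move=> ab xy hf n2 n3 n4; have d := hereditary_disj hf.
have hA := obstruction_free_entin hf.
have [aX bX] : a \in [set a; b] /\ b \in [set a; b] by rewrite !inE !eqxx orbT.
have [xY yY] : x \in [set x; y] /\ y \in [set x; y] by rewrite !inE !eqxx orbT.
have hS := hereditary_now hA.
have [u2 u3 u4] : [/\ A a y \is a GRing.unit, A b x \is a GRing.unit & A b y \is a GRing.unit].
  by split; apply: (psU HS) => //; apply: hS.
pose p := cr A a b x y.
have fp : fund S p.
  have [e|n1] := eqVneq (A a x) 0; last by apply: (hereditary_fund HS hA).
  by rewrite /p /cr e !mul0r; apply: fund0 HL.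
have gp := good_U HL fp.
pose M u v := if (u == a) && (v == x) then U p else 1.
have hSh : entin Sh [set a; b] [set x; y] M.
  by move=> u v _ _; rewrite /M; case: ifP => _; [case: gp|apply: (ps1 HSh)].
have hs : seqv S [set a; b] [set x; y] (map_entries f M) A.
  exists (fun u => if u == a then A a y else A b y),
    (fun v => if v == x then A b x * (A b y)^-1 else 1).
  split=> [u|v|u v].
  - by case: eqP => _; split=> //; apply: hS.
  - case: eqP => _; last exact: (su1 HS).
    by split; [apply: (psM HS); [apply: hS|apply/(psV HS)/hS]|rewrite unitrM unitrV u3].
  rewrite /map_entries /M !inE; have [->|ua] /= := eqVneq u a; have [->|vx] //= := eqVneq v x.
  - rewrite (lif_fU HL fp) /p /cr invrM // => _ _.
    ring: (mulrV u2) (mulrV u3) (mulrV u4).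
  - by move=> _ /eqP ->; rewrite rmorph1 !mulr1.
  - by move=> /eqP -> _; rewrite rmorph1; ring: (mulrV u4).
  by move=> /eqP -> /eqP ->; rewrite rmorph1 !mulr1.
exists M; split=> //.
have mono w : global [set a; b] ([set x; y] :\ w) M \/ w \notin [set x; y].
  have [wY|] := boolP (w \in [set x; y]); last by right.
  left; apply: global_col.
  - by apply: disjointWr d; apply: subsetDl.
  - by apply: entin_sub hSh; rewrite ?subsetDl.
  by have := cardsD1 w [set x; y]; rewrite wY cards2 xy add1n => -[<-].
apply: (almost_glob_glob HL (x := x) (y := y)); split=> //; split.
- by case: (mono x); rewrite ?xY.
- by case: (mono y); rewrite ?yY.
- by apply: hereditary_seqv (seqv_sym HS hs) hf => //; apply: (lift_laws_seqv HL).
move=> X' Y' M'; rewrite setDv => /reach_nocol [-> ->] u v uX vX.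
have Mb w : M b w = 1 by rewrite /M [b == a]eq_sym (negPf ab).
have key : good2 M a b x y.
  move=> _ _ _ _; rewrite /cr !Mb /M !eqxx [y == x]eq_sym (negPf xy) /= !mulr1 invr1 mulr1.
  exact: gp.
move: uX vX; rewrite !inE => /orP [] /eqP -> /orP [] /eqP ->.
- by apply: (good2_same_rows HL); apply: hSh.
- exact: key.
- by apply: (good2_rows HL) key; apply: hSh.
by apply: (good2_same_rows HL); apply: hSh.
Qed.

Lemma obstruction_free_sub X Y A X' Y' : X' \subset X -> Y' \subset Y -> obstruction_free X Y A -> obstruction_free X' Y' A.
Proof. by apply: hereditary_sub; apply: lift_laws_sub. Qed.

Lemma obstruction_free_tr X Y A : obstruction_free X Y A -> obstruction_free Y X (fun u v => A v u).
Proof. by apply: (hereditary_tr HS); [apply: (lift_laws_seqv HL)|apply: lift_laws_tr]. Qed.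

Lemma connected_tr X Y A : connected X Y A -> connected Y X (fun u v => A v u).
Proof.
move=> h k hk w w'; rewrite ![_ \in Y :|: X]inE orbC [(w' \in Y) || _]orbC -!in_setU.
by apply: h => u v uX vY n; rewrite (hk v u).
Qed.

Lemma leaf_cols X Y A x y : x \in Y -> y \in Y -> x != y -> obstruction_free X Y A ->
  connected (X :\: [set x; y]) (Y :\: [set x; y]) A ->
  liftable X (Y :\ x) A -> liftable X (Y :\ y) A -> liftable X Y A.
Proof.
move=> xY yY xy hf hc l1 l2; have d := hereditary_disj hf.
have eX : X :\: [set x; y] = X.
  apply/setP => e; rewrite !inE; case: (boolP (e \in X)); rewrite ?andbF // andbT => eX.
  by rewrite negb_or !(disj_neq d).
rewrite eX in hc.
have e1 : Y :\ x = y |: Y :\: [set x; y].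
  apply/setP => e; rewrite !inE; case: (eqVneq e y) => [->|_] /=.
    by rewrite eq_sym xy.
  by rewrite orbF.
have e2 : Y :\ y = x |: Y :\: [set x; y].
  apply/setP => e; rewrite !inE; case: (eqVneq e x) => [->|_] //=.
  by rewrite xy.
have e3 : Y = x |: (y |: Y :\: [set x; y]).
  by rewrite -e1 setD1K.
rewrite e1 in l1; rewrite e2 in l2; rewrite e3 in hf *.
apply: glue => //; rewrite !inE !eqxx ?orbT /= orbF.
  by rewrite (disjointFl d).
by rewrite (disjointFl d).
Qed.

Theorem obstruction_free_liftable X Y A : obstruction_free X Y A -> liftable X Y A.
Proof.
have [n] := ubnP (#|X| + #|Y|); elim: n X Y A => // n ih X Y A; rewrite ltnS => hn hf.
have d := hereditary_disj hf; have hS := hereditary_now (obstruction_free_entin hf).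
have [hc|nc] := pselect (connected X Y A); last first.
  apply: contrapT => nl; apply: nc => k hk w w' wD w'D; apply: contrapT => kw; apply: nl.
  apply: (liftable_parts d hk) => b; apply: ih; last first.
    by apply: obstruction_free_sub hf; apply: part_sub.
  have [z [zD kz]] : exists z, z \in X :|: Y /\ k z != b.
    have [e|] := eqVneq (k w) b; last by exists w.
    by exists w'; split=> //; rewrite -e eq_sym; apply/eqP.
  apply: leq_trans hn; have sX := part_sub k b X; have sY := part_sub k b Y.
  move: zD; rewrite inE => /orP [zX|zY].
    rewrite -addSn; apply: leq_add; last exact: subset_leq_card.
    apply: proper_card; rewrite properE sX; apply/subsetPn; exists z => //.
    by rewrite inE (negPf kz) andbF.
  rewrite -addnS; apply: leq_add; first exact: subset_leq_card.
  apply: proper_card; rewrite properE sY; apply/subsetPn; exists z => //.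
  by rewrite inE (negPf kz) andbF.
have cD (Z : {set E}) z : z \in Z -> (#|Z :\ z| < #|Z|)%N.
  by move=> zZ; rewrite (cardsD1 z Z) zZ.
have deg3_case X1 Y1 A1 : obstruction_free X1 Y1 A1 -> connected X1 Y1 A1 ->
    (#|X1| + #|Y1| = #|X| + #|Y|)%N -> deg3 X1 Y1 A1 -> liftable X1 Y1 A1.
  move=> hf1 hc1 hn1 h3; have d1 := hereditary_disj hf1.
  have [x [y [xy /orP [] /andP [h1 h2] hc2]]] := deg3_leaves d1 hc1 h3.
    have del z : z \in X1 -> liftable (X1 :\ z) Y1 A1.
      move=> zX; apply: ih; last by apply: obstruction_free_sub hf1; rewrite ?subsetDl.
      by apply: leq_trans hn; rewrite -hn1 ltn_add2r cD.
    apply: liftable_tr; apply: (leaf_cols h1 h2 xy (obstruction_free_tr hf1)).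
    - exact: connected_tr hc2.
    - exact/liftable_tr/del.
    exact/liftable_tr/del.
  have del z : z \in Y1 -> liftable X1 (Y1 :\ z) A1.
    move=> zY; apply: ih; last by apply: obstruction_free_sub hf1; rewrite ?subsetDl.
    by apply: leq_trans hn; rewrite -hn1 ltn_add2l cD.
  exact: (leaf_cols h1 h2 xy hf1 hc2 (del _ h1) (del _ h2)).
have [cY|cY] := leqP #|Y| 1; first exact: liftable_col.
have [cX|cX] := leqP #|X| 1.
  apply: (@liftable_tr Y X (fun u v => A v u)); apply: liftable_col => //.
    by rewrite disjoint_sym.
  by move=> u v uY vX; apply: hS.
have big X1 Y1 A1 : obstruction_free X1 Y1 A1 -> connected X1 Y1 A1 ->
    (#|X1| + #|Y1| = #|X| + #|Y|)%N -> (2 < #|X1|)%N -> (1 < #|Y1|)%N ->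
    liftable X1 Y1 A1.
  move=> hf1 hc1 hn1 cX1 cY1; have d1 := hereditary_disj hf1.
  have hS1 := hereditary_now (obstruction_free_entin hf1).
  have [h3|[x [y [xX yY aU h3]]]] := deg3_piv HS d1 hS1 hc1 cX1 cY1.
    exact: deg3_case.
  apply: (liftable_piv d1 hS1 xX yY aU); apply: deg3_case h3.
  - exact: hereditary_piv.
  - exact: connected_piv.
  have := reach_card (reach1 xX yY aU) d1.
  by case=> -> ->.
have [cX3|cX3] := ltnP 2 #|X|; first exact: big.
have [cY3|cY3] := ltnP 2 #|Y|.
  apply: (@liftable_tr Y X (fun u v => A v u)); apply: big => //.
  - exact: obstruction_free_tr.
  - exact: connected_tr.
  exact: addnC.
have /cards2P [a0 [b0 [ab0 eX]]] : #|X| == 2%N by rewrite eqn_leq cX3 cX.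
have /cards2P [x0 [y0 [xy0 eY]]] : #|Y| == 2%N by rewrite eqn_leq cY3 cY.
(* A connected 2 x 2 matrix has at most one zero; the labels are chosen so that it can only be at
   (a, x). *)
have [a [b [x [y [ab xy eX' eY' [n1 n2 n3]]]]]] : exists a b x y, [/\ a != b, x != y,
    X = [set a; b], Y = [set x; y] & [/\ A a y != 0, A b x != 0 & A b y != 0]].
  have gen a b x y : a != b -> x != y -> X = [set a; b] -> Y = [set x; y] ->
      A a x = 0 -> [/\ A a y != 0, A b x != 0 & A b y != 0].
    move=> ab xy eX1 eY1 z.
    have [aX bX] : a \in X /\ b \in X by rewrite eX1 !inE !eqxx orbT.
    have [xY yY] : x \in Y /\ y \in Y by rewrite eY1 !inE !eqxx orbT.
    have ba : b == a = false by rewrite eq_sym (negPf ab).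
    have yx : y == x = false by rewrite eq_sym (negPf xy).
    split; apply/negP => /eqP z'.
    - have [|||h _] := @connected_rows _ _ X Y A (pred1 b) predT b hc d.
      + by rewrite inE bX.
      + by rewrite bX /= eqxx.
      + move=> u v; rewrite eX1 eY1 !inE => /orP [] /eqP -> /orP [] /eqP -> //=;
        by rewrite ?z ?z' ?eqxx.
      by have := h a aX; rewrite /= (negPf ab).
    - have [|||_ h] := @connected_rows _ _ X Y A predT (pred1 y) b hc d.
      + by rewrite inE bX.
      + by rewrite bX.
      + move=> u v; rewrite eX1 eY1 !inE => /orP [] /eqP -> /orP [] /eqP -> //=;
        by rewrite ?z ?z' ?eqxx.
      by have := h x xY; rewrite /= (negPf xy).
    have [|||h _] := @connected_rows _ _ X Y A (pred1 a) (pred1 y) a hc d.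
    + by rewrite inE aX.
    + by rewrite aX /= eqxx.
    + move=> u v; rewrite eX1 eY1 !inE => /orP [] /eqP -> /orP [] /eqP -> //=;
      by rewrite ?z ?z' ?eqxx ?ba ?(negPf xy).
    by have := h b bX; rewrite /= ba.
  have ba0 : b0 != a0 by rewrite eq_sym.
  have yx0 : y0 != x0 by rewrite eq_sym.
  have eXc : X = [set b0; a0] by rewrite eX setUC.
  have eYc : Y = [set y0; x0] by rewrite eY setUC.
  have [z|m2] := eqVneq (A a0 y0) 0.
    by exists a0, b0, y0, x0; split=> //; apply: gen.
  have [z|m3] := eqVneq (A b0 x0) 0.
    by exists b0, a0, x0, y0; split=> //; apply: gen.
  have [z|m4] := eqVneq (A b0 y0) 0.
    by exists b0, a0, y0, x0; split=> //; apply: gen.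
  by exists a0, b0, x0, y0.
by move: hf; rewrite eX' eY' => hf; apply: liftable_22.
Qed.

End Liftable.

(** * Matrices over partial fields *)

Section PartialFieldSet.

Variable P : partial_field.

Definition inS (r : pfring P) : Prop := exists p, r = pfin p.

Lemma pfin_eq0 (p : P) : (pfin p == 0) = (p == pf_zero).
Proof. by rewrite -(pfin0 P) (inj_eq (@pfin_inj P)). Qed.

Lemma pfin_unit (p : P) : p != pf_zero ->
  pfin p \is a GRing.unit /\ (pfin p)^-1 = pfin (pf_inv p).
Proof.
move=> p0; have h : pfin (pf_inv p) * pfin p = 1 by rewrite -pfinM pf_mulVp.
have pU : pfin p \is a GRing.unit by apply/unitrP; exists (pfin (pf_inv p)); rewrite h mulrC h.
by split=> //; rewrite -[LHS]mul1r -h mulrK.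
Qed.

Lemma inS_pfset : pfset inS.
Proof.
split.
- by exists pf_zero; rewrite pfin0.
- by exists pf_one.
- by move=> _ [p ->]; exists (pf_opp p); rewrite pfinN.
- by move=> _ _ [p ->] [q ->]; exists (pf_mul p q); rewrite pfinM.
- move=> _ [p ->]; have [->|p0] := eqVneq p pf_zero.
    by exists pf_zero; rewrite pfin0 invr0.
  by exists (pf_inv p); rewrite (pfin_unit p0).2.
by move=> _ [p ->]; rewrite pfin_eq0 => /pfin_unit [].
Qed.

Lemma pfin_inS p : inS (pfin p). Proof. by exists p. Qed.

Definition dn (r : pfring P) : P :=
  if pselect (inS r) is left h then sval (cid h) else pf_zero.

Lemma pfdnK r : inS r -> pfin (dn r) = r.
Proof. by move=> h; rewrite /dn; case: pselect => // h'; case: cid. Qed.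

Lemma dnK p : dn (pfin p) = p.
Proof. by apply: (@pfin_inj P); rewrite pfdnK //; apply: pfin_inS. Qed.

Lemma fundP (p : P) : fundamental p <-> fund inS (pfin p).
Proof.
split=> [[q /pfinD h]|[_ [q h]]].
  split; first exact: pfin_inS.
  by exists q; rewrite -h pfinN.
by exists q; apply/pfinD; rewrite -h pfinN.
Qed.

Lemma fund_inv (r : pfring P) : fund inS r -> r != 0 -> fund inS r^-1.
Proof.
move=> [h1 h2] n; have HS := inS_pfset; have rU := psU HS h1 n.
split; first exact: (psV HS).
rewrite (_ : _ - _ = - (r^-1 * (1 - r))); last by ring: (mulrV rU).
by apply: (psN HS); apply: (psM HS) => //; apply: (psV HS).
Qed.

Lemma pf_detE n (M : 'M[P]_n) d :
  pf_det M d <-> \det (\matrix_(i, j) pfin (M i j)) = pfin d.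
Proof.
rewrite /pf_det -pfin_sum big_map big_enum /=.
suff -> : \sum_(s : 'S_n) pfin (pf_mul (pf_sign P (odd_perm s))
    (\big[pf_mul/pf_one]_(i < n) M i (s i))) = \det (\matrix_(i, j) pfin (M i j)) by [].
apply: eq_bigr => s _; rewrite pfinM; congr (_ * _).
  by case: odd_perm; rewrite /= ?pfinN ?expr1 ?expr0.
rewrite (big_morph _ (@pfinM P) (@pfin1 P)).
by apply: eq_bigr => i _; rewrite mxE.
Qed.

End PartialFieldSet.

Section LiftingData.

Variables (P Ph : partial_field) (phi : Ph -> P) (up : P -> Ph).
Hypotheses (hphi : pf_hom phi) (hup : lifting_function phi up).

Definition ringU (r : pfring P) : pfring Ph := pfin (up (dn r)).

Lemma ringU_in p : ringU (pfin p) = pfin (up p).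
Proof. by rewrite /ringU dnK. Qed.

Lemma ring_lifting :
  lifting (@inS P) (@inS Ph) (ring_rmorphism hphi hup) ringU.
Proof.
split.
- exact: inS_pfset.
- exact: inS_pfset.
- by move=> _ [p ->]; exists (phi p); apply: (ring_hom_in hphi hup).
- by move=> r _; apply: pfin_inS.
- move=> r [[p ->] hp]; rewrite ringU_in [LHS](ring_hom_in hphi hup); congr pfin.
  have fp : fundamental p by apply/fundP; split=> //; apply: pfin_inS.
  by have [-> _ _] := hup fp fp.
- move=> r [[p ->] [q hq]].
  have fp : fundamental p by apply/fundP; split; [apply: pfin_inS|exists q].
  have fq : fundamental q.
    by apply/fundP; split; [apply: pfin_inS|rewrite -hq; exists p; rewrite opprB addrC subrK].
  rewrite hq !ringU_in; have [_ h _] := hup fp fq.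
  have /h /pfinD e : pf_add p q = Some pf_one.
    by apply/pfinD; rewrite -hq addrC subrK pfin1.
  by apply/eqP; rewrite eq_sym subr_eq addrC -(pfin1 Ph) -e.
move=> r fr nr; have [[p rp] _] := fr; rewrite rp in fr nr *.
have p0 : p != pf_zero by rewrite -pfin_eq0.
have [pU pV] := pfin_unit p0; have fV := fund_inv fr nr; rewrite pV in fV *.
rewrite !ringU_in; have /fundP fp := fr; have /fundP fq := fV.
have [_ _ h] := hup fp fq.
have e : pf_mul p (pf_inv p) = pf_one by rewrite pf_mulCt pf_mulVp.
have {h} := congr1 (@pfin Ph) (h e); rewrite pfinM pfin1 => h.
have uU : pfin (up p) \is a GRing.unit.
  by apply/unitrP; exists (pfin (up (pf_inv p))); rewrite mulrC h.
by rewrite -[RHS]mulr1 -h mulrA mulVr // mul1r.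
Qed.

End LiftingData.

(** * Translation between labelled matrices and their ring versions *)

Section LabelledMatrices.

Variables (P : partial_field) (E : finType).
Implicit Types (A B : lmatrix P E).
Notation S := (@inS P).
Let HS := inS_pfset P.

Definition em A : E -> E -> pfring P := fun u v => pfin (A u v).

Lemma em_inS A X Y : entin S X Y (em A).
Proof. by move=> u v _ _; apply: pfin_inS. Qed.

Lemma pmatrix_dets A : pmatrix A <-> dets S (lrows A) (lcols A) (em A).
Proof.
split=> h n f g injf injg fX gY.
  have [d /pf_detE hd] := h n f g injf injg fX gY; exists d; rewrite -hd.
  by congr (\det _); apply/matrixP => i j; rewrite !mxE.
have [d hd] := h n f g injf injg fX gY; exists d; apply/pf_detE; rewrite -hd.
by congr (\det _); apply/matrixP => i j; rewrite !mxE.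
Qed.

Lemma lmx_eq_agree A B : lmx_eq A B -> [/\ lrows A = lrows B, lcols A = lcols B &
  forall u v, u \in lrows A -> v \in lcols A -> em A u v = em B u v].
Proof.
case=> h1 h2 h3; split=> // u v; rewrite h1 h2 => uX vY.
by rewrite /em h3.
Qed.

Lemma pivotP A x y B : [disjoint lrows A & lcols A] -> is_pivot A x y B <->
  [/\ x \in lrows A, y \in lcols A, em A x y \is a GRing.unit,
      lrows B = y |: lrows A :\ x /\ lcols B = x |: lcols A :\ y
    & forall u v, u \in lrows B -> v \in lcols B -> em B u v = piv (em A) x y u v].
Proof.
move=> d; split=> [[[xX yY n] [eX eY] [h1 h2] h3 h4]|[xX yY aU [eX eY] h]].
  have [aU aV] := pfin_unit n; split=> // u v.
  have xy := disj_neq d xX yY.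
  rewrite eX eY !inE; case: (eqVneq u y) => [->|uy] /=; case: (eqVneq v x) => [->|vx] /=.
  - by move=> _ _; rewrite piv_yx /em h1 aV.
  - by move=> _ vY; rewrite piv_yv // /em h2 ?in_setD1 // pfinM aV.
  - by move=> uX _; rewrite piv_ux // /em h3 ?in_setD1 // pfinN pfinM aV.
  move=> uX vY; rewrite piv_uv // /em.
  have uX' : u \in lrows A :\ x by rewrite !inE.
  have vY' : v \in lcols A :\ y by rewrite !inE.
  by have /pfinD := h4 u v uX' vY'; rewrite pfinN !pfinM -aV => <-.
have n : A x y != pf_zero.
  by rewrite -pfin_eq0; apply: contraTneq aU => e; rewrite /em e unitr0.
have [_ aV] := pfin_unit n; have xy := disj_neq d xX yY.
have yB : y \in lrows B by rewrite eX setU11.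
have xB : x \in lcols B by rewrite eY setU11.
have uB u : u \in lrows A :\ x -> u \in lrows B by rewrite eX => uX; rewrite inE uX orbT.
have vB v : v \in lcols A :\ y -> v \in lcols B by rewrite eY => vY; rewrite inE vY orbT.
have uy u : u \in lrows A :\ x -> u != y.
  by rewrite inE => /andP [_ uX]; apply: disj_neq d uX yY.
have vx v : v \in lcols A :\ y -> v != x.
  by rewrite inE eq_sym => /andP [_ vY]; apply: disj_neq d xX vY.
split=> //; last first.
- move=> u v uX vY; apply/pfinD; rewrite pfinN !pfinM -aV.
  by rewrite -[pfin (B u v)]/(em B u v) h ?uB ?vB // piv_uv ?uy ?vx.
- move=> u uX; apply: (@pfin_inj P); rewrite pfinN pfinM -aV.
  by rewrite -[pfin (B u x)]/(em B u x) h ?uB // piv_ux ?uy.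
split; first by apply: (@pfin_inj P); rewrite -aV -[LHS]/(em B y x) h // piv_yx.
move=> v vY; apply: (@pfin_inj P); rewrite pfinM -aV.
by rewrite -[LHS]/(em B y v) h ?vB // piv_yv ?vx.
Qed.

Lemma pfin_su a : a != pf_zero -> su S (pfin a).
Proof. by move=> a0; split; [apply: pfin_inS|case: (pfin_unit a0)]. Qed.

Lemma su_dn r : su S r -> dn r != pf_zero.
Proof.
move=> [h rU]; rewrite -pfin_eq0 pfdnK //; apply: contraTneq rU => ->.
by rewrite unitr0.
Qed.

Lemma minor_step_cases A B : [disjoint lrows A & lcols A] -> minor_step A B ->
  [\/ lrows B \subset lrows A /\ lcols B \subset lcols A /\
        seqv S (lrows B) (lcols B) (em A) (em B)
    | exists x y, [/\ x \in lrows A, y \in lcols A, em A x y \is a GRing.unit,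
      lrows B = y |: lrows A :\ x /\ lcols B = x |: lcols A :\ y
    & forall u v, u \in lrows B -> v \in lcols B -> em B u v = piv (em A) x y u v]].
Proof.
move=> d [x a xX a0 /lmx_eq_agree [/= eX eY h]|y a yY a0 /lmx_eq_agree [/= eX eY h]
  |sX sY h|x y /pivotP -/(_ d) h]; last by right; exists x, y.
- left; rewrite eX eY; split=> //; split=> //.
  exists (fun u => if u == x then pfin a else 1), (fun _ => 1).
  split=> [u|_|u v uX vY]; [|exact: (su1 HS)|].
    by case: eqP => _; [apply: pfin_su|apply: (su1 HS)].
  rewrite h ?eX ?eY // /em /= mulr1; case: eqP => _; last by rewrite mul1r.
  by rewrite pfinM.
- left; rewrite eX eY; split=> //; split=> //.
  exists (fun _ => 1), (fun v => if v == y then pfin a else 1).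
  split=> [_|v|u v uX vY]; [exact: (su1 HS)| |].
    by case: eqP => _; [apply: pfin_su|apply: (su1 HS)].
  rewrite h ?eX ?eY // /em /= mul1r; case: eqP => _; last by rewrite mulr1.
  by rewrite pfinM mulrC.
left; split=> //; split=> //; apply: (seqv_agree HS) => u v uX vY.
by rewrite /em h.
Qed.

Lemma minor_disj A B : [disjoint lrows A & lcols A] -> minor A B ->
  [disjoint lrows B & lcols B].
Proof.
move=> d; elim=> // {}B C _ dB /(minor_step_cases dB) [[sX [sY _]]|].
  exact: disjointW dB.
by move=> [x [y [xX yY _ [-> ->] _]]]; apply: disj_piv.
Qed.

Lemma hereditary_minor (Q : mprop (pfring P) E) A B : seqv_closed S Q -> sub_closed Q ->
  [disjoint lrows A & lcols A] -> minor A B ->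
  hereditary Q (lrows A) (lcols A) (em A) -> hereditary Q (lrows B) (lcols B) (em B).
Proof.
move=> h1 h2 d m hA; elim: m => // {}B C mB hB.
have dB := minor_disj d mB.
case/(minor_step_cases dB) => [[sX [sY h]]|[x [y [xX yY aU [eX eY] h]]]].
  by apply: (hereditary_seqv HS h1 h); apply: hereditary_sub hB.
have := hereditary_piv hB xX yY aU; rewrite -eX -eY => hC.
by apply: (hereditary_seqv HS h1 _ hC); apply: (seqv_agree HS).
Qed.

Lemma minor_trans A B C : minor A B -> minor B C -> minor A C.
Proof. by move=> h; elim=> // B' C' _ ih; apply: MinorStep ih. Qed.

Lemma minor1 A B : minor_step A B -> minor A B.
Proof. by apply: MinorStep; apply: MinorRefl. Qed.

(** Each pivot is undone by the pivot over the inverse entry, so the state is realized by a matrix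
    strongly equivalent to [A]. Its entries are brought back by [dn], which is faithful because
    every state has entries in the partial field. *)
Lemma minor_reach A X' Y' M' : hereditary (@entin _ S E) (lrows A) (lcols A) (em A) ->
  reach (lrows A) (lcols A) (em A) X' Y' M' ->
  exists A', [/\ minor A A', minor A' A, lrows A' = X', lcols A' = Y' &
    forall u v, u \in X' -> v \in Y' -> em A' u v = M' u v].
Proof.
move=> hA r; have d := hereditary_disj hA.
elim: r {-2}X' {-2}Y' {-2}M' (erefl X') (erefl Y') (erefl M') => [|X1 Y1 M1 x y r1 ih xX yY aU].
  by move=> _ _ _ -> -> ->; exists A; split=> //; apply: MinorRefl.
move=> X2 Y2 M2 eX2 eY2 eM2; subst.
have [A1 [m1 m1' eX eY h]] := ih _ _ _ erefl erefl erefl.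
have d1 := reach_disj r1 d.
pose A2 := LMatrix (y |: X1 :\ x) (x |: Y1 :\ y) (fun u v => dn (piv M1 x y u v)).
have hS : entin S (y |: X1 :\ x) (x |: Y1 :\ y) (piv M1 x y).
  by apply: hA.2; apply: reachS.
have E2 u v : u \in lrows A2 -> v \in lcols A2 -> em A2 u v = piv M1 x y u v.
  by move=> uX vY; rewrite /em /= pfdnK //; apply: hS.
have pivE u v : u \in y |: X1 :\ x -> v \in x |: Y1 :\ y ->
    piv (em A1) x y u v = piv M1 x y u v.
  rewrite !inE /piv h //; case: (eqVneq u y) => [_|uy] /=;
    case: (eqVneq v x) => [_|vx] //=.
  - by move=> _ /andP [_ vY]; rewrite h.
  - by move=> /andP [_ uX] _; rewrite h.
  by move=> /andP [_ uX] /andP [_ vY]; rewrite !h.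
have p12 : is_pivot A1 x y A2.
  apply/pivotP; rewrite eX eY //; split=> //; first by rewrite h.
  by move=> u v uX vY; rewrite E2 // pivE.
have p21 : is_pivot A2 y x A1.
  apply/pivotP => /=; first exact: disj_piv.
  split; rewrite ?setU11 //; first by rewrite E2 ?setU11 //= piv_yx unitrV.
    by rewrite eX eY (piv_sets d1) // (piv_sets' d1).
  rewrite eX eY => u v uX vY.
  have -> : em A1 u v = piv (piv M1 x y) y x u v by rewrite (piv_invol d1) // h.
  have yx := disj_neq (disj_piv d1 xX yY) (setU11 y (X1 :\ x)) (setU11 x (Y1 :\ y)).
  have uX2 : u != x -> u \in lrows A2 by move=> ux; rewrite /= !inE ux uX orbT.
  have vY2 : v != y -> v \in lcols A2 by move=> vy; rewrite /= !inE vy vY orbT.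
  rewrite [LHS]/piv [RHS]/piv.
  have yX2 : y \in lrows A2 by rewrite /= setU11.
  have xY2 : x \in lcols A2 by rewrite /= setU11.
  rewrite (E2 y x) //.
  case: (eqVneq u x) => [_|/uX2 uB]; case: (eqVneq v y) => [_|/vY2 vB] //.
  - by rewrite (E2 y v).
  - by rewrite (E2 u x).
  by rewrite (E2 u v) // (E2 u x) // (E2 y v).
exists A2; split=> //.
- by apply: MinorStep m1 _; apply: MinorPivot p12.
- by apply: minor_trans m1'; apply: minor1; apply: MinorPivot p21.
Qed.

Lemma minor_agree A B : lrows B \subset lrows A -> lcols B \subset lcols A ->
  (forall u v, u \in lrows B -> v \in lcols B -> A u v = B u v) -> minor A B.
Proof. by move=> sX sY h; apply/minor1/MinorDelete. Qed.

Lemma minor_scale A (r c : E -> P) : (forall u, r u != pf_zero) ->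
  (forall v, c v != pf_zero) ->
  minor A (LMatrix (lrows A) (lcols A) (fun u v => pf_mul (pf_mul (r u) (A u v)) (c v))).
Proof.
move=> hr hc.
pose R1 (s : seq E) := LMatrix (lrows A) (lcols A)
  (fun u v => if u \in s then pf_mul (r u) (A u v) else A u v).
have m1 s : uniq s -> {subset s <= lrows A} -> minor A (R1 s).
  elim: s => [|x s ih] us ss; first by apply: minor_agree.
  have /andP [xs us'] := us.
  apply: (MinorStep (ih us' _)); first by move=> e es; apply: ss; rewrite inE es orbT.
  apply: (@MinorScaleRow _ _ _ _ x (r x)) => //=; first by apply: ss; rewrite inE eqxx.
  split=> // u v _ _ /=; rewrite inE; case: (eqVneq u x) => [->|_] //=.
  by rewrite (negPf xs).
pose B := R1 (enum (lrows A)).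
pose C1 (s : seq E) := LMatrix (lrows A) (lcols A)
  (fun u v => if v \in s then pf_mul (c v) (B u v) else B u v).
have m2 s : uniq s -> {subset s <= lcols A} -> minor B (C1 s).
  elim: s => [|y s ih] us ss; first by apply: minor_agree.
  have /andP [ys us'] := us.
  apply: (MinorStep (ih us' _)); first by move=> e es; apply: ss; rewrite inE es orbT.
  apply: (@MinorScaleCol _ _ _ _ y (c y)) => //=; first by apply: ss; rewrite inE eqxx.
  split=> // u v _ _ /=; rewrite inE; case: (eqVneq v y) => [->|_] //=.
  by rewrite (negPf ys).
apply: minor_trans (m1 (enum (lrows A)) (enum_uniq _) _) _.
  by move=> u; rewrite mem_enum.
apply: minor_trans (m2 (enum (lcols A)) (enum_uniq _) _) _.
  by move=> u; rewrite mem_enum.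
apply: minor_agree => //= u v uX vY.
by rewrite !mem_enum uX vY pf_mulCt.
Qed.

Lemma gadjE A : gadj A = radj (lrows A) (lcols A) (em A).
Proof.
by apply/funext => u; apply/funext => v; rewrite /gadj /radj /em !pfin_eq0.
Qed.

Lemma induced_cycleE A c : induced_cycle A c <-> induced (radj (lrows A) (lcols A) (em A)) c.
Proof. by rewrite /induced_cycle gadjE. Qed.

Lemma pfin_csig A c : path.cycle (radj (lrows A) (lcols A) (em A)) c -> uniq c ->
  pfin (cycle_signature A c) = csig (lrows A) (em A) c.
Proof.
move=> hc uc; rewrite /cycle_signature /csig pfinM; congr (_ * _).
  by case: odd; rewrite /= ?pfinN.
rewrite (big_morph _ (@pfinM P) (@pfin1 P)) big_seq [RHS]big_seq.
apply: eq_bigr => v vc; have := next_cycle hc vc.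
rewrite /edge_signature /esig; case: ifP => // vX.
rewrite /radj vX /= => /and3P [_ _]; rewrite /em pfin_eq0 => n.
by rewrite (pfin_unit n).2.
Qed.

End LabelledMatrices.

(** * Obstructions *)

Section ShortCycles.

Variables (R : comUnitRingType) (E : finType).
Implicit Types (A M : E -> E -> R) (X Y : {set E}) (a b c x y z w : E).

Lemma induced4 X Y A a b x y : [disjoint X & Y] -> a \in X -> b \in X ->
  x \in Y -> y \in Y -> a != b -> x != y ->
  A a x != 0 -> A a y != 0 -> A b x != 0 -> A b y != 0 ->
  induced (radj X Y A) [:: a; x; b; y].
Proof.
move=> d aX bX xY yY ab xy n1 n2 n3 n4.
have rY u : u \in X -> (u \in Y) = false by move=> h; rewrite (disjointFr d).
have cX v : v \in Y -> (v \in X) = false by move=> h; rewrite (disjointFl d).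
have ne u v : u \in X -> v \in Y -> (u == v = false) * (v == u = false).
  by move=> h1 h2; rewrite [v == u]eq_sym (negPf (disj_neq d h1 h2)).
have ba : (b == a) = false by rewrite eq_sym (negPf ab).
have yx : (y == x) = false by rewrite eq_sym (negPf xy).
have E1 := (ne _ _ aX xY, ne _ _ aX yY, ne _ _ bX xY, ne _ _ bX yY,
  negPf ab, negPf xy, ba, yx).
have E2 := (aX, bX, xY, yY, rY _ aX, rY _ bX, cX _ xY, cX _ yY, n1, n2, n3, n4).
split=> //; first by rewrite /ucycle /= /radj !E2 !inE !E1.
move=> u v; rewrite !inE => /or4P [] /eqP -> /or4P [] /eqP ->;
  by rewrite /radj /= !(E2, E1, eqxx).
Qed.

(** A 3 x 3 block with zeros exactly on its diagonal is K_{3,3} minus a perfect matching, which is a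
    hexagon. *)
Lemma induced6 X Y A r1 r2 r3 c1 c2 c3 : [disjoint X & Y] ->
  r1 \in X -> r2 \in X -> r3 \in X -> c1 \in Y -> c2 \in Y -> c3 \in Y ->
  A r1 c1 = 0 -> A r1 c2 != 0 -> A r1 c3 != 0 ->
  A r2 c1 != 0 -> A r2 c2 = 0 -> A r2 c3 != 0 ->
  A r3 c1 != 0 -> A r3 c2 != 0 -> A r3 c3 = 0 ->
  induced (radj X Y A) [:: r1; c2; r3; c1; r2; c3].
Proof.
move=> d r1X r2X r3X c1Y c2Y c3Y z11 n12 n13 n21 z22 n23 n31 n32 z33.
have rY u : u \in X -> (u \in Y) = false by move=> h; rewrite (disjointFr d).
have cX v : v \in Y -> (v \in X) = false by move=> h; rewrite (disjointFl d).
have ne u v : u \in X -> v \in Y -> (u == v = false) * (v == u = false).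
  by move=> h1 h2; rewrite [v == u]eq_sym (negPf (disj_neq d h1 h2)).
have nr u v w : A u w = 0 -> A v w != 0 -> (u == v = false) * (v == u = false).
  by move=> z n; rewrite [v == u]eq_sym; split; apply/negP => /eqP e; rewrite -e z eqxx in n.
have nc u v w : A w u = 0 -> A w v != 0 -> (u == v = false) * (v == u = false).
  by move=> z n; rewrite [v == u]eq_sym; split; apply/negP => /eqP e; rewrite -e z eqxx in n.
have E1 := (ne _ _ r1X c1Y, ne _ _ r1X c2Y, ne _ _ r1X c3Y,
  ne _ _ r2X c1Y, ne _ _ r2X c2Y, ne _ _ r2X c3Y,
  ne _ _ r3X c1Y, ne _ _ r3X c2Y, ne _ _ r3X c3Y).
have E3 := (nr _ _ _ z11 n21, nr _ _ _ z11 n31, nr _ _ _ z22 n32,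
  nc _ _ _ z11 n12, nc _ _ _ z11 n13, nc _ _ _ z22 n23).
have E2 := (r1X, r2X, r3X, c1Y, c2Y, c3Y, rY _ r1X, rY _ r2X, rY _ r3X,
  cX _ c1Y, cX _ c2Y, cX _ c3Y).
have E4 := (n12, n13, n21, n23, n31, n32, z11, z22, z33).
split=> //; first by rewrite /ucycle /= /radj !E2 !inE !E1 !E3 !E4.
move=> u v; rewrite !inE => hu hv.
have {hu} : u \in [:: r1; c2; r3; c1; r2; c3] by rewrite !inE.
have {hv} : v \in [:: r1; c2; r3; c1; r2; c3] by rewrite !inE.
rewrite !inE => /or4P [/eqP ->|/eqP ->|/eqP ->|/or3P [] /eqP ->];
  move=> /or4P [/eqP ->|/eqP ->|/eqP ->|/or3P [] /eqP ->];
  by rewrite /radj /= !(E2, E1, E3, E4, eqxx).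
Qed.

Lemma csig4 X Y A a b x y : [disjoint X & Y] -> a \in X -> b \in X ->
  x \in Y -> y \in Y -> uniq [:: a; x; b; y] ->
  A b x \is a GRing.unit -> A a y \is a GRing.unit ->
  csig X A [:: a; x; b; y] = cr A a b x y.
Proof.
move=> d aX bX xY yY u u1 u2; rewrite csig_cycprod //= mul1r mulr1.
rewrite /esig aX bX (disjointFl d xY) (disjointFl d yY) /cr invrM //; ring.
Qed.

(** The signature of the six-cycle in [induced6] without its sign, which is -1 since half the length
    is odd. *)
Definition hexagon A r1 r2 r3 c1 c2 c3 := A r1 c2 * (A r3 c2)^-1 * A r3 c1
  * (A r2 c1)^-1 * A r2 c3 * (A r1 c3)^-1.

Lemma csig6 X Y A r1 r2 r3 c1 c2 c3 : [disjoint X & Y] ->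
  r1 \in X -> r2 \in X -> r3 \in X -> c1 \in Y -> c2 \in Y -> c3 \in Y ->
  uniq [:: r1; c2; r3; c1; r2; c3] ->
  csig X A [:: r1; c2; r3; c1; r2; c3] = - hexagon A r1 r2 r3 c1 c2 c3.
Proof.
move=> d r1X r2X r3X c1Y c2Y c3Y u; rewrite csig_cycprod //= mulr1.
rewrite /esig r1X r2X r3X (disjointFl d c1Y) (disjointFl d c2Y) (disjointFl d c3Y).
by rewrite /hexagon; ring.
Qed.

Lemma cr_eq1 A a b x y : A a y \is a GRing.unit -> A b x \is a GRing.unit ->
  cr A a b x y = 1 -> A a x * A b y = A a y * A b x.
Proof.
by move=> u1 u2 h; rewrite -[RHS]mul1r -h /cr mulrVK // unitrM u1.
Qed.

(* All entries of column w being nonzero, cross ratios 1 mean that the six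
   entries of the hexagon can be scaled to 1. *)
Lemma hexagon1 A r1 r2 r3 c1 c2 c3 w :
  A r1 c2 \is a GRing.unit -> A r1 c3 \is a GRing.unit -> A r1 w \is a GRing.unit ->
  A r2 c1 \is a GRing.unit -> A r2 c3 \is a GRing.unit -> A r2 w \is a GRing.unit ->
  A r3 c1 \is a GRing.unit -> A r3 c2 \is a GRing.unit -> A r3 w \is a GRing.unit ->
  cr A r1 r2 c3 w = 1 -> cr A r1 r3 c2 w = 1 -> cr A r2 r3 c1 w = 1 ->
  hexagon A r1 r2 r3 c1 c2 c3 = 1.
Proof.
move=> u12 v13 u1 v21 u23 u2 u31 v32 u3 h1 h2 h3.
have e1 : A r1 c3 * A r2 w = A r1 w * A r2 c3 by apply: cr_eq1.
have e2 : A r1 c2 * A r3 w = A r1 w * A r3 c2 by apply: cr_eq1.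
have e3 : A r2 c1 * A r3 w = A r2 w * A r3 c1 by apply: cr_eq1.
have E1 : A r2 c3 = (A r1 w)^-1 * (A r1 c3 * A r2 w) by rewrite e1 mulKr.
have E2 : A r1 c2 = (A r3 w)^-1 * (A r1 w * A r3 c2) by rewrite -e2 mulrC mulrK.
have E3 : A r3 c1 = (A r2 w)^-1 * (A r2 c1 * A r3 w) by rewrite e3 mulKr.
rewrite /hexagon E1 E2 E3.
ring: (mulrV u1) (mulrV u2) (mulrV u3) (mulrV v13) (mulrV v32) (mulrV v21).
Qed.

Lemma cr_mul A a b x y z : A a x \is a GRing.unit -> A a y \is a GRing.unit ->
  A a z \is a GRing.unit -> A b x \is a GRing.unit -> A b y \is a GRing.unit ->
  A b z \is a GRing.unit ->
  cr A a b x y = cr A a b z y * (cr A a b z x)^-1.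
Proof.
move=> u1 u2 u3 u4 u5 u6.
rewrite /cr !invrM ?unitrM ?unitrV ?unitrM ?u1 ?u2 ?u3 ?u4 ?u5 ?u6 // ?invrK.
ring: (mulrV u1) (mulrV u2) (mulrV u3) (mulrV u4) (mulrV u5) (mulrV u6).
Qed.

End ShortCycles.

Section Obstructions.

Variables (P Ph : partial_field) (phi : Ph -> P) (up : P -> Ph) (E : finType).
Hypotheses (hphi : pf_hom phi) (hup : lifting_function phi up).
Implicit Types (A B : lmatrix P E) (Bh : lmatrix Ph E).

Notation S := (@inS P).
Notation Sh := (@inS Ph).
Notation f := (ring_rmorphism hphi hup).
Notation U := (ringU up).
Let HL := ring_lifting hphi hup.
Let HS := inS_pfset P.
Let HSh := inS_pfset Ph.

Lemma em_map Bh u v : em (map_lmx phi Bh) u v = f (em Bh u v).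
Proof. by rewrite /em /= [RHS](ring_hom_in hphi hup). Qed.

Lemma scaling_equivE A B : scaling_equiv A B <-> [/\ lrows B = lrows A,
  lcols B = lcols A & seqv S (lrows A) (lcols A) (em A) (em B)].
Proof.
split=> [[eX eY [r [c [hr hc h]]]]|[eX eY [r [c [hr hc h]]]]]; split=> //.
  exists (fun u => pfin (r u)), (fun v => pfin (c v)).
  split=> [u|v|u v uX vY]; [exact: pfin_su|exact: pfin_su|].
  by rewrite /em h // !pfinM.
exists (fun u => dn (r u)), (fun v => dn (c v)).
split=> [u|v|u v uX vY]; [exact: su_dn|exact: su_dn|].
apply: (@pfin_inj P); rewrite !pfinM !pfdnK; [exact: h|by case: (hc v)|by case: (hr u)].
Qed.

Lemma local_liftE B Bh : local_lift phi up B Bh -> [disjoint lrows B & lcols B] ->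
  [/\ lrows Bh = lrows B, lcols Bh = lcols B,
   forall u v, u \in lrows B -> v \in lcols B -> (em B u v == 0) = (em Bh u v == 0)
   & forall c, induced (radj (lrows B) (lcols B) (em B)) c ->
      U (csig (lrows B) (em B) c) = csig (lrows B) (em Bh) c].
Proof.
case=> _ /scaling_equivE [/= eX eY h] hc d.
have z u v : u \in lrows B -> v \in lcols B -> (em B u v == 0) = (em Bh u v == 0).
  rewrite eX eY => uX vY; rewrite (seqv_eq0 h) // em_map.
  by apply: (lif_eq0 HL); apply: pfin_inS.
split=> // c hi; have [_ /andP [cy uc] _] := hi.
have := hc c ((induced_cycleE B c).2 hi) => e.
rewrite -pfin_csig // ringU_in e eX -pfin_csig //.
by rewrite -eX -eY -(radj_zeros z).
Qed.

Lemma local_cr B Bh a b x y : local_lift phi up B Bh ->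
  [disjoint lrows B & lcols B] -> a \in lrows B -> b \in lrows B ->
  x \in lcols B -> y \in lcols B -> a != b -> x != y ->
  em B a x != 0 -> em B a y != 0 -> em B b x != 0 -> em B b y != 0 ->
  U (cr (em B) a b x y) = cr (em Bh) a b x y.
Proof.
move=> hl d aX bX xY yY ab xy n1 n2 n3 n4.
have [eX eY z h] := local_liftE hl d.
have hi := induced4 d aX bX xY yY ab xy n1 n2 n3 n4.
have [_ /andP [_ uc] _] := hi.
have Un u v : em B u v != 0 -> em B u v \is a GRing.unit.
  by apply: (psU HS); apply: pfin_inS.
have Unh u v : u \in lrows B -> v \in lcols B -> em B u v != 0 ->
    em Bh u v \is a GRing.unit.
  by move=> uX vY; rewrite z //; apply: (psU HSh); apply: pfin_inS.
have := h _ hi; rewrite !(csig4 d) //; by [apply: Un|apply: Unh].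
Qed.

Lemma local_hexagon B Bh r1 r2 r3 c1 c2 c3 : local_lift phi up B Bh ->
  [disjoint lrows B & lcols B] ->
  r1 \in lrows B -> r2 \in lrows B -> r3 \in lrows B ->
  c1 \in lcols B -> c2 \in lcols B -> c3 \in lcols B ->
  em B r1 c1 = 0 -> em B r1 c2 != 0 -> em B r1 c3 != 0 ->
  em B r2 c1 != 0 -> em B r2 c2 = 0 -> em B r2 c3 != 0 ->
  em B r3 c1 != 0 -> em B r3 c2 != 0 -> em B r3 c3 = 0 ->
  U (- hexagon (em B) r1 r2 r3 c1 c2 c3) = - hexagon (em Bh) r1 r2 r3 c1 c2 c3.
Proof.
move=> hl d r1X r2X r3X c1Y c2Y c3Y z11 n12 n13 n21 z22 n23 n31 n32 z33.
have [eX eY z h] := local_liftE hl d.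
have hi := induced6 d r1X r2X r3X c1Y c2Y c3Y z11 n12 n13 n21 z22 n23 n31 n32 z33.
have [_ /andP [_ uc] _] := hi.
by have := h _ hi; rewrite !(csig6 _ d).
Qed.

Lemma sub_scale A (X Y : {set E}) (r c : E -> pfring P) :
  X \subset lrows A -> Y \subset lcols A -> (forall u, su S (r u)) ->
  (forall v, su S (c v)) ->
  exists B, [/\ minor A B, lrows B = X, lcols B = Y &
    forall u v, em B u v = r u * em A u v * c v].
Proof.
move=> sX sY hr hc.
exists (LMatrix X Y (fun u v => pf_mul (pf_mul (dn (r u)) (A u v)) (dn (c v)))).
split=> // [|u v].
  apply: minor_trans (minor_scale A (r := fun u => dn (r u)) (c := fun v => dn (c v)) _ _) _.
  - by move=> u; apply: su_dn.
  - by move=> v; apply: su_dn.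
  exact: minor_agree.
rewrite /em /= !pfinM !pfdnK //; [by case: (hc v)|by case: (hr u)].
Qed.

Lemma set_nth_imset (x0 : E) (s : seq E) :
  [set u in s] = [set nth x0 s i | i : 'I_(size s)].
Proof.
apply/setP => u; rewrite inE; apply/idP/imsetP => [us|[i _ ->]]; last exact: mem_nth.
have iu : (index u s < size s)%N by rewrite index_mem.
by exists (Ordinal iu); rewrite //= nth_index.
Qed.

Lemma nth_ord_inj (x0 : E) (s : seq E) : uniq s ->
  injective (fun i : 'I_(size s) => nth x0 s i).
Proof. by move=> us i j /eqP; rewrite nth_uniq // => /eqP /val_inj. Qed.

Lemma displayed2 B a b z x y (p q : P) : uniq [:: a; b] -> uniq [:: z; x; y] ->
  lrows B = [set u in [:: a; b]] -> lcols B = [set v in [:: z; x; y]] ->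
  em B a z = 1 -> em B a x = 1 -> em B a y = 1 ->
  em B b z = 1 -> em B b x = pfin p -> em B b y = pfin q ->
  displayed_as B (obstruction2 p q).
Proof.
move=> u1 u2 eX eY h1 h2 h3 h4 h5 h6.
exists (fun i : 'I_(size [:: a; b]) => nth a [:: a; b] i),
  (fun j : 'I_(size [:: z; x; y]) => nth z [:: z; x; y] j).
split; [exact: (nth_ord_inj (x0 := a) u1)|exact: (nth_ord_inj (x0 := z) u2)| | |].
- by rewrite eX; apply: (set_nth_imset a [:: a; b]).
- by rewrite eY; apply: (set_nth_imset z [:: z; x; y]).
move=> [[|[|i]] hi] [[|[|[|j]]] hj] //; rewrite /obstruction2 /seqs_mx mxE /=;
  exact: pfin_inj.
Qed.

Lemma displayed1 B a b c x1 x2 x3 w : uniq [:: a; b; c] -> uniq [:: x1; x2; x3; w] ->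
  lrows B = [set u in [:: a; b; c]] -> lcols B = [set v in [:: x1; x2; x3; w]] ->
  em B a x1 = 0 -> em B a x2 = 1 -> em B a x3 = 1 -> em B a w = 1 ->
  em B b x1 = 1 -> em B b x2 = 0 -> em B b x3 = 1 -> em B b w = 1 ->
  em B c x1 = 1 -> em B c x2 = 1 -> em B c x3 = 0 -> em B c w = 1 ->
  displayed_as B (obstruction1 P).
Proof.
move=> u1 u2 eX eY h1 h2 h3 h4 h5 h6 h7 h8 h9 h10 h11 h12.
exists (fun i : 'I_(size [:: a; b; c]) => nth a [:: a; b; c] i),
  (fun j : 'I_(size [:: x1; x2; x3; w]) => nth w [:: x1; x2; x3; w] j).
split; [exact: (nth_ord_inj (x0 := a) u1)|exact: (nth_ord_inj (x0 := w) u2)| | |].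
- by rewrite eX; apply: (set_nth_imset a [:: a; b; c]).
- by rewrite eY; apply: (set_nth_imset w [:: x1; x2; x3; w]).
have p0 : pfin (pf_zero : P) = 0 := pfin0 P.
move=> [[|[|[|i]]] hi] [[|[|[|[|j]]]] hj] //; rewrite /obstruction1 /seqs_mx mxE /=; apply: pfin_inj;
  by rewrite ?p0 //; assumption.
Qed.

End Obstructions.

Section Normalize.

Variables (R Rh : comUnitRingType) (S : R -> Prop) (Sh : Rh -> Prop).
Variables (f : {rmorphism Rh -> R}) (U : R -> Rh) (E : finType).
Hypothesis HL : lifting S Sh f U.
Implicit Types (M N : E -> E -> R) (X Y : {set E}) (a b x y : E).

Let HS := lif_S HL.
Let HSh := lif_Sh HL.

Definition scaled M N := exists r c : E -> R,
  [/\ forall u, su S (r u), forall v, su S (c v)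
    & forall u v, N u v = r u * M u v * c v].

Lemma scaled_seqv X Y M N : scaled M N -> seqv S X Y M N.
Proof. by case=> r [c [hr hc h]]; exists r, c; split=> // u v _ _; apply: h. Qed.

Lemma unit_U p : fund S p -> p != 0 -> U p \is a GRing.unit.
Proof.
move=> fp n; have Sp := lif_U HL fp; apply: (psU HSh) => //.
by rewrite -(lif_eq0 HL) // (lif_fU HL).
Qed.

(** If p = 1, q = 1 or p = q, the law follows from U 1 = 1 and the inverse rule. Otherwise the
    submatrix scales to rows (1, 1, 1) and (1, p, q), and its lift [Nh] proves the law because cross
    ratios multiply in [Nh]. Keeping [Nh] abstract lets one argument serve a matrix and its
    transpose. *)
Lemma quotient_law_normal X Y M : hereditary (@entin _ S E) X Y M ->
  (forall a b x y z p q N, a \in X -> b \in X -> x \in Y -> y \in Y -> z \in Y ->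
    uniq [:: a; b] -> uniq [:: z; x; y] -> scaled M N ->
    fund S p -> fund S q -> p != 0 -> p != 1 -> q != 0 -> q != 1 -> p != q ->
    N a z = 1 -> N a x = 1 -> N a y = 1 -> N b z = 1 -> N b x = p -> N b y = q ->
    exists Nh : E -> E -> Rh,
    [/\ forall u v, u \in [:: a; b] -> v \in [:: z; x; y] -> Nh u v \is a GRing.unit
      & forall v w, v \in [:: z; x; y] -> w \in [:: z; x; y] -> v != w ->
        U (cr N a b v w) = cr Nh a b v w]) ->
  quotient_law U X Y M.
Proof.
move=> hM hN a b x y z aX bX xY yY zY n1 n2 n3 n4 n5 n6.
have hS := hereditary_now hM.
have Un u v : u \in X -> v \in Y -> M u v != 0 -> M u v \is a GRing.unit.
  by move=> uX vY; apply: (psU HS); apply: hS.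
have Us u v : u \in X -> v \in Y -> M u v != 0 -> su S (M u v).
  by move=> uX vY n; split; [apply: hS|apply: Un].
have [u1 u2 u3] := And3 (Un a x aX xY n1) (Un a y aX yY n2) (Un a z aX zY n3).
have [u4 u5 u6] := And3 (Un b x bX xY n4) (Un b y bX yY n5) (Un b z bX zY n6).
have crU v w : M a v \is a GRing.unit -> M b v \is a GRing.unit ->
    M a w \is a GRing.unit -> M b w \is a GRing.unit -> cr M a b v w != 0.
  move=> w1 w2 w3 w4; apply: contraTneq (oner_neq0 R) => e; rewrite negbK; apply/eqP.
  have : cr M a b v w \is a GRing.unit by rewrite /cr !(unitrM, unitrV) w1 w2 w3 w4.
  by rewrite e unitr0.
set p := cr M a b z x; set q := cr M a b z y.
have p0 : p != 0 by apply: crU.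
have q0 : q != 0 by apply: crU.
have fp : fund S p by apply: (hereditary_fund HS hM).
have fq : fund S q by apply: (hereditary_fund HS hM).
have U1 := lif_U1 HL.
have [p1|p1] := eqVneq p 1; first by rewrite p1 invr1 !mulr1 U1 invr1 mulr1.
have [q1|q1] := eqVneq q 1; first by rewrite q1 !mul1r U1 mul1r (lif_V HL).
have [pq|pq] := eqVneq p q.
  by rewrite pq !mulrV ?U1 ?unit_U //; apply: (psU HS) => //; case: fq.
have crr v : M a v \is a GRing.unit -> M b v \is a GRing.unit -> cr M a b v v = 1.
  by move=> w1 w2; rewrite /cr mulrV // unitrM w1.
have ab : a != b.
  apply: contraNneq p1 => e; rewrite /p /cr -e [M a x * _]mulrC mulrV // unitrM u3.
  by rewrite u1.
have zx : z != x by apply: contraNneq p1 => e; rewrite /p -e crr.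
have zy : z != y by apply: contraNneq q1 => e; rewrite /q -e crr.
have xy : x != y by apply: contraNneq pq => e; rewrite /p /q e.
pose r u := if u == a then 1 else M a z * (M b z)^-1.
pose c v := if v \in [:: z; x; y] then (M a v)^-1 else 1.
pose N u v := r u * M u v * c v.
have rS u : su S (r u).
  rewrite /r; case: eqP => _; first exact: (su1 HS).
  by apply: (suM HS); [|apply: (suV HS)]; apply: Us.
have cS v : su S (c v).
  rewrite /c; case: ifP; last by move=> _; apply: (su1 HS).
  rewrite !inE => /or3P [] /eqP ->; apply: (suV HS); exact: Us.
have [cz cx cy] : [/\ c z = (M a z)^-1, c x = (M a x)^-1 & c y = (M a y)^-1].
  by rewrite /c !inE !eqxx ?orbT.
have ra : r a = 1 by rewrite /r eqxx.
have rb : r b = M a z * (M b z)^-1 by rewrite /r eq_sym (negPf ab).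
have sMN : scaled M N by exists r, c; split.
have uab : uniq [:: a; b] by rewrite /= inE ab.
have uzxy : uniq [:: z; x; y] by rewrite /= !inE negb_or zx zy xy.
have [||||||Nh [hu h]] := hN a b x y z p q N aX bX xY yY zY uab uzxy sMN fp fq p0 p1 q0 q1 pq.
- by rewrite /N ra cz mul1r mulrV.
- by rewrite /N ra cx mul1r mulrV.
- by rewrite /N ra cy mul1r mulrV.
- by rewrite /N rb cz mulrVK // mulrV.
- by rewrite /N rb cx /p /cr invrM //; ring.
- by rewrite /N rb cy /q /cr invrM //; ring.
have crN v w : v \in Y -> w \in Y -> M a w != 0 -> M b v != 0 ->
    cr N a b v w = cr M a b v w.
  move=> vY wY m1 m2; have sq : seqv S X Y M N by apply: scaled_seqv.
  exact: (cr_seqv HS sq hS).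
have [mz mx my] : [/\ z \in [:: z; x; y], x \in [:: z; x; y] & y \in [:: z; x; y]].
  by rewrite !inE !eqxx ?orbT.
have [ma mb] : a \in [:: a; b] /\ b \in [:: a; b] by rewrite !inE !eqxx ?orbT.
have := h x y mx my xy; rewrite crN // (cr_mul u1 u2 u3 u4 u5 u6) -/p -/q => ->.
have := h z x mz mx zx; rewrite crN // -/p => ->.
have := h z y mz my zy; rewrite crN // -/q => ->.
by apply: cr_mul; apply: hu.
Qed.

(** After scaling to zeros and ones, the lift [Nh] has the three cross ratios U 1 = 1, so by
    [hexagon1] its hexagon is 1. The signature of the hexagon downstairs is -1, and comparing the
    two gives U(-1) = -1. *)
Lemma minus_one_law_normal X Y M : entin S X Y M ->
  (forall a b c x1 x2 x3 w N, a \in X -> b \in X -> c \in X ->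
    x1 \in Y -> x2 \in Y -> x3 \in Y -> w \in Y ->
    uniq [:: a; b; c] -> uniq [:: x1; x2; x3; w] -> scaled M N ->
    N a x1 = 0 -> N a x2 = 1 -> N a x3 = 1 -> N a w = 1 ->
    N b x1 = 1 -> N b x2 = 0 -> N b x3 = 1 -> N b w = 1 ->
    N c x1 = 1 -> N c x2 = 1 -> N c x3 = 0 -> N c w = 1 ->
    exists Nh : E -> E -> Rh,
    [/\ forall u v, u \in [:: a; b; c] -> v \in [:: x1; x2; x3; w] ->
          N u v != 0 -> Nh u v \is a GRing.unit,
        [/\ U (cr N a b x3 w) = cr Nh a b x3 w,
            U (cr N a c x2 w) = cr Nh a c x2 w
          & U (cr N b c x1 w) = cr Nh b c x1 w]
      & U (- hexagon N a b c x1 x2 x3) = - hexagon Nh a b c x1 x2 x3]) ->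
  minus_one_law U X Y M.
Proof.
move=> hS hN a b c x1 x2 x3 w aX bX cX x1Y x2Y x3Y wY.
move=> z11 n12 n13 n1w n21 z22 n23 n2w n31 n32 z33 n3w h1 h2 h3.
have Un u v : u \in X -> v \in Y -> M u v != 0 -> M u v \is a GRing.unit.
  by move=> uX vY; apply: (psU HS); apply: hS.
have Us u v : u \in X -> v \in Y -> M u v != 0 -> su S (M u v).
  by move=> uX vY n; split; [apply: hS|apply: Un].
have [u12 u13 u1w] := And3 (Un _ _ aX x2Y n12) (Un _ _ aX x3Y n13) (Un _ _ aX wY n1w).
have [u21 u23 u2w] := And3 (Un _ _ bX x1Y n21) (Un _ _ bX x3Y n23) (Un _ _ bX wY n2w).
have [u31 u32 u3w] := And3 (Un _ _ cX x1Y n31) (Un _ _ cX x2Y n32) (Un _ _ cX wY n3w).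
have nr u v t : M u t = 0 -> M v t != 0 -> u != v.
  by move=> z; apply: contraNneq => <-; rewrite z.
have nc u v t : M t u = 0 -> M t v != 0 -> u != v.
  by move=> z; apply: contraNneq => <-; rewrite z.
have uabc : uniq [:: a; b; c].
  by rewrite /= !inE negb_or (nr _ _ _ z11 n21) (nr _ _ _ z11 n31) (nr _ _ _ z22 n32).
have [x12 x13 x1w] := And3 (nc _ _ _ z11 n12) (nc _ _ _ z11 n13) (nc _ _ _ z11 n1w).
have [x23 x2w x3w] := And3 (nc _ _ _ z22 n23) (nc _ _ _ z22 n2w) (nc _ _ _ z33 n3w).
have ux : uniq [:: x1; x2; x3; w].
  by rewrite /= !inE !negb_or x12 x13 x1w x23 x2w x3w.
pose r u := if u \in [:: a; b; c] then (M u w)^-1 else 1.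
(* Row factors make column w all ones; each column factor then normalizes one chosen entry, in row b
   for x1 and in row a for x2 and x3. The unit cross ratios force the other nonzero entries to be 1
   as well. *)
pose k v := if v == x1 then M b w * (M b x1)^-1 else if v == x2 then M a w * (M a x2)^-1
  else if v == x3 then M a w * (M a x3)^-1 else 1.
pose N u v := r u * M u v * k v.
have rS u : su S (r u).
  rewrite /r; case: ifP; last by move=> _; apply: (su1 HS).
  rewrite !inE => /or3P [] /eqP ->; apply: (suV HS); exact: Us.
have kS v : su S (k v).
  rewrite /k; do ?[case: ifP => _]; try exact: (su1 HS);
    by apply: (suM HS); [|apply: (suV HS)]; apply: Us.
have [ra rb rc] : [/\ r a = (M a w)^-1, r b = (M b w)^-1 & r c = (M c w)^-1].
  by rewrite /r !inE !eqxx ?orbT.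
have k1 : k x1 = M b w * (M b x1)^-1 by rewrite /k eqxx.
have k2 : k x2 = M a w * (M a x2)^-1 by rewrite /k eq_sym (negPf x12) eqxx.
have k3 : k x3 = M a w * (M a x3)^-1.
  by rewrite /k [x3 == x1]eq_sym [x3 == x2]eq_sym (negPf x13) (negPf x23) eqxx.
have kw : k w = 1.
  rewrite /k [w == x1]eq_sym [w == x2]eq_sym [w == x3]eq_sym.
  by rewrite (negPf x1w) (negPf x2w) (negPf x3w).
have e1 : M a x3 * M b w = M a w * M b x3 by apply: cr_eq1.
have e2 : M a x2 * M c w = M a w * M c x2 by apply: cr_eq1.
have e3 : M b x1 * M c w = M b w * M c x1 by apply: cr_eq1.
have sMN : scaled M N by exists r, k; split.
have N11 : N a x1 = 0 by rewrite /N z11 mulr0 mul0r.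
have N12 : N a x2 = 1 by rewrite /N ra k2; ring: (mulrV u12) (mulrV u1w).
have N13 : N a x3 = 1 by rewrite /N ra k3; ring: (mulrV u13) (mulrV u1w).
have N1w : N a w = 1 by rewrite /N ra kw mulVr ?mulr1.
have N21 : N b x1 = 1 by rewrite /N rb k1; ring: (mulrV u21) (mulrV u2w).
have N22 : N b x2 = 0 by rewrite /N z22 mulr0 mul0r.
have N23 : N b x3 = 1.
  rewrite /N rb k3 (_ : _ * _ = (M b w)^-1 * (M a w * M b x3) * (M a x3)^-1); last by ring.
  by rewrite -e1; ring: (mulrV u13) (mulrV u2w).
have N2w : N b w = 1 by rewrite /N rb kw mulVr ?mulr1.
have N31 : N c x1 = 1.
  rewrite /N rc k1 (_ : _ * _ = (M c w)^-1 * (M b w * M c x1) * (M b x1)^-1); last by ring.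
  by rewrite -e3; ring: (mulrV u21) (mulrV u3w).
have N32 : N c x2 = 1.
  rewrite /N rc k2 (_ : _ * _ = (M c w)^-1 * (M a w * M c x2) * (M a x2)^-1); last by ring.
  by rewrite -e2; ring: (mulrV u12) (mulrV u3w).
have N33 : N c x3 = 0 by rewrite /N z33 mulr0 mul0r.
have N3w : N c w = 1 by rewrite /N rc kw mulVr ?mulr1.
have [Nh [hu [g1 g2 g3] g]] := hN a b c x1 x2 x3 w N aX bX cX x1Y x2Y x3Y wY uabc ux sMN
  N11 N12 N13 N1w N21 N22 N23 N2w N31 N32 N33 N3w.
have U1 := lif_U1 HL.
move: g1 g2 g3 g; rewrite /cr /hexagon N12 N13 N1w N21 N23 N2w N31 N32 N3w.
rewrite !(mulr1, invr1) U1 => g1 g2 g3 ->; congr (- _).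
have [ma mb mc] : [/\ a \in [:: a; b; c], b \in [:: a; b; c] & c \in [:: a; b; c]].
  by rewrite !inE !eqxx ?orbT.
have [m1 m2 m3 mw] : [/\ x1 \in [:: x1; x2; x3; w], x2 \in [:: x1; x2; x3; w],
    x3 \in [:: x1; x2; x3; w] & w \in [:: x1; x2; x3; w]].
  by rewrite !inE !eqxx ?orbT.
have n1 : (1 : R) != 0 by apply: oner_neq0.
apply: (@hexagon1 _ _ Nh a b c x1 x2 x3 w) => //; apply: hu => //;
  by rewrite ?N12 ?N13 ?N1w ?N21 ?N23 ?N2w ?N31 ?N32 ?N3w.
Qed.

End Normalize.

Section Unobstructed.

Variables (P Ph : partial_field) (phi : Ph -> P) (up : P -> Ph) (E : finType).
Hypotheses (hphi : pf_hom phi) (hup : lifting_function phi up).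
Implicit Types (A B : lmatrix P E) (Bh : lmatrix Ph E).

Notation S := (@inS P).
Notation Sh := (@inS Ph).
Notation f := (ring_rmorphism hphi hup).
Notation U := (ringU up).
Let HL := ring_lifting hphi hup.
Let HS := inS_pfset P.
Let HSh := inS_pfset Ph.

Definition unobstructed A := forall B, minor A B ->
  is_obstruction B \/ is_obstruction (ltr B) -> has_local_lift phi up B.

Lemma local_unit B Bh u v : local_lift phi up B Bh -> [disjoint lrows B & lcols B] ->
  u \in lrows B -> v \in lcols B -> em B u v != 0 -> em Bh u v \is a GRing.unit.
Proof.
move=> hl d uX vY n; have [_ _ z _] := local_liftE hphi hup hl d.
by apply: (psU HSh); [apply: pfin_inS|rewrite -z].
Qed.

Lemma hereditary_emtr A : hereditary (@entin _ S E) (lrows A) (lcols A) (em A) ->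
  hereditary (@entin _ S E) (lcols A) (lrows A) (fun u v => em A v u).
Proof.
apply: (hereditary_tr HS); [exact: entin_seqv|exact: entin_tr].
Qed.

Lemma one_neq0 : (1 : pfring P) != 0. Proof. exact: oner_neq0. Qed.

Lemma obstruction2_dn (p q : pfring P) : fund S p -> fund S q -> p != 0 -> p != 1 ->
  q != 0 -> q != 1 -> p != q ->
  [/\ fundamental (dn p), fundamental (dn q), dn p \notin [:: pf_zero; pf_one],
      dn q \notin [:: pf_zero; pf_one] & dn p != dn q].
Proof.
move=> fp fq p0 p1 q0 q1 pq; have [Sp Sq] := (fp.1, fq.1).
have e (r t : P) : (r == t) = (pfin r == pfin t) by rewrite (inj_eq (@pfin_inj P)).
split; rewrite ?inE ?negb_or ?e ?pfdnK ?pfin0 ?pfin1 ?p0 ?p1 ?q0 ?q1 //;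
  by apply/fundP; rewrite pfdnK.
Qed.

Lemma unobstructed_O2 A : hereditary (@entin _ S E) (lrows A) (lcols A) (em A) ->
  unobstructed A -> quotient_law U (lrows A) (lcols A) (em A).
Proof.
move=> hA hU; apply: (quotient_law_normal HL hA).
move=> a b x y z p q N aX bX xY yY zY u1 u2 [r [c [hr hc hN]]] fp fq p0 p1 q0 q1 pq.
move=> e1 e2 e3 e4 e5 e6.
have sX : [set u in [:: a; b]] \subset lrows A.
  by apply/subsetP => u; rewrite !inE => /orP [] /eqP ->.
have sY : [set v in [:: z; x; y]] \subset lcols A.
  by apply/subsetP => v; rewrite !inE => /or3P [] /eqP ->.
have [B [m eX eY hB]] := sub_scale sX sY hr hc.
have eB u v : em B u v = N u v by rewrite hB hN.
have [|Bh hl] := hU B m.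
  left; right; exists (dn p), (dn q); split; first exact: obstruction2_dn.
  by apply: (displayed2 u1 u2 eX eY); rewrite eB ?pfdnK //; [case: fp|case: fq].
have dB := minor_disj (hereditary_disj hA) m.
have nz u v : u \in [:: a; b] -> v \in [:: z; x; y] -> em B u v != 0.
  rewrite !inE => /orP [] /eqP -> /or3P [] /eqP ->;
    by rewrite eB ?(e1, e2, e3, e4, e5, e6) ?one_neq0.
have rB u : u \in [:: a; b] -> u \in lrows B by move=> h; rewrite eX inE.
have cB v : v \in [:: z; x; y] -> v \in lcols B by move=> h; rewrite eY inE.
have [ma mb] : a \in [:: a; b] /\ b \in [:: a; b] by rewrite !inE !eqxx ?orbT.
have ab : a != b by move: u1; rewrite /= inE => /andP [].
exists (em Bh); split=> [u v um vm|v w vm wm vw].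
  by apply: (local_unit hl) => //; [apply: rB|apply: cB|apply: nz].
rewrite -(local_cr hphi hup hl dB (rB _ ma) (rB _ mb) (cB _ vm) (cB _ wm)) ?nz //.
by rewrite /cr !eB.
Qed.

Lemma unobstructed_O2tr A : hereditary (@entin _ S E) (lrows A) (lcols A) (em A) ->
  unobstructed A -> quotient_law U (lcols A) (lrows A) (fun u v => em A v u).
Proof.
move=> hA hU; apply: (quotient_law_normal HL (hereditary_emtr hA)).
move=> a b x y z p q N aX bX xY yY zY u1 u2 [r [c [hr hc hN]]] fp fq p0 p1 q0 q1 pq.
move=> e1 e2 e3 e4 e5 e6.
have sX : [set u in [:: a; b]] \subset lcols A.
  by apply/subsetP => u; rewrite !inE => /orP [] /eqP ->.
have sY : [set v in [:: z; x; y]] \subset lrows A.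
  by apply/subsetP => v; rewrite !inE => /or3P [] /eqP ->.
have [B [m eY eX hB]] := sub_scale sY sX hc hr.
have eB u v : em B v u = N u v by rewrite hB hN; ring.
have [|Bh hl] := hU B m.
  right; right; exists (dn p), (dn q); split; first exact: obstruction2_dn.
  apply: (@displayed2 _ _ (ltr B) a b z x y) => //;
    rewrite -[LHS]/(em B _ _) eB ?pfdnK //; by [case: fp|case: fq].
have dB := minor_disj (hereditary_disj hA) m.
have nz u v : u \in [:: a; b] -> v \in [:: z; x; y] -> em B v u != 0.
  rewrite !inE => /orP [] /eqP -> /or3P [] /eqP ->;
    by rewrite eB ?(e1, e2, e3, e4, e5, e6) ?one_neq0.
have rB u : u \in [:: a; b] -> u \in lcols B by move=> h; rewrite eX inE.
have cB v : v \in [:: z; x; y] -> v \in lrows B by move=> h; rewrite eY inE.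
have [ma mb] : a \in [:: a; b] /\ b \in [:: a; b] by rewrite !inE !eqxx ?orbT.
have ab : a != b by move: u1; rewrite /= inE => /andP [].
exists (fun u v => em Bh v u); split=> [u v um vm|v w vm wm vw].
  by apply: (local_unit hl) => //; [apply: cB|apply: rB|apply: nz].
rewrite [RHS]crtr -(local_cr hphi hup hl dB (cB _ vm) (cB _ wm) (rB _ ma) (rB _ mb)) ?nz //.
by congr U; rewrite -[RHS]crtr /cr !eB.
Qed.

Lemma unobstructed_O1 A : hereditary (@entin _ S E) (lrows A) (lcols A) (em A) ->
  unobstructed A -> minus_one_law U (lrows A) (lcols A) (em A).
Proof.
move=> hA hU; apply: (minus_one_law_normal HL (hereditary_now hA)).
move=> a b c x1 x2 x3 w N aX bX cX x1Y x2Y x3Y wY u1 u2 [r [k [hr hk hN]]].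
move=> e11 e12 e13 e1w e21 e22 e23 e2w e31 e32 e33 e3w.
have sX : [set u in [:: a; b; c]] \subset lrows A.
  by apply/subsetP => u; rewrite !inE => /or3P [] /eqP ->.
have sY : [set v in [:: x1; x2; x3; w]] \subset lcols A.
  by apply/subsetP => v; rewrite !inE => /or4P [] /eqP ->.
have [B [m eX eY hB]] := sub_scale sX sY hr hk.
have eB u v : em B u v = N u v by rewrite hB hN.
have [|Bh hl] := hU B m.
  by left; left; apply: (displayed1 u1 u2 eX eY); rewrite eB.
have dB := minor_disj (hereditary_disj hA) m.
have [ma mb mc] : [/\ a \in lrows B, b \in lrows B & c \in lrows B].
  by rewrite eX !inE !eqxx ?orbT.
have [m1 m2 m3 mw] : [/\ x1 \in lcols B, x2 \in lcols B, x3 \in lcols B & w \in lcols B].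
  by rewrite eY !inE !eqxx ?orbT.
have [ab ac bc] : [/\ a != b, a != c & b != c].
  by move: u1; rewrite /= !inE negb_or => /andP [/andP [-> ->] /andP [-> _]].
have [x1w x2w x3w] : [/\ x1 != w, x2 != w & x3 != w].
  move: u2; rewrite /= !inE !negb_or.
  by move=> /andP [/and3P [_ _ ->]] /andP [/andP [_ ->]] /andP [->].
have cE u v t s : cr N u v t s = cr (em B) u v t s by rewrite /cr !eB.
have n1 := one_neq0.
exists (em Bh); split=> [u v um vm n||].
- by apply: (local_unit hl) => //; rewrite ?eB // ?eX ?eY inE.
- split; rewrite cE; apply: (local_cr hphi hup hl dB) => //;
    by rewrite eB ?(e12, e13, e1w, e21, e23, e2w, e31, e32, e3w).
rewrite (_ : hexagon N _ _ _ _ _ _ = hexagon (em B) a b c x1 x2 x3); last first.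
  by rewrite /hexagon !eB.
by apply: (local_hexagon hphi hup hl dB) => //;
  rewrite eB ?(e12, e13, e1w, e21, e23, e2w, e31, e32, e3w).
Qed.

Lemma unobstructed_O1tr A : hereditary (@entin _ S E) (lrows A) (lcols A) (em A) ->
  unobstructed A -> minus_one_law U (lcols A) (lrows A) (fun u v => em A v u).
Proof.
move=> hA hU; apply: (minus_one_law_normal HL (hereditary_now (hereditary_emtr hA))).
move=> a b c x1 x2 x3 w N aX bX cX x1Y x2Y x3Y wY u1 u2 [r [k [hr hk hN]]].
move=> e11 e12 e13 e1w e21 e22 e23 e2w e31 e32 e33 e3w.
have sX : [set u in [:: a; b; c]] \subset lcols A.
  by apply/subsetP => u; rewrite !inE => /or3P [] /eqP ->.
have sY : [set v in [:: x1; x2; x3; w]] \subset lrows A.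
  by apply/subsetP => v; rewrite !inE => /or4P [] /eqP ->.
have [B [m eY eX hB]] := sub_scale sY sX hk hr.
have eB u v : em B v u = N u v by rewrite hB hN; ring.
have [|Bh hl] := hU B m.
  right; left; apply: (@displayed1 _ _ (ltr B) a b c x1 x2 x3 w) => //;
    by rewrite -[LHS]/(em B _ _) eB.
have dB := minor_disj (hereditary_disj hA) m.
have [ma mb mc] : [/\ a \in lcols B, b \in lcols B & c \in lcols B].
  by rewrite eX !inE !eqxx ?orbT.
have [m1 m2 m3 mw] : [/\ x1 \in lrows B, x2 \in lrows B, x3 \in lrows B & w \in lrows B].
  by rewrite eY !inE !eqxx ?orbT.
have [ab ac bc] : [/\ a != b, a != c & b != c].
  by move: u1; rewrite /= !inE negb_or => /andP [/andP [-> ->] /andP [-> _]].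
have [x1w x2w x3w] : [/\ x1 != w, x2 != w & x3 != w].
  move: u2; rewrite /= !inE !negb_or.
  by move=> /andP [/and3P [_ _ ->]] /andP [/andP [_ ->]] /andP [->].
have cE u v t s : cr N u v t s = cr (em B) t s u v by rewrite -crtr /cr !eB.
have n1 := one_neq0.
exists (fun u v => em Bh v u); split=> [u v um vm n||].
- by apply: (local_unit hl) => //; rewrite ?eB // ?eX ?eY inE.
- split; rewrite cE [RHS]crtr; apply: (local_cr hphi hup hl dB) => //;
    by rewrite eB ?(e12, e13, e1w, e21, e23, e2w, e31, e32, e3w).
(* Transposing with the indices in order would run around the hexagon the other way and invert the
   product; exchanging the second and third index restores the direction. *)
rewrite (_ : hexagon N _ _ _ _ _ _ = hexagon (em B) x1 x3 x2 a c b); last first.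
  by rewrite /hexagon !eB; ring.
rewrite (local_hexagon hphi hup hl dB) //;
  rewrite ?eB ?(e12, e13, e1w, e21, e23, e2w, e31, e32, e3w) //.
by rewrite /hexagon; ring.
Qed.

Lemma pmatrix_her A : [disjoint lrows A & lcols A] -> pmatrix A ->
  hereditary (@entin _ S E) (lrows A) (lcols A) (em A).
Proof. by move=> d /pmatrix_dets; apply: dets_her. Qed.

Lemma hereditary_pmatrix A : hereditary (@entin _ S E) (lrows A) (lcols A) (em A) -> pmatrix A.
Proof. by move=> /(hereditary_dets HS) /pmatrix_dets. Qed.

(** By [minor_reach] every state agrees on its labels with a matrix strongly equivalent to [A], so
    such matrices are all that has to be checked. *)
Lemma hereditary_minor_reach (Q : mprop (pfring P) E) A : seqv_closed S Q ->
  hereditary (@entin _ S E) (lrows A) (lcols A) (em A) ->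
  (forall A', minor A A' -> minor A' A ->
    hereditary (@entin _ S E) (lrows A') (lcols A') (em A') -> Q (lrows A') (lcols A') (em A')) ->
  hereditary Q (lrows A) (lcols A) (em A).
Proof.
move=> hQ hA h; split; first exact: hereditary_disj hA.
move=> X' Y' M' r; have [A' [m m' eX eY e]] := minor_reach hA r.
have hr := hereditary_reach hA r.
have e1 : seqv S X' Y' (em A') M'.
  by apply: (seqv_agree HS) => u v uX vY; rewrite e.
have e2 : seqv S X' Y' M' (em A') by apply: (seqv_agree HS) => u v; apply: e.
apply: (hQ _ _ _ _ e1); rewrite -eX -eY; apply: h => //.
by rewrite eX eY; apply: (hereditary_seqv HS _ e2 hr); apply: entin_seqv.
Qed.

Lemma unobstructed_ofree A : [disjoint lrows A & lcols A] -> pmatrix A ->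
  unobstructed A -> obstruction_free S U (lrows A) (lcols A) (em A).
Proof.
move=> d hA hU; have h := pmatrix_her d hA.
apply: (hereditary_minor_reach (@lift_laws_seqv _ _ _ _ _ _ _ HL) h) => A' m _ h'.
have hU' : unobstructed A' by move=> B m' ; apply: hU; apply: minor_trans m'.
split; first exact: em_inS.
split; [exact: unobstructed_O2|exact: unobstructed_O2tr|exact: unobstructed_O1|].
exact: unobstructed_O1tr.
Qed.

End Unobstructed.

(** * Global lifts *)

Section GlobalLifts.

Variables (P Ph : partial_field) (phi : Ph -> P) (up : P -> Ph) (E : finType).
Hypotheses (hphi : pf_hom phi) (hup : lifting_function phi up).
Implicit Types (A B : lmatrix P E) (Ah Bh : lmatrix Ph E) (M : E -> E -> pfring Ph).

Notation S := (@inS P).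
Notation Sh := (@inS Ph).
Notation f := (ring_rmorphism hphi hup).
Notation U := (ringU up).
Notation global := (global Sh f U).
Notation liftable := (liftable S Sh f U).
Let HL := ring_lifting hphi hup.
Let HS := inS_pfset P.
Let HSh := inS_pfset Ph.

Lemma em_map_fmx Bh : em (map_lmx phi Bh) = map_entries f (em Bh).
Proof. by apply/funext => u; apply/funext => v; apply: em_map. Qed.

(** The determinants of [Bh] are defined since no pivot leaves the partial field. The cycle
    condition is [global_csig], combined with the invariance of signatures under scaling. *)
Lemma local_of_glob B Bh : lrows Bh = lrows B -> lcols Bh = lcols B ->
  global (lrows B) (lcols B) (em Bh) ->
  seqv S (lrows B) (lcols B) (map_entries f (em Bh)) (em B) -> local_lift phi up B Bh.
Proof.
move=> eX eY hg h; have d := hereditary_disj hg.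
split; first by apply: hereditary_pmatrix; rewrite eX eY; apply: global_entin hg.
  by apply/scaling_equivE; rewrite /= eX eY em_map_fmx.
move=> c /induced_cycleE hi.
have z u v : u \in lrows B -> v \in lcols B -> (em B u v == 0) = (em Bh u v == 0).
  by move=> uX vY; rewrite (seqv_eq0 h) // /map_entries (lif_eq0 HL) //; apply: pfin_inS.
have eR := radj_zeros z.
have [_ /andP [cy uc] _] := hi; have hih := hi; rewrite eR in hih.
have cyh : path.cycle (radj (lrows B) (lcols B) (em Bh)) c by rewrite -eR.
have cyf : path.cycle (radj (lrows B) (lcols B) (map_entries f (em Bh))) c.
  rewrite -(@radj_zeros _ _ _ _ _ (em B)) // => u v uX vY.
  by rewrite (seqv_eq0 h).
apply: (@pfin_inj Ph); rewrite -ringU_in pfin_csig // pfin_csig ?eX ?eY //.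
have fS : entin S (lrows B) (lcols B) (map_entries f (em Bh)).
  by move=> u v _ _; apply: (lif_f HL); apply: pfin_inS.
rewrite (csig_seqv HS d fS h cyf uc) -(f_csig HL d _ cyh uc); last exact: em_inS.
by have [_ _] := global_csig HL hg hih.
Qed.

Definition descend (X Y : {set E}) M : lmatrix Ph E := LMatrix X Y (fun u v => dn (M u v)).

Lemma descend_seqv X Y M : entin Sh X Y M -> seqv Sh X Y M (em (descend X Y M)).
Proof.
by move=> h; apply: (seqv_agree HSh) => u v uX vY; rewrite /em pfdnK //; apply: h.
Qed.

Lemma liftable_descend A : liftable (lrows A) (lcols A) (em A) ->
  exists Ah, [/\ lrows Ah = lrows A, lcols Ah = lcols A,
    global (lrows A) (lcols A) (em Ah)
    & seqv S (lrows A) (lcols A) (map_entries f (em Ah)) (em A)].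
Proof.
case=> M [hg h]; exists (descend (lrows A) (lcols A) M).
have hM : entin Sh (lrows A) (lcols A) M by case: (hereditary_now hg).
split=> //; first exact: hereditary_seqv (good_ratios_seqv HL) (descend_seqv hM) hg.
apply: (seqv_trans HS _ h); apply: (seqv_agree HS) => u v uX vY.
by rewrite /map_entries /em pfdnK //; apply: hM.
Qed.

Lemma liftable_local A : liftable (lrows A) (lcols A) (em A) -> has_local_lift phi up A.
Proof.
by move=> /liftable_descend [Ah [eX eY hg h]]; exists Ah; apply: local_of_glob.
Qed.

Lemma liftable_global A : liftable (lrows A) (lcols A) (em A) -> has_global_lift phi up A.
Proof.
move=> /liftable_descend [Ah [eX eY hg h]]; have d := hereditary_disj hg.
rewrite -eX -eY in d h hg.
exists Ah; split; first by apply/scaling_equivE; rewrite /= em_map_fmx.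
move=> B [_ m].
have hB := hereditary_minor (good_ratios_seqv HL) (@good_ratios_sub _ _ _ _ _ _) d m hg.
apply: local_of_glob => //; rewrite em_map_fmx; exact: seqv_refl.
Qed.

(** A cross ratio with distinct rows and columns is the signature of an induced four-cycle in a
    strongly equivalent matrix, so the local lift condition there makes it good. *)
Lemma global_of_global Ah : [disjoint lrows Ah & lcols Ah] ->
  global_lift phi up Ah -> global (lrows Ah) (lcols Ah) (em Ah).
Proof.
move=> d hG.
have [hp _ _] := hG Ah (conj (MinorRefl _) (MinorRefl _)).
apply: (hereditary_minor_reach (good_ratios_seqv HL) (pmatrix_her d hp)) => A' m m' h'.
split; first exact: em_inS.
move=> a b x y aX bX xY yY n1 n2 n3 n4.
have hl := hG A' (conj m' m); have d' := hereditary_disj h'.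
have Sm u v : Sh (em A' u v) by apply: pfin_inS.
have [<-|ab] := eqVneq a b; first exact: (good2_same_rows HL).
have [<-|xy] := eqVneq x y; first exact: (good2_same_cols HL).
have nz u v : em A' u v != 0 -> em (map_lmx phi A') u v != 0.
  by rewrite (em_map hphi hup) (lif_eq0 HL).
have [] := hereditary_fund HSh h' aX bX xY yY n1 n2 n3 n4; split=> //.
rewrite (f_cr HL) // -[cr _ a b x y in RHS](local_cr hphi hup hl) ?nz //.
by congr U; rewrite /cr !(em_map hphi hup).
Qed.

Lemma liftable_of_global A : [disjoint lrows A & lcols A] ->
  has_global_lift phi up A -> liftable (lrows A) (lcols A) (em A).
Proof.
move=> d [Ah [/scaling_equivE [/= eX eY h] hG]]; rewrite eX eY in d *.
exists (em Ah); split; first exact: global_of_global.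
by rewrite -em_map_fmx.
Qed.

(** Pivots of the given matrix are followed by the same pivots of its lift, deletions restrict the
    lift, and scalings are absorbed. A liftable matrix thus has no minor without a local lift. *)
Lemma liftable_minor A B : [disjoint lrows A & lcols A] -> minor A B ->
  liftable (lrows A) (lcols A) (em A) -> liftable (lrows B) (lcols B) (em B).
Proof.
move=> d; elim=> // {}B C m ih st /ih [M [hg h]] {ih}.
have dB := minor_disj d m.
case: (minor_step_cases dB st) => [[sX [sY hC]]|[x [y [xX yY aU [eX eY] hC]]]].
  exists M; split; first exact: hereditary_sub (@good_ratios_sub _ _ _ _ _ _) sX sY hg.
  by apply: (seqv_trans HS _ hC); apply: seqv_sub h.
have dn0 : M x y != 0.
  rewrite -(lif_eq0 HL) -?[f _]/(map_entries f M x y) -?(seqv_eq0 h) //; last exact: (hereditary_now hg).1.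
  by apply: contraTneq aU => ->; rewrite unitr0.
have MU : M x y \is a GRing.unit by apply: (psU HSh) dn0; apply: (hereditary_now hg).1.
exists (piv M x y); rewrite eX eY; split; first exact: hereditary_piv.
rewrite map_entries_piv //; apply: (seqv_trans HS (seqv_piv HS dB xX yY _ h)).
  by apply: rmorph_unit.
by apply: (seqv_agree HS) => u v; rewrite -eX -eY; apply: hC.
Qed.

End GlobalLifts.

Theorem theorem3p5 (P Ph : partial_field) (phi : Ph -> P) (up : P -> Ph)
    (hphi : pf_hom phi) (hup : lifting_function phi up)
    (E : finType) (A : lmatrix P E)
    (hdisj : [disjoint lrows A & lcols A]) (hA : pmatrix A) :
  let global := has_global_lift phi up A in
  let obstructed :=
    exists B : lmatrix P E,
      [/\ minor A B, ~ has_local_lift phi up B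
        & is_obstruction B \/ is_obstruction (ltr B)] in
  (global /\ ~ obstructed) \/ (~ global /\ obstructed).
Proof.
move=> global obstructed.
have notboth : obstructed -> ~ global.
  move=> [B [m nB _]] /(liftable_of_global hphi hup hdisj) /(liftable_minor hdisj m) hB.
  exact/nB/(liftable_local hB).
have [ob|nob] := pselect obstructed; first by right; split=> //; apply: notboth.
left; split=> //; apply: (@liftable_global _ _ _ _ _ hphi hup).
apply: (obstruction_free_liftable (ring_lifting hphi hup)).
apply: (unobstructed_ofree hphi hup) => // B m hB; apply: contrapT => nB.
by apply: nob; exists B.
Qed.
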